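(* (1) There are exactly $23{,}392{,}233{,}361{,}244{,}160$ bent functions $\mathbb F_2^6\to\mathbb F_2^2$, and they fall into exactly $9$ extended-affine equivalence classes. (2) There are exactly $121{,}282{,}113{,}886{,}947{,}901{,}440$ bent functions $\mathbb F_2^6\to\mathbb F_2^3$, and they fall into exactly $13$ extended-affine equivalence classes. (3) For $m\in\{1,2\}$ every $(6,m)$-bent function $F$ is extendable, i.e. there is a Boolean bent function $f$ on $\mathbb F_2^6$ such that $\mathbf x\mapsto(F(\mathbf x),f(\mathbf x))$ is a $(6,m+1)$-bent function.
   Context: An $(n,m)$-function $F\colon\mathbb F_2^n\to\mathbb F_2^m$ is bent if $\sum_{\mathbf x\in\mathbb F_2^n}(-1)^{\langle\mathbf b,F(\mathbf x)\rangle\oplus\langle\mathbf a,\mathbf x\rangle}=\pm2^{n/2}$ for all $\mathbf a\in\mathbb F_2^n$ and all $\mathbf b\in\mathbb F_2^m\setminus\{\mathbf0\}$ (standard dot products). $F,F'$ are extended-affine equivalent if $F=A_1\circ F'\circ A_2\oplus A_3$ with $A_1$ a linear permutation of $\mathbb F_2^m$, $A_2$ an affine permutation of $\mathbb F_2^n$ and $A_3\colon\mathbb F_2^n\to\mathbb F_2^m$ affine. *)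

(* Defs.v *)
From HB Require Import structures.
From mathcomp Require Import all_boot all_order all_algebra.
From Stdlib Require Import NArith.
Set Implicit Arguments. Unset Strict Implicit. Unset Printing Implicit Defensive.
Import Order.TTheory GRing.Theory Num.Theory.
Local Open Scope ring_scope.

Definition dot (n : nat) (u v : 'rV['F_2]_n) : 'F_2 := (u *m v^T) 0 0.

Definition sgnF2 (v : 'F_2) : int := if v == 0 then 1 else -1.

Definition walsh (n m : nat) (F : {ffun 'rV['F_2]_n -> 'rV['F_2]_m})
  (a : 'rV['F_2]_n) (b : 'rV['F_2]_m) : int :=
  \sum_(x : 'rV['F_2]_n) sgnF2 (dot b (F x) + dot a x).

(* (n,m)-bent: all Walsh coefficients with b <> 0 equal +-2^(n/2)
   (n is even in all uses below). *)
Definition bent (n m : nat) (F : {ffun 'rV['F_2]_n -> 'rV['F_2]_m}) : bool :=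
  [forall a : 'rV['F_2]_n, forall b : 'rV['F_2]_m,
     (b != 0) ==> ((walsh F a b == (2 ^ n./2)%:Z) || (walsh F a b == - (2 ^ n./2)%:Z))].

Definition EAeq (n m : nat) (F G : {ffun 'rV['F_2]_n -> 'rV['F_2]_m}) : bool :=
  [exists M1 : 'M['F_2]_m, exists M2 : 'M['F_2]_n, exists v : 'rV['F_2]_n,
   exists M3 : 'M['F_2]_(n, m), exists c : 'rV['F_2]_m,
     [&& M1 \in unitmx, M2 \in unitmx &
       [forall x, F x == (G (x *m M2 + v)) *m M1 + (x *m M3 + c)]]].

Definition bent_set (n m : nat) : {set {ffun 'rV['F_2]_n -> 'rV['F_2]_m}} :=
  [set F | bent F].

Definition EA_classes (n m : nat) :=
  [set [set G in bent_set n m | EAeq F G] | F in bent_set n m].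

(* Main.v *)
(** A bent function on F_2^6 has degree at most 3 and, by Parseval, balanced derivatives in all nonzero
    directions. Modulo affine functions it is therefore given by 15 quadratic and 20 cubic coefficients. Given
    a tuple fs, the functions g for which (g, fs) may be bent are enumerated by fixing the coefficients of the
    monomials with least variable x_0, then x_1, and so on. Once the variables up to x_j are treated, the
    derivative of g + k in a direction u supported on x_0, ..., x_j is known up to affine functions for every k
    in the span of fs. A branch is dropped when such a derivative cannot be balanced, and branches
    related by an affine map that preserves the span of fs and the coefficients fixed so far are explored
    only once. At a leaf, an explicit affine map sends (g, fs) to one of a few representatives rep_i. Every
    identification respects sums of an EA-invariant weight Phi supported on bent functions, whence
      sum_g Phi(g, fs) = 128 * sum_i w_i Phi(rep_i)     (128 = number of affine functions)
    with explicit w_i. Iterating from the empty tuple yields 4, 9 and 13 representatives for m = 1, 2, 3.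
    With Phi = [F bent] this identity gives the number of bent functions; with Phi = [F bent and
    not equivalent to any representative], which vanishes on the right-hand side, it shows that the list of
    representatives is complete; and each representative extends because its w_i are not all 0.
    Representatives are told apart by two invariants that count triples (u, v, w) such that the second
    derivatives D_u D_v F, D_v D_w F, D_u D_w F vanish nowhere, respectively vanish at a common point. *)

Require Import Defs.
From Stdlib Require Import NArith.
From HB Require Import structures.
From mathcomp Require Import all_boot all_order all_algebra zify ring.
Set Implicit Arguments. Unset Strict Implicit. Unset Printing Implicit Defensive.
Import GRing.Theory Num.Theory.

(** Ordering by least variable is what permits early pruning. A monomial free of x_0, ..., x_j is
    killed by every derivative in a direction supported on these variables. Such derivatives of g
    therefore depend only on the coefficients fixed so far and on a constant from the affine part,
    which balancedness ignores. Modulo affine functions there are 2^35 candidates g for each tuple,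
    so pruning has to be combined with symmetry. Symmetry is expressed through sums, not sets: a
    partial assignment enters only via the total weight of its completions, and a symmetry is a
    permutation of all functions g that keeps the weight and carries the completions of one
    assignment to those of another. Hence no stabiliser has to be known and no orbit has to be
    complete. The certificates only propose affine maps. Each map is checked before it is used, so
    wrong data can make the computation fail but cannot falsify the identity. *)

Notation bits := (seq bool).

Fixpoint bxor (a b : bits) : bits := match a, b with
  | x :: a', y :: b' => (if x then if y then false else true else y) :: bxor a' b'
  | _, _ => [::] end.
Fixpoint allbits n : seq bits :=
  if n is m.+1 then map (cons false) (allbits m) ++ map (cons true) (allbits m)
  else [:: [::]].
Definition zeros n : bits := nseq n false.
Fixpoint blin (acc : bits) (ms : seq bits) (c : bits) : bits := match ms, c with
  | m :: ms', b :: c' => blin (if b then bxor acc m else acc) ms' c'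
  | _, _ => acc end.

(* A tree of depth n is the truth table of a function of n bits; the root branches on the first variable. *)
Inductive tree := Leaf of bool | Node of tree & tree.

Fixpoint treen n t := match n, t with
  | 0, Leaf _ => true
  | m.+1, Node l r => treen m l && treen m r
  | _, _ => false end.
Fixpoint tadd s t := match s, t with
  | Leaf a, Leaf b => Leaf (a (+) b)
  | Node a b, Node c d => Node (tadd a c) (tadd b d)
  | _, _ => Leaf false end.
Fixpoint tconst n b := if n is m.+1 then Node (tconst m b) (tconst m b) else Leaf b.
Notation tzero n := (tconst n false).
Fixpoint tshift (u : bits) t := match u, t with
  | b :: u', Node l r =>
      if b then Node (tshift u' r) (tshift u' l) else Node (tshift u' l) (tshift u' r)
  | _, _ => t end.
Definition deriv u t := tadd t (tshift u t).
Fixpoint ev t (x : bits) := match t, x with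
  | Leaf b, _ => b
  | Node l r, b :: x' => ev (if b then r else l) x'
  | Node _ _, [::] => false end.
Fixpoint ones t := match t with Leaf b => nat_of_bool b | Node l r => ones l + ones r end.
Fixpoint isc b t := match t with Leaf a => a == b | Node l r => isc b l && isc b r end.
Definition isconst t := isc false t || isc true t.
(* [degle d]: degree strictly below d. *)
Fixpoint degle d n t := match n, t with
  | 0, Leaf b => (0 < d) || ~~ b
  | m.+1, Node l r => degle d m l && degle d.-1 m (tadd l r)
  | _, _ => false end.

(* [monos] lists all monomials of degree below d, [nc] the nonconstant ones; [coefs] and [ncf] read off the
   corresponding coefficients. *)
Fixpoint monos d n : seq tree := match d, n with
  | 0, _ => [::]
  | _, 0 => [:: Leaf true]
  | d'.+1, m.+1 => map (Node (tzero m)) (monos d' m) ++ map (fun t => Node t t) (monos d m) end.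
Fixpoint nc d n : seq tree := match d, n with
  | 0, _ => [::] | _, 0 => [::]
  | d'.+1, m.+1 => map (Node (tzero m)) (monos d' m) ++ map (fun t => Node t t) (nc d m) end.
Fixpoint coefs d n t : bits := match d, n, t with
  | d'.+1, m.+1, Node l r => coefs d' m (tadd l r) ++ coefs d m l
  | d'.+1, 0, Leaf b => [:: b]
  | _, _, _ => [::] end.
Fixpoint ncf d n t : bits := match d, n, t with
  | d'.+1, m.+1, Node l r => coefs d' m (tadd l r) ++ ncf d m l
  | _, _, _ => [::] end.
Fixpoint lin acc (ms : seq tree) (c : bits) := match ms, c with
  | m :: ms', b :: c' => lin (if b then tadd acc m else acc) ms' c'
  | _, _ => acc end.

Fixpoint emb j t := if j is i.+1 then Node (emb i t) (emb i t) else t.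
(* In j + 1 + k variables: the quadratic and cubic monomials with least variable x_j. *)
Definition block j k := map (fun m => emb j (Node (tzero k) m)) (nc 3 k).
(* [W j t]: the derivatives of t in all directions supported on x_0, ..., x_(j-1) are constant. Under [W j],
   [bcode j k] gives the coefficients on [block j k], and [drp j t] below is the restriction of t to x_j = 0. *)
Fixpoint W j t := match j, t with
  | i.+1, Node l r => isconst (tadd l r) && W i l
  | _, _ => true end.
Fixpoint bcode j k t : bits := match j, t with
  | i.+1, Node l r => bcode i k l
  | 0, Node l r => ncf 3 k (tadd l r)
  | _, _ => [::] end.
Fixpoint drp j t := match j, t with
  | 0, Node l r => l
  | i.+1, Node l r => Node (drp i l) (drp i r)
  | _, _ => t end.

(** * Bit vectors *)

Lemma mem_map_cons (T : eqType) (a b : T) c s : (b :: c \in map (cons a) s) = (a == b) && (c \in s).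
Proof.
apply/mapP/andP => [[x hx [-> ->]]|[/eqP -> hc]]; first by rewrite eqxx hx.
by exists c.
Qed.

Lemma mem_allbits n c : (c \in allbits n) = (size c == n).
Proof.
elim: n c => [|n IH] [|b c] //=.
  by rewrite mem_cat; apply/negbTE/negP => /orP [] /mapP [].
by rewrite mem_cat !mem_map_cons eqSS -IH; case: b => //=; rewrite orbF.
Qed.

Lemma uniq_allbits n : uniq (allbits n).
Proof.
elim: n => // n IH /=; rewrite cat_uniq !map_inj_uniq ?IH //=; try by (move=> x y []).
by rewrite andbT; apply/hasPn => x /mapP [y _ ->]; apply/negP => /mapP [].
Qed.

Lemma size_bxor a b : size a = size b -> size (bxor a b) = size a.
Proof. by elim: a b => [|x a IH] [|y b] //= [/IH ->]. Qed.
Lemma bxorC a b : bxor a b = bxor b a.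
Proof. by elim: a b => [|x a IH] [|y b] //=; rewrite IH; case: x; case: y. Qed.
Lemma bxorA a b c : bxor a (bxor b c) = bxor (bxor a b) c.
Proof. by elim: a b c => [|x a IH] [|y b] [|z c] //=; rewrite IH; case: x; case: y; case: z. Qed.
Lemma bxor0 n a : size a = n -> bxor a (zeros n) = a.
Proof. by move=> <-; elim: a => //= x a ->; case: x. Qed.
Lemma bxorK n a : size a = n -> bxor a a = zeros n.
Proof. by move=> <-; elim: a => //= x a ->; case: x. Qed.
Lemma bxorKK a b : size a = size b -> bxor (bxor a b) b = a.
Proof. by move=> h; rewrite -bxorA (bxorK (erefl _)) bxor0. Qed.
Lemma bxor_cat a b c d : size a = size c -> bxor (a ++ b) (c ++ d) = bxor a c ++ bxor b d.
Proof. by elim: a c => [|x a IH] [|y c] //= [/IH ->]. Qed.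
Lemma size_zeros n : size (zeros n) = n. Proof. exact: size_nseq. Qed.

Lemma size_blin n acc ms c : size acc = n -> all (fun m => size m == n) ms -> size (blin acc ms c) = n.
Proof.
elim: ms acc c => [|m ms IH] acc [|b c] //= ha /andP [/eqP hm hms].
by apply: IH => //; case: b; rewrite ?size_bxor ?hm.
Qed.

Lemma blinE n acc ms c : size acc = n -> all (fun m => size m == n) ms ->
  blin acc ms c = bxor acc (blin (zeros n) ms c).
Proof.
elim: ms acc c => [|m ms IH] acc c ha; first by case: c => [|b c] _ /=; rewrite bxor0.
case: c => [|b c] /=; first by rewrite bxor0.
move=> /andP [/eqP hm hms]; case: b; rewrite IH ?size_bxor ?hm ?size_zeros //.
by rewrite [in RHS]IH ?size_bxor ?hm ?size_zeros // bxorA [bxor (zeros n) m]bxorC bxor0.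
Qed.

Lemma bxorACA a b c d : bxor (bxor a b) (bxor c d) = bxor (bxor a c) (bxor b d).
Proof. by rewrite -!bxorA [bxor b (bxor c d)]bxorA [bxor b c]bxorC -bxorA. Qed.
Lemma bxor0l n a : size a = n -> bxor (zeros n) a = a.
Proof. by move=> ha; rewrite bxorC bxor0. Qed.

Lemma blin_cons n m ms b c : size m = n -> all (fun m => size m == n) ms ->
  blin (zeros n) (m :: ms) (b :: c) = bxor (if b then m else zeros n) (blin (zeros n) ms c).
Proof.
move=> hm hms /=.
have -> : (if b then bxor (zeros n) m else zeros n) = if b then m else zeros n by case: b; rewrite ?bxor0l.
by rewrite (blinE (n := n)) //; case: b; rewrite ?size_zeros.
Qed.

Lemma blinD n ms c c' : all (fun m => size m == n) ms -> size c = size ms -> size c' = size ms ->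
  blin (zeros n) ms (bxor c c') = bxor (blin (zeros n) ms c) (blin (zeros n) ms c').
Proof.
elim: ms c c' => [|m ms IH] [|b c] [|b' c'] //; first by rewrite /= bxor0 ?size_zeros.
rewrite [all _ _]/= => /andP [/eqP hm hms] [hc] [hc'].
have -> : bxor (b :: c) (b' :: c') = (b (+) b') :: bxor c c' by case: b; case: b'.
rewrite !blin_cons // IH // bxorACA; congr (bxor _ _).
by case: b; case: b'; rewrite /= ?(bxorK hm) ?bxor0 ?bxor0l ?size_zeros ?hm.
Qed.

(** * Trees *)

Fixpoint teq s t := match s, t with
  | Leaf a, Leaf b => a == b
  | Node a b, Node c d => teq a c && teq b d
  | _, _ => false end.
Lemma teqP : Equality.axiom teq.
Proof.
elim=> [a|l IHl r IHr] [b|l' r'] /=; try by constructor.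
  by apply: (iffP eqP) => [->|[]].
by apply: (iffP andP) => [[/IHl -> /IHr ->]|[/IHl -> /IHr ->]].
Qed.
HB.instance Definition _ := hasDecEq.Build tree teqP.

Lemma eq_Node a b c d : (Node a b == Node c d) = (a == c) && (b == d).
Proof. by []. Qed.
Lemma taddC s t : tadd s t = tadd t s.
Proof. by elim: s t => [a|l IHl r IHr] [b|l' r'] //=; rewrite ?IHl ?IHr // addbC. Qed.
Lemma treen_add n s t : treen n s -> treen n t -> treen n (tadd s t).
Proof.
elim: n s t => [|n IH] [a|l r] [b|l' r'] //= /andP [? ?] /andP [? ?].
by rewrite !IH.
Qed.
Lemma treen_const n b : treen n (tconst n b).
Proof. by elim: n => //= n ->. Qed.
Lemma treen_shift n u t : treen n t -> treen n (tshift u t).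
Proof.
elim: n u t => [|n IH] [|b u] [a|l r] //= /andP [? ?].
by case: b; rewrite /= !IH.
Qed.
Lemma treen_deriv n u t : treen n t -> treen n (deriv u t).
Proof. by move=> h; rewrite treen_add ?treen_shift. Qed.
#[local] Hint Resolve treen_add treen_const treen_shift treen_deriv : core.
Lemma taddA n s t w : treen n s -> treen n t -> treen n w -> tadd s (tadd t w) = tadd (tadd s t) w.
Proof.
elim: n s t w => [|n IH] [a|l r] [b|l' r'] [c|l2 r2] //=; first by rewrite addbA.
by do 3![case/andP => ? ?]; rewrite !IH.
Qed.
Lemma taddACA n a b c d : treen n a -> treen n b -> treen n c -> treen n d ->
  tadd (tadd a b) (tadd c d) = tadd (tadd a c) (tadd b d).
Proof.
move=> ha hb hc hd.
by rewrite -!(taddA (n := n)) ?[tadd b (tadd c d)](taddA (n := n)) ?[tadd b c]taddC -?(taddA (n := n)) ; auto.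
Qed.
Lemma tadd0 n t : treen n t -> tadd t (tzero n) = t.
Proof. by elim: n t => [|n IH] [a|l r] //= => [_|/andP [? ?]]; rewrite ?addbF ?IH. Qed.
Lemma tadd0l n t : treen n t -> tadd (tzero n) t = t.
Proof. by move=> h; rewrite taddC tadd0. Qed.
Lemma taddK n t : treen n t -> tadd t t = tzero n.
Proof. by elim: n t => [|n IH] [a|l r] //= => [_|/andP [? ?]]; rewrite ?addbb ?IH. Qed.
Lemma taddKK n s t : treen n s -> treen n t -> tadd (tadd s t) t = s.
Proof. by move=> hs ht; rewrite -(taddA (n := n)) // (taddK ht) tadd0. Qed.
Lemma tadd_const n a b : tadd (tconst n a) (tconst n b) = tconst n (a (+) b).
Proof. by elim: n => //= n ->. Qed.

Lemma iscP n b t : treen n t -> isc b t = (t == tconst n b).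
Proof.
elim: n t => [|n IH] [a|l r] //= /andP [hl hr].
by rewrite !IH.
Qed.
Lemma isconstP n t : treen n t -> reflect (exists b, t = tconst n b) (isconst t).
Proof.
move=> ht; rewrite /isconst !(iscP _ ht); apply: (iffP orP) => [[] /eqP ->|[[] ->]]; rewrite ?eqxx; first [by eexists | by auto].
Qed.
Lemma isconst_const n b : isconst (tconst n b).
Proof. by apply/(isconstP (n := n)) => //; exists b. Qed.
Lemma isconst_add n s t : treen n s -> treen n t -> isconst s -> isconst (tadd s t) = isconst t.
Proof.
move=> hs ht /(isconstP hs) [b ->].
apply/idP/idP => /(isconstP (n := n)) h.
  have [|c hc] := h; first by auto.
  apply/(isconstP ht); exists (b (+) c).
  by rewrite -tadd_const -hc taddC (taddC (tconst _ _)) (taddKK (n := n)).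
have [//|c ->] := h; rewrite tadd_const; exact: isconst_const.
Qed.
Lemma tconst_inj n a b : tconst n a = tconst n b -> a = b.
Proof. by elim: n => [[]|n IH [/IH]]. Qed.

Lemma treen_lin n acc ms c : treen n acc -> all (treen n) ms -> treen n (lin acc ms c).
Proof.
elim: ms acc c => [|m ms IH] acc [|b c] //= ha /andP [hm hms].
by apply: IH => //; case: b; auto.
Qed.
#[local] Hint Resolve treen_lin : core.

Lemma linE n acc ms c : treen n acc -> all (treen n) ms ->
  lin acc ms c = tadd acc (lin (tzero n) ms c).
Proof.
elim: ms acc c => [|m ms IH] acc c ha; first by case: c => [|b c] _ /=; rewrite (tadd0 ha).
case: c => [|b c] /=; first by rewrite (tadd0 ha).
move=> /andP [hm hms]; case: b; rewrite IH //; last by auto.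
by rewrite [in RHS]IH ?(tadd0l hm) // (taddA (n := n)) //; auto.
Qed.

Lemma lin_cat acc ms1 ms2 c1 c2 : size c1 = size ms1 ->
  lin acc (ms1 ++ ms2) (c1 ++ c2) = lin (lin acc ms1 c1) ms2 c2.
Proof. by elim: ms1 acc c1 => [|m ms IH] acc [|b c] //= [h]; rewrite IH. Qed.

Lemma lin_map n (f : tree -> tree) acc ms c :
  (forall s t, treen n s -> treen n t -> f (tadd s t) = tadd (f s) (f t)) ->
  treen n acc -> all (treen n) ms -> lin (f acc) (map f ms) c = f (lin acc ms c).
Proof.
move=> hf; elim: ms acc c => [|m ms IH] acc [|b c] //= ha /andP [hm hms].
by case: b; rewrite -?hf // IH //; auto.
Qed.

Lemma blin_map n (q : tree -> bits) acc ms c :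
  (forall s t, treen n s -> treen n t -> q (tadd s t) = bxor (q s) (q t)) ->
  treen n acc -> all (treen n) ms -> blin (q acc) (map q ms) c = q (lin acc ms c).
Proof.
move=> hf; elim: ms acc c => [|m ms IH] acc [|b c] //= ha /andP [hm hms].
by case: b; rewrite -?hf // IH //; auto.
Qed.

(** * Algebraic degree and algebraic normal form *)

Definition deg d n t := treen n t && degle d n t.
Lemma deg_treen d n t : deg d n t -> treen n t. Proof. by case/andP. Qed.
#[local] Hint Resolve deg_treen : core.
Lemma deg_Node d n l r :
  deg d n.+1 (Node l r) = [&& treen n l, treen n r, deg d n l & deg d.-1 n (tadd l r)].
Proof.
rewrite /deg /=; case hl: (treen n l); case hr: (treen n r) => //=.
by rewrite (treen_add hl hr).
Qed.
Lemma deg_add d n s t : deg d n s -> deg d n t -> deg d n (tadd s t).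
Proof.
elim: n d s t => [|n IH] d [a|l r] [b|l' r'] //=; rewrite ?deg_Node //.
  by rewrite /deg /=; case: a; case: b; case: d.
case/and4P => ? ? h1 h2 /and4P [? ? h3 h4]; rewrite !treen_add //=.
by rewrite IH //= (taddACA (n := n)) // IH.
Qed.
Lemma deg_zero d n : deg d n (tzero n).
Proof.
elim: n d => [|n IH] d; first by rewrite /deg /= orbT.
by rewrite deg_Node !treen_const IH (taddK (treen_const n false)) IH.
Qed.
Lemma deg_const d n b : deg d.+1 n (tconst n b).
Proof.
elim: n d b => [|n IH] d b //=.
by rewrite deg_Node !treen_const IH (taddK (treen_const n b)) deg_zero.
Qed.
Lemma deg0 n t : deg 0 n t -> t = tzero n.
Proof.
elim: n t => [|n IH] [a|l r] //; first by case: a.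
by rewrite deg_Node => /and4P [hl hr /IH -> /IH]; rewrite (tadd0l hr) => ->.
Qed.
Lemma deg_mono d d' n t : d <= d' -> deg d n t -> deg d' n t.
Proof.
elim: n d d' t => [|n IH] d d' [a|l r] hd //; rewrite ?deg_Node.
  by rewrite /deg /= => /orP [h|->]; rewrite ?orbT // (leq_trans h hd).
case/and4P => -> -> h1 h2; rewrite (IH d) //= (IH d.-1) //.
by rewrite -!subn1 leq_sub2r.
Qed.
Lemma all_monos d n : all (deg d n) (monos d n).
Proof.
elim: n d => [|n IH] [|d] //=.
rewrite all_cat !all_map; apply/andP; split; apply/allP => m hm; rewrite [preim _ _ _]/= deg_Node.
  have h := allP (IH d) _ hm; have ht := deg_treen h.
  by rewrite treen_const ht deg_zero (tadd0l ht).
have h := allP (IH d.+1) _ hm; have ht := deg_treen h.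
by rewrite ht h (taddK ht) deg_zero.
Qed.
Lemma all_nc d n : all (deg d n) (nc d n).
Proof.
elim: n d => [|n IH] [|d] //=.
rewrite all_cat !all_map; apply/andP; split; apply/allP => m hm; rewrite [preim _ _ _]/= deg_Node.
  have h := allP (all_monos d n) _ hm; have ht := deg_treen h.
  by rewrite treen_const ht deg_zero (tadd0l ht).
have h := allP (IH d.+1) _ hm; have ht := deg_treen h.
by rewrite ht h (taddK ht) deg_zero.
Qed.
Lemma deg_lin d n acc ms c : deg d n acc -> all (deg d n) ms -> deg d n (lin acc ms c).
Proof.
elim: ms acc c => [|m ms IH] acc [|b c] //= ha /andP [hm hms].
by apply: IH => //; case: b => //; apply: deg_add.
Qed.
Lemma sub_deg d n s : all (deg d n) s -> all (treen n) s.
Proof. by apply: sub_all => t /deg_treen. Qed.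

Lemma size_coefs d n t : treen n t -> size (coefs d n t) = size (monos d n).
Proof.
elim: n d t => [|n IH] [|d] [a|l r] //= /andP [hl hr].
by rewrite !size_cat !size_map !IH; auto.
Qed.
Lemma size_ncf d n t : treen n t -> size (ncf d n t) = size (nc d n).
Proof.
elim: n d t => [|n IH] [|d] [a|l r] //= /andP [hl hr].
by rewrite !size_cat !size_map !size_coefs ?IH; auto.
Qed.
Lemma coefsD d n s t : treen n s -> treen n t -> coefs d n (tadd s t) = bxor (coefs d n s) (coefs d n t).
Proof.
elim: n d s t => [|n IH] [|d] [a|l r] [b|l' r'] //=; first by case: a; case: b.
move=> /andP [hl hr] /andP [hl' hr'].
by rewrite bxor_cat ?size_coefs -?IH //; auto; rewrite (taddACA (n := n)).
Qed.
Lemma ncfD d n s t : treen n s -> treen n t -> ncf d n (tadd s t) = bxor (ncf d n s) (ncf d n t).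
Proof.
elim: n d s t => [|n IH] [|d] [a|l r] [b|l' r'] //= /andP [hl hr] /andP [hl' hr'].
by rewrite bxor_cat ?size_coefs -?coefsD -?IH //; auto; rewrite (taddACA (n := n)).
Qed.
Lemma coefs0 d n : coefs d n (tzero n) = zeros (size (monos d n)).
Proof.
have h : coefs d n (tzero n) = bxor (coefs d n (tzero n)) (coefs d n (tzero n)).
  by rewrite -coefsD // (taddK (treen_const n false)).
by rewrite h (bxorK (size_coefs _ (treen_const _ _))).
Qed.
Lemma ncf_const d n b : ncf d n (tconst n b) = zeros (size (nc d n)).
Proof.
elim: n d => [|n IH] [|d] //=.
by rewrite (taddK (treen_const n b)) coefs0 IH size_cat !size_map /zeros nseqD.
Qed.

(** The expansion f = f_0 + x_0 (f_0 + f_1) into the two halves of f: [Node (tzero n) m] is the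
    product x_0 m, and [Node t t] is t seen as a function that does not involve x_0. *)
Lemma lin_nodes n ms1 ms2 c1 c2 : size c1 = size ms1 ->
  all (treen n) ms1 -> all (treen n) ms2 ->
  lin (tzero n.+1) (map (Node (tzero n)) ms1 ++ map (fun t => Node t t) ms2) (c1 ++ c2) =
  Node (lin (tzero n) ms2 c2) (tadd (lin (tzero n) ms1 c1) (lin (tzero n) ms2 c2)).
Proof.
move=> h1 hm1 hm2 /=; rewrite lin_cat ?size_map //.
have -> : lin (Node (tzero n) (tzero n)) (map (Node (tzero n)) ms1) c1 = Node (tzero n) (lin (tzero n) ms1 c1).
  apply: (lin_map (n := n) (f := Node (tzero n))) => // s t hs ht /=.
  by rewrite (taddK (treen_const n false)).
rewrite (linE (n := n.+1)) /=; last 2 first.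
- by rewrite treen_const treen_lin.
- by rewrite all_map; apply: sub_all hm2 => t /= ->.
rewrite (lin_map (n := n) (f := fun t => Node t t)) //= tadd0l //; auto.
Qed.

Lemma lin_cons n m ms b c : treen n m -> all (treen n) ms ->
  lin (tzero n) (m :: ms) (b :: c) = tadd (if b then m else tzero n) (lin (tzero n) ms c).
Proof.
move=> hm hms /=.
have -> : (if b then tadd (tzero n) m else tzero n) = if b then m else tzero n by case: b; rewrite ?tadd0l.
by rewrite (linE (n := n)) //; case: b.
Qed.

Lemma lin_bxor n ms c c' : all (treen n) ms -> size c = size ms -> size c' = size ms ->
  lin (tzero n) ms (bxor c c') = tadd (lin (tzero n) ms c) (lin (tzero n) ms c').
Proof.
elim: ms c c' => [|m ms IH] [|b c] [|b' c'] //; first by rewrite /= tadd0.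
rewrite [all _ _]/= => /andP [hm hms] [hc] [hc'].
have -> : bxor (b :: c) (b' :: c') = (b (+) b') :: bxor c c' by case: b; case: b'.
rewrite !lin_cons // IH // (taddACA (n := n)); try by [case: b | case: b' | exact: treen_lin].
by congr (tadd _ _); case: b; case: b'; rewrite /= ?(taddK hm) ?tadd0 ?tadd0l.
Qed.

#[local] Hint Resolve sub_deg all_monos all_nc : core.

Lemma treen_monos d n : all (treen n) (monos d n).
Proof. exact: sub_deg (all_monos d n). Qed.
Lemma treen_nc d n : all (treen n) (nc d n).
Proof. exact: sub_deg (all_nc d n). Qed.
#[local] Hint Resolve treen_monos treen_nc : core.

Lemma size_cat_split (T : Type) (c : seq T) a b : size c = a + b ->
  exists c1 c2, [/\ c = c1 ++ c2, size c1 = a & size c2 = b].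
Proof.
move=> h; exists (take a c), (drop a c).
by rewrite cat_take_drop size_takel ?size_drop h ?addKn ?leq_addr.
Qed.

Lemma tadd_eq n s t w : treen n s -> treen n t -> treen n w -> (tadd s t == w) = (s == tadd w t).
Proof.
move=> hs ht hw; apply/eqP/eqP => [<-|->]; first by rewrite (taddKK hs ht).
by rewrite (taddKK hw ht).
Qed.

(** Existence and uniqueness of the algebraic normal form in one Boolean equation. In the recursion
    the part with x_0 is read off [tadd l r], whose degree is one lower, and the part without x_0
    off [l]. *)
Lemma coefsP d n t c : deg d n t -> size c = size (monos d n) ->
  (t == lin (tzero n) (monos d n) c) = (c == coefs d n t).
Proof.
elim: n d t c => [|n IH] [|d] [a|l r] // c.
- by move=> /deg0 -> /size0nil ->.
- by case: c => [|x [|y c]] //= _ _; case: a; case: x.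
- by move=> /deg0 -> /size0nil ->; rewrite /= !eqxx.
rewrite deg_Node => /and4P [hl hr h1 h2]; rewrite [monos _ _]/= size_cat !size_map => /size_cat_split.
move=> [c1 [c2 [-> hc1 hc2]]]; rewrite lin_nodes // [coefs _ _ _]/= eqseq_cat ?size_coefs ?hc1 //; auto.
rewrite -!IH //; set y1 := lin _ _ c1; set y2 := lin _ _ c2.
have t1 : treen n y1 by rewrite treen_lin.
have t2 : treen n y2 by rewrite treen_lin.
rewrite eq_Node andbC; case: (l =P y2) => [->|_]; rewrite ?andbF ?andbT //.
by rewrite [tadd y2 r]taddC (tadd_eq hr t2 t1).
Qed.

Lemma ncfP d n t c : deg d n t -> size c = size (nc d n) ->
  isconst (tadd t (lin (tzero n) (nc d n) c)) = (c == ncf d n t).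
Proof.
elim: n d t c => [|n IH] [|d] [a|l r] // c.
- by move=> _ /size0nil ->; case: a.
- by move=> _ /size0nil ->; case: a.
- by move=> /deg0 -> /size0nil ->; rewrite [lin _ _ _]/= (taddK (treen_const _ _)) isconst_const.
rewrite deg_Node => /and4P [hl hr h1 h2]; rewrite [nc _ _]/= size_cat !size_map => /size_cat_split.
move=> [c1 [c2 [-> hc1 hc2]]]; rewrite lin_nodes // [ncf _ _ _]/= eqseq_cat ?size_coefs ?hc1 //; auto.
rewrite -IH // -coefsP //; set y1 := lin _ _ c1; set y2 := lin _ _ c2.
have t1 : treen n y1 by rewrite treen_lin.
have t2 : treen n y2 by rewrite treen_lin.
have tl : treen n (tadd l y2) by auto.
have tr : treen n (tadd r (tadd y1 y2)) by auto.
(* The right-hand side is the sum of the two halves of the function under test. That function is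
   constant iff its halves agree, which is the condition on [c1], and its left half is constant,
   which is the induction hypothesis for [c2]. *)
have e : tadd (tadd l r) y1 = tadd (tadd l y2) (tadd r (tadd y1 y2)).
  rewrite (taddACA (n := n)) //; auto.
  by rewrite [tadd y2 _]taddC (taddKK t1 t2).
rewrite (_ : (tadd l r == y1) = (tadd l y2 == tadd r (tadd y1 y2))); last first.
  apply/eqP/eqP => h.
    by apply/eqP; rewrite -(tadd0l tr) -(tadd_eq tl tr) ?treen_const // -e h (taddK t1).
  by move: e; rewrite h (taddK tr) => e; apply/eqP; rewrite -(tadd0l t1) -(tadd_eq _ t1) ?treen_const ?e //; auto.
apply/idP/andP => [/(isconstP (n := n.+1)) h|[/eqP e1 /(isconstP tl) [b hb]]].
  by have [|b [-> ->]] := h; first (by apply/andP); by rewrite eqxx isconst_const.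
by rewrite [tadd _ _]/= -e1 hb; exact: (isconst_const n.+1 b).
Qed.

Lemma isconst_ncf d n t : deg d n t -> isconst (tadd t (lin (tzero n) (nc d n) (ncf d n t))).
Proof. by move=> h; rewrite ncfP ?eqxx ?size_ncf ?(deg_treen h). Qed.

Lemma ncf_lin d n c : size c = size (nc d n) -> ncf d n (lin (tzero n) (nc d n) c) = c.
Proof.
move=> h; apply/esym/eqP; rewrite -ncfP //; last by rewrite deg_lin ?deg_zero.
by rewrite (taddK (n := n)) ?isconst_const // treen_lin.
Qed.

(** * The condition [W] and the coordinates of a block *)

Lemma W_add j n s t : treen n s -> treen n t -> W j s -> W j (tadd s t) = W j t.
Proof.
elim: j n s t => [|j IH] [|n] [a|l r] [b|l' r'] //= /andP [hl hr] /andP [hl' hr'] /andP [h1 h2].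
rewrite (IH n) // (taddACA (n := n)) // (isconst_add (n := n)) //; auto.
Qed.

Lemma W_Node j l r : W j.+1 (Node l r) = isconst (tadd l r) && W j l.
Proof. by []. Qed.

Lemma treen_emb j n t : treen n t -> treen (j + n) (emb j t).
Proof. by move=> h; elim: j => //= j ->. Qed.
Lemma embD j n s t : treen n s -> treen n t -> emb j (tadd s t) = tadd (emb j s) (emb j t).
Proof. by move=> hs ht; elim: j => //= j ->. Qed.
Lemma emb0 j n : emb j (tzero n) = tzero (j + n).
Proof. by elim: j => //= j ->. Qed.
Lemma deg_emb d j n t : deg d n t -> deg d (j + n) (emb j t).
Proof.
move=> h; elim: j => //= j IH; rewrite deg_Node IH (deg_treen IH).
by rewrite (taddK (deg_treen IH)) deg_zero.
Qed.

Lemma lin_block j k c : lin (tzero (j + k.+1)) (block j k) c = emb j (Node (tzero k) (lin (tzero k) (nc 3 k) c)).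
Proof.
rewrite -emb0 -[tzero k.+1]/(Node (tzero k) (tzero k)).
apply: (lin_map (n := k) (f := fun m => emb j (Node (tzero k) m))) => // s t hs ht.
rewrite -(embD (n := k.+1) _) /=; try by rewrite treen_const ?hs ?ht.
by rewrite (taddK (treen_const _ _)).
Qed.

Lemma all_block j k : all (deg 4 (j + k.+1)) (block j k).
Proof.
rewrite all_map; apply: sub_all (all_nc 3 k) => m hm /=.
by apply: deg_emb; rewrite deg_Node treen_const (deg_treen hm) deg_zero (tadd0l (deg_treen hm)).
Qed.
Lemma treen_block j k : all (treen (j + k.+1)) (block j k).
Proof. exact: sub_deg (all_block j k). Qed.
Lemma size_block j k : size (block j k) = size (nc 3 k).
Proof. exact: size_map. Qed.

(** Passing from [W j] to [W j.+1] adds one requirement: on x_0 = ... = x_(j-1) = 0 the derivative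
    in direction x_j is constant. That derivative has degree at most 2 in the k later variables, and
    adding the block with coefficients [c] adds the combination of [nc 3 k] with the same
    coefficients, so exactly one [c] works. *)
Lemma splitW j k d c : deg 4 (j + k.+1) d -> size c = size (nc 3 k) ->
  W j.+1 (tadd d (lin (tzero (j + k.+1)) (block j k) c)) = W j d && (c == bcode j k d).
Proof.
rewrite lin_block => hd hc; elim: j d hd => [|j IH] [a|l r] //; rewrite ?addSn ?add0n deg_Node => /and4P [hl hr h1 h2].
  rewrite /= andbT tadd0 // -ncfP // (taddA (n := k)) //; auto.
rewrite [emb _ _]/=; set y := emb j _; rewrite [tadd _ _]/= !W_Node.
have ty : treen (j + k.+1) y.
  by apply: treen_emb; rewrite /= treen_const treen_lin.
by rewrite IH // (taddACA (n := j + k.+1)) // (taddK ty) tadd0 ?andbA //; apply: treen_add.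
Qed.

(** * Derivatives *)

Lemma tshiftD n u s t : treen n s -> treen n t -> tshift u (tadd s t) = tadd (tshift u s) (tshift u t).
Proof.
elim: n u s t => [|n IH] [|b u] [a|l r] [c|l' r'] //= /andP [? ?] /andP [? ?].
by case: b; rewrite !IH.
Qed.
Lemma derivD n u s t : treen n s -> treen n t -> deriv u (tadd s t) = tadd (deriv u s) (deriv u t).
Proof.
by move=> hs ht; rewrite /deriv (tshiftD u hs ht) (taddACA (n := n)); auto.
Qed.
Lemma tshift_const n u b : tshift u (tconst n b) = tconst n b.
Proof. by elim: n u => [|n IH] [|c u] //=; rewrite !IH; case: c. Qed.
Lemma deriv_const n u b : deriv u (tconst n b) = tzero n.
Proof. by rewrite /deriv tshift_const (taddK (treen_const n b)). Qed.
Lemma tshift0 n k t : treen n t -> tshift (zeros k) t = t.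
Proof. by elim: n k t => [|n IH] [|k] [a|l r] //= /andP [? ?]; rewrite -/(zeros k) !IH. Qed.
Lemma tshiftK n u t : treen n t -> tshift u (tshift u t) = t.
Proof. by elim: n u t => [|n IH] [|[] u] [a|l r] //= /andP [? ?]; rewrite !IH. Qed.
Lemma tshift_deriv n u t : treen n t -> tshift u (deriv u t) = deriv u t.
Proof.
by move=> ht; rewrite /deriv (tshiftD u ht) ?(tshiftK u ht); auto; rewrite taddC.
Qed.

Lemma treen_drp n j t : treen n.+1 t -> j <= n -> treen n (drp j t).
Proof.
by elim: j n t => [|j IH] [|n] [a|l r] //= /andP [hl hr] h; rewrite ?IH.
Qed.
Lemma drpD n j s t : treen n.+1 s -> treen n.+1 t -> j <= n -> drp j (tadd s t) = tadd (drp j s) (drp j t).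
Proof.
elim: j n s t => [|j IH] [|n] [a|l r] [b|l' r'] //= /andP [hl hr] /andP [hl' hr'] h.
by rewrite !(IH n).
Qed.
Lemma drp_const n j b : j <= n -> drp j (tconst n.+1 b) = tconst n b.
Proof. by elim: j n => [|j IH] [|n] // h; rewrite -[RHS]/(Node (tconst n b) (tconst n b)) -(IH n h). Qed.
Lemma deg_drp d n j t : deg d n.+1 t -> j <= n -> deg d n (drp j t).
Proof.
elim: j d n t => [|j IH] d [|n] [a|l r] //; rewrite deg_Node => /and4P [hl hr h1 h2] hj //.
by rewrite [drp _ _]/= deg_Node !treen_drp // IH // -(drpD (n := n)) // IH.
Qed.

(** Shift and derivative need a joint induction: when u moves x_0, a half of the derivative is D l +
    shift (l + r), and the bound on the second summand is the shift claim for the lower degree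
    function l + r. *)
Lemma deg_shift_deriv d n u t : deg d n t -> deg d n (tshift u t) /\ deg d.-1 n (deriv u t).
Proof.
elim: n d u t => [|n IH] d [|b u] [a|l r] // h.
- by rewrite /deriv /= addbb; split => //; rewrite /deg /= orbT.
- by rewrite /deriv /= addbb; split => //; rewrite /deg /= orbT.
- by rewrite /deriv (taddK (deg_treen h)); split => //; apply: deg_zero.
have {h} := h; rewrite deg_Node => /and4P [hl hr h1 h2].
have [s1 d1] := IH _ u _ h1; have [s2 d2] := IH _ u _ h2.
have h3 : deg d n r.
  have := deg_add h1 (deg_mono (leq_pred d) h2).
  by rewrite taddC [tadd l r]taddC (taddKK hr hl).
have [s3 d3] := IH _ u _ h3.
have e2 : tshift u (tadd l r) = tadd (tshift u l) (tshift u r) by rewrite (tshiftD _ hl hr).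
have e3 : deriv u (tadd l r) = tadd (deriv u l) (deriv u r) by rewrite (derivD _ hl hr).
rewrite /deriv; case: b; rewrite [tshift _ _]/= [tadd _ _]/= !deg_Node; split.
- by rewrite !treen_shift //= s3 taddC -e2.
- have e4 : tadd l (tshift u r) = tadd (deriv u l) (tshift u (tadd l r)).
    have [sl sr] := (treen_shift u hl, treen_shift u hr).
    by rewrite e2 /deriv -(taddA hl sl (treen_add sl sr)) (taddA sl sl sr) (taddK sl) (tadd0l sr).
  rewrite !treen_add ?treen_shift //=; apply/andP; split.
    by rewrite e4; apply: deg_add.
  rewrite (taddACA (n := n)) ?treen_shift // [tadd (tshift u r) _]taddC -e2.
  exact: d2.
- by rewrite !treen_shift //= s1 -e2.
rewrite !treen_add ?treen_shift //= -/(deriv u l) -/(deriv u r) d1 -e3.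
exact: d2.
Qed.
Lemma deg_deriv d n u t : deg d n t -> deg d.-1 n (deriv u t).
Proof. by case/(deg_shift_deriv u). Qed.

Lemma ones_shift n u t : treen n t -> ones (tshift u t) = ones t.
Proof.
by elim: n u t => [|n IH] [|[] u] [a|l r] //= /andP [? ?]; rewrite !IH // addnC.
Qed.
(** The direction u has u_j = 1, so of x and x + u exactly one satisfies x_j = 0. A derivative in
    direction u is invariant under u, hence has twice as many ones as its restriction to x_j = 0. *)
Lemma ones_drp j n w t v : treen n.+1 t -> size w = j -> j <= n ->
  ones t = ones (drp j t) + ones (drp j (tshift (w ++ true :: v) t)).
Proof.
elim: j n w t => [|j IH] [|n] [|b w] [a|l r] //= /andP [hl hr].
- by move=> _ _; rewrite (ones_shift (n := 0)).
- by move=> _ _; rewrite (ones_shift (n := n.+1)).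
by move=> [hw] hj; case: b => /=; rewrite (IH n w l) ?(IH n w r) //; lia.
Qed.
Lemma ones_deriv n w v t : treen n.+1 t -> size w <= n ->
  ones (deriv (w ++ true :: v) t) = 2 * ones (drp (size w) (deriv (w ++ true :: v) t)).
Proof.
move=> ht hw; rewrite (ones_drp v (treen_deriv _ ht) (erefl (size w)) hw).
by rewrite (tshift_deriv _ ht) mul2n addnn.
Qed.

Lemma ones_compl n t b : treen n t -> ones (tadd t (tconst n b)) = if b then 2 ^ n - ones t else ones t.
Proof.
case: b => ht; last by rewrite tadd0.
suff : ones (tadd t (tconst n true)) + ones t = 2 ^ n by lia.
elim: n t ht => [|n IH] [[]|l r] //= /andP [hl hr].
by rewrite expnS mul2n -addnn -{1}(IH _ hl) -(IH _ hr); lia.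
Qed.

(** Together with [deriv_W] this describes [W j] by the subspace spanned by the first j unit vectors
    instead of by the recursion on halves. In that form its behaviour under affine maps becomes
    visible. *)
Lemma W_deriv j n w k t : treen n t -> W j t -> size w = j -> isconst (deriv (w ++ zeros k) t).
Proof.
elim: j n w t => [|j IH] n w t ht hW.
  move/size0nil ->; rewrite /deriv (tshift0 _ ht) (taddK ht); exact: isconst_const.
case: n t ht hW => [|n] [a|l r] //.
  by case: w => [|b w] //= _ _ [_]; rewrite /deriv /= addbb.
case: w => [|b w] //= /andP [hl hr] /andP [h1 h2] [hw]; have hc := IH n w l hl h2 hw.
case/(isconstP (treen_add hl hr)): h1 => c hc1.
have er : r = tadd l (tconst n c) by rewrite -hc1 taddC [tadd l r]taddC (taddKK hr hl).
case/(isconstP (treen_deriv _ hl)): hc => c2 hc2.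
have dr : deriv (w ++ zeros k) r = tconst n c2.
  by rewrite er (derivD _ hl) // deriv_const hc2 tadd_const addbF.
rewrite /deriv; case: b => /=.
  have -> : tadd l (tshift (w ++ zeros k) r) = tconst n (c2 (+) c).
    rewrite er (tshiftD _ hl) // tshift_const (taddA (n := n)) ?treen_shift // -/(deriv _ l) hc2.
    by rewrite tadd_const.
  have -> : tadd r (tshift (w ++ zeros k) l) = tconst n (c2 (+) c).
    rewrite er taddC (taddA (n := n)) ?treen_shift // [tadd (tshift _ _) l]taddC -/(deriv _ l) hc2.
    by rewrite tadd_const.
  exact: (isconst_const n.+1).
rewrite -/(deriv _ l) -/(deriv _ r) hc2 dr; exact: (isconst_const n.+1).
Qed.

Lemma deriv_W j n t : treen n t -> j <= n ->
  (forall w, size w = j -> isconst (deriv (w ++ zeros (n - j)) t)) -> W j t.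
Proof.
elim: j n t => [|j IH] [|n] [a|l r] // ht hj h; have /andP [hl hr] := ht.
apply/andP; split.
  have := h (true :: zeros j); rewrite /= size_zeros => /(_ erefl).
  rewrite subSS /zeros -nseqD subnKC // -/(zeros n) /deriv /= !(tshift0 (n := n)) //.
  by rewrite [tadd r l]taddC; case/orP => /andP [h1 _]; apply/orP; [left|right].
apply: (IH n) => // w hw; have := h (false :: w); rewrite /= hw subSS => /(_ erefl).
by rewrite /deriv /=; case/orP => /andP [h1 _]; apply/orP; [left|right].
Qed.

(** * Tries of coefficient vectors *)

(* Sets of bit strings of a common length: [TE] is empty and [TL] contains the empty string. *)
Inductive trie := TE | TL | TB of trie & trie.
(** Collapses a node with two empty children to [TE], so that emptiness of a pruned set is seen at
    the root by [isTE]. *)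
Definition tb l r :=
  match l with TE => match r with TE => TE | _ => TB TE r end | _ => TB l r end.
Definition isTE t := match t with TE => true | _ => false end.
Fixpoint tmem (c : bits) t {struct t} := match t, c with
  | TL, [::] => true
  | TB l r, b :: c' => tmem c' (if b then r else l)
  | _, _ => false end.
Fixpoint tremove (c : bits) t {struct t} := match t, c with
  | TB l r, b :: c' => if b then tb l (tremove c' r) else tb (tremove c' l) r
  | _, _ => TE end.
Fixpoint elems t : seq bits := match t with
  | TE => [::] | TL => [:: [::]]
  | TB l r => map (cons false) (elems l) ++ map (cons true) (elems r) end.
Definition child b t := match t with TB l r => if b then r else l | _ => TE end.
Fixpoint walk (c : bits) t := if c is b :: c' then walk c' (child b t) else t.
Fixpoint full n := if n is m.+1 then TB (full m) (full m) else TL.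
(* The c in T such that c + e lies in t. *)
Fixpoint cut T t (e : bits) := match T with
  | TE => TE
  | TL => match t with TE => TE | _ => TL end
  | TB l r => match t with
    | TB tl tr => match e with
      | b :: e' => if b then tb (cut l tr e') (cut r tl e') else tb (cut l tl e') (cut r tr e')
      | [::] => TE end
    | _ => TE end end.
Fixpoint cuts T (cs : seq (trie * bits)) :=
  if isTE T then TE else if cs is c :: cs' then cuts (cut T c.1 c.2) cs' else T.
(* The c for which acc plus the combination of ms with coefficients c is a balanced function of 5 variables. *)
Fixpoint balt (ms : seq tree) acc :=
  if ms is m :: ms' then tb (balt ms' acc) (balt ms' (tadd acc m))
  else if ones acc == 16 then TL else TE.

Lemma mem_tb c l r : tmem c (tb l r) = tmem c (TB l r).
Proof. by case: l => [||? ?]; case: r => [||? ?] //; case: c => [|[] ?] //=; case=> [|? ?]. Qed.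
Lemma mem_elems c t : tmem c t = (c \in elems t).
Proof.
elim: t c => [||l IHl r IHr] [|b c] //=.
  by rewrite mem_cat; apply/esym/negbTE/negP => /orP [] /mapP [].
by rewrite mem_cat !mem_map_cons -IHl -IHr; case: b => //=; rewrite orbF.
Qed.
Lemma uniq_elems t : uniq (elems t).
Proof.
elim: t => //= l hl r hr; rewrite cat_uniq !map_inj_uniq ?hl ?hr //=; try by (move=> x y []).
by rewrite andbT; apply/hasPn => x /mapP [y _ ->]; apply/negP => /mapP [].
Qed.
Lemma elems_full n : elems (full n) = allbits n.
Proof. by elim: n => //= n ->. Qed.
Lemma mem_full n c : tmem c (full n) = (size c == n).
Proof. by rewrite mem_elems elems_full mem_allbits. Qed.

Lemma elems_rem c t : tmem c t -> perm_eq (elems t) (c :: elems (tremove c t)).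
Proof.
move=> h; apply: uniq_perm; rewrite ?uniq_elems //=.
- rewrite uniq_elems andbT -mem_elems.
  by elim: t c h => [||l IHl r IHr] [|[] c] //= h; rewrite mem_tb /= ?IHl ?IHr.
move=> x; rewrite inE -!mem_elems.
elim: t c x h => [||l IHl r IHr] [|b c] x //= h; first by case: x.
case: b h => h; rewrite mem_tb; case: x => [|y x] //; case: y => //=; rewrite ?eqseq_cons //=.
  exact: IHr.
exact: IHl.
Qed.

Lemma cut_sub c T t e : tmem c (cut T t e) -> tmem c T.
Proof.
elim: T t e c => [||l IHl r IHr] t e c //; first by case: t.
case: t => // tl tr; case: e => // b e; case: c => [|x c]; first by case: b; rewrite /= mem_tb.
by case: b; rewrite [cut _ _ _]/= mem_tb; case: x => /=; [exact: IHr|exact: IHl|exact: IHr|exact: IHl].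
Qed.
(** This is the soundness of pruning: no admissible coefficient vector is lost. A vector that
    survived wrongly would do no harm, since every leaf below it must still be matched with a
    representative. *)
Lemma cut_mem c T t e : size e = size c -> tmem c T -> tmem (bxor e c) t -> tmem c (cut T t e).
Proof.
elim: T t e c => [||l IHl r IHr] t e [|x c] //; first by case: t => //; case: e.
case: t => // [|tl tr]; first by case: e.
case: e => // b e [he]; case: b; rewrite [cut _ _ _]/= mem_tb; case: x => /=.
- exact: IHr.
- exact: IHl.
- exact: IHr.
- exact: IHl.
Qed.
Lemma cuts_sub c T cs : tmem c (cuts T cs) -> tmem c T.
Proof.
elim: cs T => [|p cs IH] T; first by case: T.
by rewrite /=; case: (isTE T) => // /IH /cut_sub.
Qed.

Fixpoint pall (T : Type) (P : T -> Prop) (s : seq T) : Prop := if s is x :: s' then P x /\ pall P s' else True.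
Lemma pall_map (T S : Type) (f : T -> S) P s : pall P (map f s) <-> pall (fun x => P (f x)) s.
Proof. by elim: s => //= x s ->. Qed.
Lemma pall_cat (T : Type) (P : T -> Prop) s1 s2 : pall P (s1 ++ s2) <-> pall P s1 /\ pall P s2.
Proof. elim: s1 => /= [|x s1 ->]; tauto. Qed.
Lemma pall_flatten (T : Type) (P : T -> Prop) ss : pall P (flatten ss) <-> pall (pall P) ss.
Proof. by elim: ss => //= s ss <-; rewrite pall_cat. Qed.
Lemma pall_impl (T : Type) (P Q : T -> Prop) s : (forall x, P x -> Q x) -> pall P s -> pall Q s.
Proof. by move=> h; elim: s => //= x s IH [/h ? /IH]. Qed.
Lemma pall_in (T : eqType) (P : T -> Prop) s : (forall x, x \in s -> P x) -> pall P s.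
Proof.
elim: s => //= x s IH h; split; first by apply: h; rewrite mem_head.
by apply: IH => y hy; apply: h; rewrite inE hy orbT.
Qed.

Lemma cuts_mem c T cs : tmem c T ->
  pall (fun p => size p.2 = size c /\ tmem (bxor p.2 c) p.1) cs -> tmem c (cuts T cs).
Proof.
elim: cs T => [|p cs IH] T hT /=; first by case: T hT.
by case=> -[h1 h2] h3; have := IH _ (cut_mem h1 hT h2) h3; case: T hT {IH}.
Qed.

Lemma mem_walk c1 c2 T : tmem (c1 ++ c2) T = tmem c2 (walk c1 T).
Proof. by elim: c1 T => [|b c1 IH] [||l r] //=; rewrite -IH //; case: c1 {IH}; case: c2. Qed.

Lemma mem_balt ms acc c : size c = size ms -> tmem c (balt ms acc) = (ones (lin acc ms c) == 16).
Proof.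
elim: ms acc c => [|m ms IH] acc [|b c] //=; first by case: eqP.
by case=> hc; rewrite mem_tb /=; case: b; rewrite IH.
Qed.

(** * Codes of derivatives *)

(* A derivative in a direction whose last nonzero coordinate is x_j is determined by its restriction to
   x_j = 0, a function of 5 variables; [dirs n j] lists these directions. *)
Definition code5 j u t := ncf 3 5 (drp j (deriv u t)).
Definition dirs n j : seq bits := [seq w ++ true :: zeros (n - j.+1) | w <- allbits j].

(** The function is x_j y with y depending only on variables after x_j. The direction has j-th
    coordinate 1 and leaves these later variables alone, so the derivative is y. *)
Lemma drp_deriv_emb j k w y : treen k y -> size w = j ->
  drp j (deriv (w ++ true :: zeros k) (emb j (Node (tzero k) y))) = emb j y.
Proof.
move=> hy; elim: j w => [w /size0nil ->|i IH [|b w] //= [hw]].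
  rewrite /deriv /= (tshift0 _ hy) tadd0l //.
set e := emb i _.
have -> : deriv (b :: w ++ true :: zeros k) (Node e e) = Node (deriv (w ++ true :: zeros k) e) (deriv (w ++ true :: zeros k) e).
  by rewrite /deriv; case: b.
by rewrite /= IH.
Qed.

Lemma ncf_emb j k y : treen k y ->
  ncf 3 (j + k) (emb j y) = zeros (size (nc 3 (j + k)) - size (nc 3 k)) ++ ncf 3 k y.
Proof.
move=> hy; elim: j => [|i IH] /=; first by rewrite subnn.
rewrite (taddK (treen_emb i hy)) coefs0 IH catA /zeros -nseqD; congr (nseq _ _ ++ _).
rewrite size_cat !size_map addnBA //.
elim: i {IH} => [|i IH] //=; apply: leq_trans IH _; rewrite size_cat !size_map; exact: leq_addl.
Qed.

Section Codes.
Variables (j k : nat) (jk : j + k = 5).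

Let j5 : j <= 5. Proof. by rewrite -jk leq_addr. Qed.

Lemma size_code5 u t : treen 6 t -> size (code5 j u t) = 15.
Proof. by move=> ht; rewrite size_ncf // treen_drp ?treen_deriv. Qed.

Lemma code5D u s t : treen 6 s -> treen 6 t -> code5 j u (tadd s t) = bxor (code5 j u s) (code5 j u t).
Proof.
move=> hs ht; rewrite /code5 (derivD _ hs ht) (drpD (n := 5)) ?treen_deriv // ncfD //;
by rewrite treen_drp ?treen_deriv.
Qed.

Lemma code5_W w d : treen 6 d -> size w = j -> W j.+1 d -> code5 j (w ++ true :: zeros k) d = zeros 15.
Proof.
move=> hd hw hW.
have : isconst (deriv ((w ++ [:: true]) ++ zeros k) d).
  by apply: (W_deriv _ hd hW); rewrite size_cat hw addn1.
rewrite -catA /= => /(isconstP (treen_deriv _ hd)) [b hb].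
by rewrite /code5 hb drp_const // ncf_const.
Qed.

(** In the order of [ncf], the monomials in the last k variables come last. So the coefficients
    still to be chosen occupy a suffix of the code, and the part before it is already determined by
    the prefix of the search. *)
Lemma code5_block w c : size w = j -> size c = size (nc 3 k) ->
  code5 j (w ++ true :: zeros k) (lin (tzero 6) (block j k) c) = zeros (15 - size (nc 3 k)) ++ c.
Proof.
move=> hw hc; have e6 : 6 = j + k.+1 by rewrite addnS jk.
have -> : tzero 6 = tzero (j + k.+1) by rewrite -e6.
have ty : treen k (lin (tzero k) (nc 3 k) c) by apply: treen_lin.
rewrite lin_block /code5 drp_deriv_emb //.
by have := ncf_emb j ty; rewrite jk ncf_lin.
Qed.

End Codes.

(* [sp] is the span of the tuple, [supp] the set of functions that can extend it. *)
Section Constraints.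
Variables (sp : seq tree) (supp : tree -> Prop).
Hypothesis sp6 : all (deg 4 6) sp.
Hypothesis supp_deg : forall g, supp g -> deg 4 6 g.
Hypothesis supp_bal : forall g k u, supp g -> k \in sp -> size u = 6 -> has id u ->
  ones (deriv u (tadd g k)) = 32.

(** A necessary condition on g: the offset is typically the code of the derivative of some k in
    [sp], so that a single trie of balanced codes serves all k and all directions. *)
Definition valid j u (te : trie * bits) :=
  size te.2 = 15 /\ forall g, supp g -> tmem (bxor (code5 j u g) te.2) te.1.

Lemma valid_bal j k u w f : j + k = 5 -> u = w ++ true :: zeros k -> size w = j -> f \in sp ->
  valid j u (balt (nc 3 5) (tzero 5), code5 j u f).
Proof.
move=> jk -> hw hf; have df := allP sp6 _ hf; have tf := deg_treen df.
split; first by rewrite (size_code5 jk).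
move=> g hg; have dg := supp_deg hg; have tg := deg_treen dg.
have j5 : j <= 5 by rewrite -jk leq_addr.
rewrite -(code5D jk) //; set t := tadd g f.
have dt : deg 4 6 t by apply: deg_add.
have tt := deg_treen dt.
have hu : ones (deriv (w ++ true :: zeros k) t) = 32.
  by apply: supp_bal => //; [rewrite size_cat /= hw size_zeros addnS jk | rewrite has_cat /= orbT].
rewrite mem_balt; last by rewrite (size_code5 jk).
have dd : deg 3 5 (drp j (deriv (w ++ true :: zeros k) t)).
  by apply: deg_drp => //; exact: (deg_deriv _ dt).
have td := deg_treen dd.
have := isconst_ncf dd; rewrite -/(code5 j _ t); set y := lin _ _ _.
have ty : treen 5 y by apply: treen_lin.
case/(isconstP (treen_add td ty)) => b hb.
have -> : y = tadd (drp j (deriv (w ++ true :: zeros k) t)) (tconst 5 b).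
  by rewrite -hb [tadd _ y]taddC taddC (taddKK ty td).
(* [b] is the constant term, which the code forgets. It is harmless: complementing a function of 5
   variables with 16 ones leaves 32 - 16 = 16 ones. *)
rewrite ones_compl //.
have := ones_deriv (zeros k) tt (w := w); rewrite hw hu => /(_ j5) h.
have -> : ones (drp j (deriv (w ++ true :: zeros k) t)) = 16 by lia.
by case: b {hb}.
Qed.

Lemma valid_cuts j u ks : j <= 5 -> pall (valid j u) ks -> valid j u (cuts (full 15) ks, zeros 15).
Proof.
move=> j5 hks; split=> [//|g hg]; rewrite -[(_, _).2]/(zeros 15) -[(_, _).1]/(cuts (full 15) ks).
have tg := deg_treen (supp_deg hg).
have hs : size (code5 j u g) = 15 by rewrite (@size_code5 j (5 - j)) ?subnKC.
rewrite bxor0 //; apply: cuts_mem; first by rewrite mem_full hs.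
by apply: pall_impl hks => p [h1 h2]; rewrite h1 hs bxorC; split=> //; apply: h2.
Qed.

(** The code of the derivative of g is known in its first 15 - nb places from the prefix h alone,
    and in the last nb places it is [c] plus a known offset. Descending the trie along the known
    places turns a condition on g into one on [c]. *)
Lemma valid_walk j k w te pre hc h g c : j + k = 5 -> size w = j ->
  valid j (w ++ true :: zeros k) te -> all (treen 6) pre -> h = lin (tzero 6) pre hc ->
  size c = size (nc 3 k) -> supp g -> W j.+1 (tadd g (lin h (block j k) c)) ->
  let nb := size (nc 3 k) in
  let e := bxor (blin (zeros 15) (map (code5 j (w ++ true :: zeros k)) pre) hc) te.2 in
  size (drop (15 - nb) e) = size c /\ tmem (bxor (drop (15 - nb) e) c) (walk (take (15 - nb) e) te.1).
Proof.
move=> jk hw [h1 h2] hpre hh hc' hg hW nb e.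
have e6 : 6 = j + k.+1 by rewrite addnS jk.
have tg := deg_treen (supp_deg hg); have j5 : j <= 5 by rewrite -jk leq_addr.
set u := w ++ true :: zeros k in h2 e *.
have th : treen 6 h by rewrite hh treen_lin.
have tbl : all (treen 6) (block j k) by rewrite e6 treen_block.
have cz : code5 j u (tzero 6) = zeros 15 by rewrite /code5 deriv_const drp_const // ncf_const.
have hcols : blin (zeros 15) (map (code5 j u) pre) hc = code5 j u h.
  rewrite hh -cz; apply: (blin_map (n := 6)) => // s t hs ht; exact: (code5D jk).
have he : size e = 15 by rewrite /e hcols size_bxor ?h1 (size_code5 jk).
have nb15 : nb <= 15.
  have -> : 15 = size (nc 3 (j + k)) by rewrite jk.
  rewrite /nb; elim: (j) => // i IH; apply: leq_trans IH _ => /=.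
  by rewrite size_cat !size_map leq_addl.
have hdr : size (drop (15 - nb) e) = size c by rewrite size_drop he hc' subKn.
split=> //; rewrite -mem_walk.
have -> : take (15 - nb) e ++ bxor (drop (15 - nb) e) c = bxor e (zeros (15 - nb) ++ c).
  rewrite -{3}(cat_take_drop (15 - nb) e) bxor_cat ?bxor0 ?size_zeros //;
  by rewrite size_takel // he leq_subr.
have -> : e = bxor (code5 j u h) te.2 by rewrite /e hcols.
rewrite -bxorA [bxor te.2 _]bxorC bxorA -(code5_block jk hw hc') -(code5D jk) //; last by auto.
rewrite -(linE (n := 6)) //; set y := lin h _ c in hW *.
have ty : treen 6 y by apply: treen_lin.
(* The difference of g and y satisfies [W j.+1], so its derivative in direction u is constant and
   has code zero. *)
have -> : code5 j u y = code5 j u g.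
  have := code5_W jk (treen_add tg ty) hw hW; rewrite (code5D jk) // => hz.
  have sg : size (code5 j u g) = 15 by rewrite (size_code5 jk).
  have sy : size (code5 j u y) = 15 by rewrite (size_code5 jk).
  by rewrite -[LHS](bxor0 sy) -(bxorK sg) bxorA [bxor (code5 j u y) _]bxorC hz bxor0l.
exact: h2.
Qed.

End Constraints.

(** * Affine maps on truth tables *)

Definition amap := (seq bits * bits)%type.
Fixpoint precomp t (ms : seq bits) (v : bits) :=
  if ms is m :: ms' then Node (precomp t ms' v) (precomp t ms' (bxor v m)) else Leaf (ev t v).
Definition inj_rows n m (ms : seq bits) :=
  all (fun c => has id (blin (zeros n) ms c) || ~~ has id c) (allbits m).
Definition wfA n (A : amap) :=
  [&& size A.1 == n, all (fun m => size m == n) A.1, size A.2 == n & inj_rows n n A.1].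
(* Coordinates, modulo affine functions, of t in the span of gs. *)
Definition affcoords n (gs : seq tree) t : bits :=
  let cs := allbits (size gs) in
  nth [::] cs (find (fun c => degle 2 n (lin t gs c)) cs).
Definition rows_ok n fA (gs : seq tree) M :=
  all2 (fun f c => degle 2 n (lin f gs c) && (size c == size gs)) fA M.
Definition equivk n (A : amap) fs gs :=
  let fA := map (fun f => precomp f A.1 A.2) fs in
  let M := map (affcoords n gs) fA in
  [&& wfA n A, size fs == size gs, rows_ok n fA gs M & inj_rows (size gs) (size gs) M].

(** The matrix is quantified here, while [equivk] computes it with [affcoords]: in [ext_EAt] an
    explicit block matrix is supplied instead. *)
Definition EAt fs gs := exists A M,
  [/\ wfA 6 A, size fs = size gs, size M = size gs,
      rows_ok 6 (map (fun f => precomp f A.1 A.2) fs) gs M & inj_rows (size gs) (size gs) M].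

Lemma equivkP A fs gs : equivk 6 A fs gs -> EAt fs gs.
Proof.
case/and4P => h1 /eqP h2 h3 h4.
by exists A, (map (affcoords 6 gs) (map (fun f => precomp f A.1 A.2) fs)); rewrite !size_map.
Qed.

Lemma evD n s t x : treen n s -> treen n t -> size x = n -> ev (tadd s t) x = ev s x (+) ev t x.
Proof.
elim: n s t x => [|n IH] [a|l r] [b|l' r'] [|y x] //= /andP [? ?] /andP [? ?] [hx].
by case: y; rewrite IH.
Qed.
Lemma ev_ext n s t : treen n s -> treen n t -> (forall x, size x = n -> ev s x = ev t x) -> s = t.
Proof.
elim: n s t => [|n IH] [a|l r] [b|l' r'] //=; first by move=> _ _ /(_ [::] erefl) ->.
move=> /andP [? ?] /andP [? ?] h; congr Node; apply: IH => // x hx.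
  by have := h (false :: x); rewrite /= hx => /(_ erefl).
by have := h (true :: x); rewrite /= hx => /(_ erefl).
Qed.
Lemma ev_const n b x : size x = n -> ev (tconst n b) x = b.
Proof. by elim: n x => [|n IH] [|y x] //= [hx]; case: y; rewrite IH. Qed.
Lemma ev_shift n u t x : treen n t -> size u = n -> size x = n -> ev (tshift u t) x = ev t (bxor x u).
Proof.
elim: n u t x => [|n IH] [|b u] [a|l r] [|y x] //= /andP [? ?] [hu] [hx].
by case: b; case: y; rewrite /= IH.
Qed.
Lemma ev_deriv n u t x : treen n t -> size u = n -> size x = n ->
  ev (deriv u t) x = ev t x (+) ev t (bxor x u).
Proof. by move=> ht hu hx; rewrite (evD (n := n)) ?(ev_shift ht) //; auto. Qed.

Lemma treen_comp t ms v : treen (size ms) (precomp t ms v).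
Proof. by elim: ms v => //= m ms IH v; rewrite !IH. Qed.
Lemma ev_comp t ms v x : size x = size ms -> ev (precomp t ms v) x = ev t (blin v ms x).
Proof. by elim: ms v x => [|m ms IH] v [|y x] //= [hx]; case: y; rewrite IH. Qed.
Lemma compD n s t ms v : treen n s -> treen n t -> all (fun m => size m == n) ms -> size v = n ->
  precomp (tadd s t) ms v = tadd (precomp s ms v) (precomp t ms v).
Proof.
move=> hs ht; elim: ms v => [|m ms IH] v /=; first by move=> _ hv; rewrite (evD hs ht).
by move=> /andP [/eqP hm hms] hv; rewrite !IH // size_bxor ?hv.
Qed.

Lemma has_zeros k : has id (zeros k) = false.
Proof. by elim: k. Qed.
Lemma not_has x : ~~ has id x -> x = zeros (size x).
Proof. by elim: x => //= b x IH; rewrite negb_or => /andP [/negbTE -> /IH {1}->]. Qed.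
Lemma blin_zeros acc ms k : blin acc ms (zeros k) = acc.
Proof. by elim: ms k acc => [|m ms IH] [|k] acc //=; rewrite -/(zeros k) IH. Qed.
Lemma blin_prefix acc ms w k : size w <= size ms ->
  blin acc ms (w ++ zeros k) = blin acc (take (size w) ms) w.
Proof.
elim: w ms acc => [|b w IH] ms acc; first by rewrite take0 cat0s blin_zeros.
by case: ms => // m ms h; rewrite /= IH.
Qed.
Lemma drop_bxor j a b : ~~ has id (drop j a) -> ~~ has id (drop j b) -> ~~ has id (drop j (bxor a b)).
Proof.
elim: a b j => [|x a IH] [|y b] [|j] //=; last exact: IH.
rewrite !negb_or => /andP [/negbTE -> h1] /andP [/negbTE -> h2] /=.
by have := IH b 0; rewrite !drop0; apply.
Qed.
Lemma drop_blin j acc ms w : all (fun m => ~~ has id (drop j m)) ms ->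
  ~~ has id (drop j acc) -> ~~ has id (drop j (blin acc ms w)).
Proof.
elim: ms acc w => [|m ms IH] acc [|b w] //= /andP [hm hms] ha.
by apply: IH => //; case: b => //; apply: drop_bxor.
Qed.

Section Affine.
Variables (n : nat) (A : amap).
Hypothesis hA : wfA n A.
Let ms := A.1.
Let v := A.2.
Let L := blin (zeros n) ms.
Definition affmap x := blin v ms x.
Definition tcomp t := precomp t ms v.

Let sms : size ms = n. Proof. by case/and4P: hA => /eqP. Qed.
Let ams : all (fun m => size m == n) ms. Proof. by case/and4P: hA. Qed.
Let sv : size v = n. Proof. by case/and4P: hA => _ _ /eqP. Qed.

Lemma size_L x : size (L x) = n. Proof. exact: size_blin (size_zeros n) ams. Qed.
Lemma appE x : affmap x = bxor v (L x). Proof. exact: blinE. Qed.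
Lemma size_app x : size (affmap x) = n. Proof. exact: size_blin. Qed.
Lemma LD x y : size x = n -> size y = n -> L (bxor x y) = bxor (L x) (L y).
Proof. by move=> hx hy; apply: blinD; rewrite ?sms. Qed.

Lemma inj_L x y : size x = n -> size y = n -> L x = L y -> x = y.
Proof.
move=> hx hy hxy.
have h0 : L (bxor x y) = zeros n by rewrite LD // hxy (bxorK (size_L y)).
have hm : bxor x y \in allbits n by rewrite mem_allbits size_bxor ?hx ?hy.
case/and4P: hA => _ _ _ /allP /(_ _ hm); rewrite -/ms -/(L _) h0 has_zeros /= => /not_has.
rewrite size_bxor ?hx ?hy // => e.
by rewrite -[x](@bxorKK x y) ?hx ?hy // e bxor0l.
Qed.
Lemma inj_app x y : size x = n -> size y = n -> affmap x = affmap y -> x = y.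
Proof.
move=> hx hy; rewrite !appE => h; apply: inj_L => //.
have : bxor (bxor v (L x)) v = bxor (bxor v (L y)) v by rewrite h.
by rewrite ![bxor v _]bxorC !bxorKK ?size_L ?sv.
Qed.

Lemma surj_bits (f : bits -> bits) k : (forall x, size x = k -> size (f x) = k) ->
  (forall x y, size x = k -> size y = k -> f x = f y -> x = y) ->
  forall y, size y = k -> exists2 x, size x = k & f x = y.
Proof.
move=> hs hi y hy.
have hu : uniq (map f (allbits k)).
  rewrite map_inj_in_uniq ?uniq_allbits // => a b; rewrite !mem_allbits => /eqP ha /eqP hb.
  exact: hi.
have hsub : {subset map f (allbits k) <= allbits k}.
  by move=> z /mapP [x]; rewrite !mem_allbits => /eqP hx ->; rewrite hs.
have [_ he] := uniq_min_size hu hsub (eq_leq (esym (size_map _ _))).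
have : y \in map f (allbits k) by rewrite he mem_allbits hy.
by case/mapP => x; rewrite mem_allbits => /eqP hx ->; exists x.
Qed.

Lemma surj_app y : size y = n -> exists2 x, size x = n & affmap x = y.
Proof. by apply: surj_bits => [x _|]; [exact: size_app | exact: inj_app]. Qed.

Lemma treen_tcomp t : treen n (tcomp t).
Proof. by rewrite -sms treen_comp. Qed.
Lemma ev_tcomp t x : size x = n -> ev (tcomp t) x = ev t (affmap x).
Proof. by move=> hx; rewrite ev_comp ?sms. Qed.
Lemma tcompD s t : treen n s -> treen n t -> tcomp (tadd s t) = tadd (tcomp s) (tcomp t).
Proof. by move=> hs ht; apply: (compD hs ht). Qed.
Lemma tcomp_inj s t : treen n s -> treen n t -> tcomp s = tcomp t -> s = t.
Proof.
move=> hs ht h; apply: (ev_ext hs ht) => y /surj_app [x hx <-].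
by rewrite -!ev_tcomp // h.
Qed.
Lemma tcomp_const b : tcomp (tconst n b) = tconst n b.
Proof.
apply: (ev_ext (n := n)) => [||x hx]; rewrite ?treen_tcomp //.
by rewrite ev_tcomp // !ev_const ?size_app.
Qed.
Lemma isconst_tcomp t : treen n t -> isconst (tcomp t) = isconst t.
Proof.
move=> ht; apply/(isconstP (treen_tcomp t))/(isconstP ht) => -[b hb]; exists b.
  by apply: tcomp_inj => //; rewrite hb tcomp_const.
by rewrite hb tcomp_const.
Qed.
Lemma deriv_tcomp u t : treen n t -> size u = n -> deriv u (tcomp t) = tcomp (deriv (L u) t).
Proof.
move=> ht hu; apply: (ev_ext (n := n)) => [||x hx]; rewrite ?treen_deriv ?treen_tcomp //.
rewrite (ev_deriv (n := n)) ?treen_tcomp // !ev_tcomp ?size_bxor ?hx ?hu //.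
by rewrite (ev_deriv (n := n)) ?size_app ?size_L // !appE LD // bxorA.
Qed.

(** By the chain rule [deriv_tcomp], derivatives of the composite in directions u correspond to
    derivatives of t in directions L u. The hypothesis on the first j rows says that L maps the span
    of the first j unit vectors into itself. Being injective, it permutes this span, so the same set
    of directions is tested on both sides. *)
Lemma W_tcomp j t : j <= n -> all (fun m => ~~ has id (drop j m)) (take j ms) ->
  treen n t -> W j (tcomp t) = W j t.
Proof.
move=> hj hfl ht.
pose E w := w ++ zeros (n - j).
have sE w : size w = j -> size (E w) = n by move=> hw; rewrite size_cat size_zeros hw subnKC.
pose f w := take j (L (E w)).
have sf w : size w = j -> size (f w) = j by move=> _; rewrite size_takel ?size_L.
have hL w : size w = j -> L (E w) = E (f w).
  move=> hw; rewrite -[LHS](cat_take_drop j); congr (_ ++ _).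
  have hs : size (drop j (L (E w))) = n - j by rewrite size_drop size_L.
  rewrite -hs; apply: not_has; rewrite /L blin_prefix ?hw ?sms //.
  by apply: drop_blin => //; rewrite /zeros drop_nseq has_zeros.
have injf x y : size x = j -> size y = j -> f x = f y -> x = y.
  move=> hx hy hxy; have := inj_L (sE _ hx) (sE _ hy).
  rewrite !hL // hxy => /(_ erefl) /eqP; rewrite eqseq_cat ?hx ?hy // => /andP [/eqP //].
apply/idP/idP => hW; apply: (deriv_W (n := n)) => //.
  move=> w /(surj_bits sf injf) [w' hw' <-].
  rewrite -/(E _) -hL // -isconst_tcomp ?treen_deriv // -deriv_tcomp ?sE //.
  exact: (W_deriv _ (treen_tcomp t) hW hw').
exact: treen_tcomp.
move=> w hw; rewrite -/(E _) deriv_tcomp ?sE // isconst_tcomp ?treen_deriv // hL //.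
by apply: (W_deriv _ ht hW); rewrite sf.
Qed.

End Affine.

(** * The set of all truth tables *)

Fixpoint alltrees n : seq tree :=
  if n is m.+1 then [seq Node l r | l <- alltrees m, r <- alltrees m]
  else [:: Leaf false; Leaf true].

Lemma mem_alltrees n t : (t \in alltrees n) = treen n t.
Proof.
elim: n t => [|n IH] t; first by case: t => [[]|].
apply/idP/idP => [/allpairsP [[a b] /= [ha hb ->]] /=|]; first by rewrite -!IH ha hb.
case: t => // l r /= /andP [hl hr]; apply/allpairsP; exists (l, r); by rewrite !IH.
Qed.
Lemma uniq_alltrees n : uniq (alltrees n).
Proof. by elim: n => //= n IH; apply: allpairs_uniq => // -[a b] [c d] _ _ [-> ->]. Qed.

Lemma perm_alltrees n (f : tree -> tree) :
  (forall t, treen n t -> treen n (f t)) ->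
  (forall s t, treen n s -> treen n t -> f s = f t -> s = t) ->
  perm_eq (map f (alltrees n)) (alltrees n).
Proof.
move=> hf hi.
have hu : uniq (map f (alltrees n)).
  by rewrite map_inj_in_uniq ?uniq_alltrees // => a b; rewrite !mem_alltrees; exact: hi.
have hs : {subset map f (alltrees n) <= alltrees n}.
  by move=> z /mapP [x]; rewrite !mem_alltrees => hx ->; exact: hf.
have [_ he] := uniq_min_size hu hs (eq_leq (esym (size_map _ _))).
exact: uniq_perm hu (uniq_alltrees n) he.
Qed.

Lemma sum_alltreesS n (F : tree -> nat) :
  \sum_(t <- alltrees n.+1) F t = \sum_(l <- alltrees n) \sum_(r <- alltrees n) F (Node l r).
Proof. exact: big_allpairs_dep. Qed.

(** These are the affine functions. Each extra variable doubles their number, since the right half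
    must equal the left half up to a constant. For n = 6 this is the factor 128. *)
Lemma sum_W n : \sum_(t <- alltrees n | W n t) 1 = 2 ^ n.+1.
Proof.
have hc m s : treen m s -> \sum_(r <- alltrees m | isconst (tadd s r)) 1 = 2.
  move=> hs; rewrite -big_filter.
  have hp : perm_eq [seq r <- alltrees m | isconst (tadd s r)] [:: s; tadd s (tconst m true)].
    apply: uniq_perm; rewrite ?filter_uniq ?uniq_alltrees //=.
      rewrite inE andbT; apply/eqP => h.
      have : tconst m true = tconst m false.
        by rewrite -(taddK hs) {2}h (taddA (n := m)) ?treen_const // (taddK hs) tadd0l.
      by move/(@tconst_inj m).
    move=> r; rewrite mem_filter mem_alltrees !inE.
    apply/andP/orP => [[h hr]|].
      case/(isconstP (treen_add hs hr)): h => b hb.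
      have -> : r = tadd s (tconst m b) by rewrite -hb taddC [tadd s r]taddC (taddKK hr hs).
      by case: b {hb}; [right | left; rewrite tadd0].
    case=> /eqP ->; first by rewrite (taddK hs) isconst_const.
    rewrite (taddA (n := m)) ?treen_const // (taddK hs) tadd0l ?treen_const //.
    by rewrite isconst_const; split=> //; apply: treen_add.
  by rewrite (perm_big _ hp) big_cons big_seq1.
elim: n => [|n IH]; first by rewrite /= !big_cons big_nil.
rewrite big_mkcond sum_alltreesS.
transitivity (\sum_(l <- alltrees n | W n l) 2); last first.
  by rewrite expnS -IH big_distrr /=; apply: eq_bigr.
rewrite [RHS]big_mkcond !big_seq; apply: eq_bigr => l; rewrite mem_alltrees => hl.
rewrite -big_mkcond; case hW: (W n l).
  rewrite -(hc n l hl); apply: eq_bigl => r; by rewrite W_Node hW andbT.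
by rewrite big1 // => r; rewrite W_Node hW andbF.
Qed.

(** The list [alltrees 6] has 2^64 elements, so it must be kept from unfolding. *)
Fact tables_key : {s : seq tree | s = alltrees 6}.
Proof. by exists (alltrees 6). Qed.
Definition tables := sval tables_key.
Lemma tablesE : tables = alltrees 6. Proof. exact: (svalP tables_key). Qed.
Lemma mem_tables t : (t \in tables) = treen 6 t.
Proof. by rewrite tablesE; apply: mem_alltrees. Qed.
Lemma uniq_tables : uniq tables.
Proof. by rewrite tablesE; apply: uniq_alltrees. Qed.
Lemma perm_tables (f : tree -> tree) :
  (forall t, treen 6 t -> treen 6 (f t)) ->
  (forall s t, treen 6 s -> treen 6 t -> f s = f t -> s = t) ->
  perm_eq (map f tables) tables.
Proof. by rewrite tablesE; apply: perm_alltrees. Qed.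
Lemma sum_W_tables : \sum_(t <- tables | W 6 t) 1 = 128.
Proof. by rewrite tablesE; apply: (sum_W 6). Qed.

(** * Orbit sums *)

Inductive ctree := CL of bits | CN of ctree & ctree.
(** A table of an affine map on all coefficient vectors: the orbit search applies each map to many
    vectors, and every application becomes a walk down this tree. *)
Fixpoint ctab (cols : seq bits) acc :=
  if cols is c :: cols' then CN (ctab cols' acc) (ctab cols' (bxor acc c)) else CL acc.
Fixpoint look t (c : bits) := match t, c with
  | CN l r, b :: c' => look (if b then r else l) c' | CL x, _ => x | _, _ => [::] end.

Fixpoint loop fuel (acts : seq ctree) R (st : seq bits) (cnt : N) := match fuel, st with
  | f.+1, c :: st' =>
      if tmem c R then loop f acts (tremove c R) (map (fun a => look a c) acts ++ st') (N.succ cnt)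
      else loop f acts R st' cnt
  | _, _ => (R, cnt) end.
Fixpoint orbs fuel acts R (cs : seq bits) :=
  if cs is c :: cs' then
    if tmem c R then
      let: (R', n) := loop fuel acts R [:: c] 0%num in
      if orbs fuel acts R' cs' is Some os then Some ((c, n) :: os) else None
    else orbs fuel acts R cs'
  else if R is TE then Some [::] else None.
Definition orbits fuel acts R :=
  if acts is [::] then Some (map (fun c => (c, 1%num)) (elems R)) else orbs fuel acts R (elems R).

Lemma look_ctab cols acc c : size c = size cols -> look (ctab cols acc) c = blin acc cols c.
Proof. by elim: cols acc c => [|m cols IH] acc [|b c] //= [h]; case: b; rewrite IH. Qed.

Section Orbits.
Variables (acts : seq ctree) (G : bits -> nat) (n : nat).
Hypothesis actsP : pall (fun a => forall c, size c = n -> G (look a c) = G c) acts.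

Definition sized R := forall c, tmem c R -> size c = n.

Lemma mem_rem c R x : tmem c R -> tmem x (tremove c R) -> tmem x R.
Proof. by move=> /elems_rem /perm_mem h; rewrite !mem_elems h inE orbC => ->. Qed.
Lemma sum_rem c R : tmem c R ->
  \sum_(x <- elems R) G x = G c + \sum_(x <- elems (tremove c R)) G x.
Proof. by move=> /elems_rem h; rewrite (perm_big _ h) big_cons. Qed.

(** The equation is an invariant of the search, true after every step. Exhausted fuel would
    therefore only split an orbit into pieces, each with its own branch, and would not spoil the
    sum. *)
Lemma loopP fuel R st cnt g : sized R -> (forall c, c \in st -> size c = n -> G c = g) ->
  let: (R', cnt') := loop fuel acts R st cnt in
  sized R' /\ \sum_(x <- elems R) G x + N.to_nat cnt * g = \sum_(x <- elems R') G x + N.to_nat cnt' * g.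
Proof.
elim: fuel R st cnt => [|f IH] R [|c st] cnt //= hR hst.
case hm: (tmem c R); last first.
  by apply: IH => // x hx; apply: hst; rewrite inE hx orbT.
have gc : G c = g by apply: hst; [rewrite mem_head | exact: hR].
have := IH (tremove c R) (map (fun a => look a c) acts ++ st) (N.succ cnt).
case: (loop _ _ _ _ _) => R' cnt' [].
- by move=> x /(mem_rem hm); exact: hR.
- move=> x; rewrite mem_cat => /orP [|hx]; last by apply: hst; rewrite inE hx orbT.
  move=> hx _; rewrite -gc; have sc := hR _ hm.
  elim: acts actsP hx => //= a l IHl [ha hl]; rewrite inE => /orP [/eqP ->|]; last exact: IHl.
  exact: ha.
move=> h1 h2; split=> //; rewrite -h2 (sum_rem hm) gc; lia.
Qed.

Lemma orbsP fuel R cs os : sized R -> orbs fuel acts R cs = Some os ->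
  \sum_(x <- elems R) G x = \sum_(o <- os) N.to_nat o.2 * G o.1 /\ pall (fun o => size o.1 = n) os.
Proof.
elim: cs R os => [|c cs IH] R os hR /=; first by case: R hR => // _ [<-]; rewrite !big_nil.
case hm: (tmem c R); last exact: IH.
have := @loopP fuel R [:: c] 0%num (G c) hR.
case: (loop _ _ _ _ _) => R' k [].
  by move=> x; rewrite inE => /eqP ->.
move=> hR' hs; case ho: (orbs _ _ _ _) => [os'|] // [<-].
have [h1 h2] := IH _ _ hR' ho; split; last by split=> //; exact: hR hm.
by rewrite big_cons -h1 -[LHS]addn0 hs addnC.
Qed.
Lemma orbitsP fuel R os : sized R -> orbits fuel acts R = Some os ->
  \sum_(x <- elems R) G x = \sum_(o <- os) N.to_nat o.2 * G o.1 /\ pall (fun o => size o.1 = n) os.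
Proof.
move=> hR; have := @orbsP fuel R (elems R) os hR; rewrite /orbits.
case: (acts) => [_ [<-]|a l h]; last exact: h.
split; first by rewrite big_map; apply: eq_bigr => c _; rewrite mul1n.
by apply/pall_map/pall_in => x; rewrite -mem_elems; exact: hR.
Qed.
End Orbits.

(** * The search and its soundness *)

Fixpoint span n (fs : seq tree) :=
  if fs is f :: fs' then let s := span n fs' in s ++ map (tadd f) s else [:: tzero n].

Definition idA n : amap := (map (fun i => map (fun k => k == i) (iota 0 n)) (iota 0 n), zeros n).
(* The action on the coefficients of block j of the affine map A, followed by addition of the element of
   the span of fs with coordinates [kap]; [None] unless it preserves the prefix h. *)
Definition gen j fs h (A : amap) kap : option ctree :=
  let k := 5 - j in
  let bl := block j k in
  if [&& equivk 6 A fs fs, all (fun m => ~~ has id (drop j.+1 m)) (take j.+1 A.1) & size kap == size fs] then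
    let t := lin (tadd h (precomp h A.1 A.2)) fs kap in
    let base := bcode j k t in
    let bA := map (fun b => precomp b A.1 A.2) bl in
    let cols := map (bcode j k) bA in
    if [&& W j.+1 (lin t bl base), size base == size bl &
           all2 (fun b c => W j.+1 (lin b bl c) && (size c == size bl)) bA cols]
    then Some (ctab cols base) else None
  else None.
(* An element of the span of fs, given by its coordinates, that puts h + h o A in [W j]. *)
Definition kappa j fs h (A : amap) :=
  let hA := tadd h (precomp h A.1 A.2) in
  let cs := allbits (size fs) in
  nth [::] cs (find (fun c => W j (lin hA fs c)) cs).

(* Certificate of the search tree: at an inner node, affine maps generating the symmetries to be used and
   one certificate per orbit of branches; at a leaf, the index of a representative and the affine map leading
   to it; [D] at a node without branches. Affine maps are coded as in [amapN]. *)
Inductive cert := D | L of N & N | B of seq N & seq cert.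
Fixpoint nbits k (x : N) : bits := if k is k'.+1 then N.odd x :: nbits k' (N.div2 x) else [::].
Fixpoint chunks n k (s : bits) := if k is k'.+1 then take n s :: chunks n k' (drop n s) else [::].
Definition amapN n x : amap := let s := nbits (n * n.+1) x in (chunks n n (drop n s), take n s).

(** Missing certificates are read as [D], so [B gs [::]] stands for a node all of whose branches die
    out further down. *)
Fixpoint zipD T (os : seq T) cs :=
  if os is o :: os' then (o, head D cs) :: zipD os' (behead cs) else [::].
Fixpoint collect (l : seq (N * option (seq (N * nat)))) := match l with
  | [::] => Some [::]
  | (n, Some x) :: l' =>
      if collect l' is Some y then Some (map (fun p => (N.mul n p.1, p.2)) x ++ y) else None
  | _ => None end.

Definition tabs := seq (seq (seq bits * seq (trie * bits))).
Fixpoint premonos j := if j is i.+1 then premonos i ++ block i (5 - i) else [::].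
(** Codes of derivatives are linear in the function, so it suffices to tabulate them on the
    monomials already treated. The code for a prefix is then the combination given by its
    coefficients. *)
Definition dtabs := mkseq (fun j => map (fun u => (u, map (code5 j u) (premonos j))) (dirs 6 j)) 6.
(** For j < 2 there are only three directions in all, and for each of them the conditions from all k
    in the span are intersected beforehand into one trie with offset zero. For larger j the trie
    [bal] is kept, with one offset for each k. *)
Definition mktabs bal (dt : seq (seq (bits * seq bits))) (fs : seq tree) : tabs :=
  let sp := span 6 fs in
  mkseq (fun j => map (fun ud => let ks := map (fun k => (bal, code5 j ud.1 k)) sp in
    (ud.2, if j < 2 then [:: (cuts (full 15) ks, zeros 15)] else ks)) (nth [::] dt j)) 6.
Definition constraints k (hc : bits) (tab : seq (seq bits * seq (trie * bits))) : seq (trie * bits) :=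
  flatten (map (fun ue => let cd := blin (zeros 15) ue.1 hc in
    map (fun te => let e := bxor cd te.2 in (walk (take k e) te.1, drop k e)) ue.2) tab).

(** At the root no coefficient is fixed yet, so adding a member of [fs] to g is a symmetry as well;
    [(idA (size fs)).1] lists the unit vectors. Deeper in the tree the summand from the span is
    dictated by the affine map through [kappa]. *)
Definition node_acts j fs h gs : seq ctree :=
  pmap (fun x => let A := amapN 6 x in gen j fs h A (kappa j fs h A)) gs ++
  (if j is 0 then pmap (fun kap => gen 0 fs h (idA 6) kap) (idA (size fs)).1 else [::]).

(* [run] explores the completions of the prefix h (with coefficients [hc]) on the [block]s from j on, and
   returns multiplicities of representatives. *)
Fixpoint run fuel fs (reps : seq (seq tree)) (tbs : tabs) r j h hc c : option (seq (N * nat)) :=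
  if r is r'.+1 then
    let nb := size (nc 3 r') in
    let T := cuts (full nb) (constraints (15 - nb) hc (head [::] tbs)) in
    let acts := node_acts j fs h (if c is B gs _ then gs else [::]) in
    if orbits fuel acts T is Some os then
      collect (map (fun x => (x.1.2, run fuel fs reps (behead tbs) r' j.+1
                 (lin h (block j r') x.1.1) (hc ++ x.1.1) x.2))
               (zipD os (if c is B _ l then l else [::])))
    else None
  else if c is L i x then
    if equivk 6 (amapN 6 x) (h :: fs) (nth [::] reps (N.to_nat i)) then Some [:: (1%num, N.to_nat i)]
    else None
  else None.

Lemma run0E fuel fs reps tbs j h hc c : run fuel fs reps tbs 0 j h hc c =
  if c is L i x then
    if equivk 6 (amapN 6 x) (h :: fs) (nth [::] reps (N.to_nat i)) then Some [:: (1%num, N.to_nat i)]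
    else None
  else None.
Proof. by []. Qed.
Lemma runSE fuel fs reps tbs r j h hc c : run fuel fs reps tbs r.+1 j h hc c =
  let nb := size (nc 3 r) in
  let T := cuts (full nb) (constraints (15 - nb) hc (head [::] tbs)) in
  let acts := node_acts j fs h (if c is B gs _ then gs else [::]) in
  if orbits fuel acts T is Some os then
    collect (map (fun x => (x.1.2, run fuel fs reps (behead tbs) r j.+1
               (lin h (block j r) x.1.1) (hc ++ x.1.1) x.2))
             (zipD os (if c is B _ l then l else [::])))
  else None.
Proof. by []. Qed.

Lemma blin_cons0 x acc M c : blin (x :: acc) (map (cons false) M) c = x :: blin acc M c.
Proof.
elim: M x acc c => [|m M IH] x acc [|b c] //=.
by case: b => //=; rewrite ?IH //; case: x.
Qed.

(** The output matrix is block triangular: the row of g is 1 followed by [kap], and the rows of [fs]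
    are those of the self-equivalence preceded by 0. It is injective because its lower right block
    is. *)
Lemma ext_EAt A fs kap g g' : equivk 6 A fs fs -> size kap = size fs ->
  degle 2 6 (lin (tadd (precomp g A.1 A.2) g') fs kap) -> EAt (g :: fs) (g' :: fs).
Proof.
case/and4P => hA _ hr hi hk hd.
set fA := map _ fs in hr; set M := map _ fA in hr hi.
have sM : size M = size fs by rewrite !size_map.
exists A, ((true :: kap) :: map (cons false) M); split=> //.
- by rewrite /= size_map sM.
- change ((degle 2 6 (lin (tadd (precomp g A.1 A.2) g') fs kap) && (size kap == size fs))
    && rows_ok 6 fA (g' :: fs) (map (cons false) M)).
  rewrite hd hk eqxx /=; move: hr; rewrite /rows_ok.
  elim: fA M {hi sM} => [[|? ?] //|f l IH [|c M] // /andP [h1 /IH h2]].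
  by rewrite /= -/(degle 2 6) h2 andbT; exact: h1.
apply/allP => c; rewrite mem_allbits => /eqP; case: c => [|b c] // [hc].
have hc' : c \in allbits (size fs) by rewrite mem_allbits hc.
have := allP hi _ hc' => /=; case: b => /=; rewrite /zeros /= -/(zeros _) blin_cons0 //=.
Qed.

(** Bookkeeping in characteristic 2 for [Nsum_act], checked on truth values. There [cg] and [ch] are
    g and h composed with the affine map, [kp] is the summand from the span, [y] the composed block
    part and [b] the new block part. *)
Lemma act_identity n cg kp h ch y b :
  treen n cg -> treen n kp -> treen n h -> treen n ch -> treen n y -> treen n b ->
  tadd (tadd cg kp) (tadd h b) =
  tadd (tadd (tadd (tadd (tadd h ch) kp) y) b) (tadd cg (tadd ch y)).
Proof.
move=> h1 h2 h3 h4 h5 h6; apply: (ev_ext (n := n)) => [||x hx]; try by rewrite !treen_add.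
rewrite !(evD (n := n)) ?treen_add //.
by case: (ev cg x); case: (ev kp x); case: (ev h x); case: (ev ch x); case: (ev y x); case: (ev b x).
Qed.

Lemma W_deg n t : treen n t -> W n t -> deg 2 n t.
Proof.
elim: n t => [|n IH] [a|l r] // ht; have [hl hr] : treen n l /\ treen n r by apply/andP.
move=> /andP [h1 h2]; rewrite deg_Node hl hr IH //=.
by case/(isconstP (treen_add hl hr)): h1 => b ->; apply: deg_const.
Qed.
Lemma lin_zeros acc ms k : lin acc ms (zeros k) = acc.
Proof. by elim: ms k acc => [|m ms IH] [|k] acc //=; rewrite -/(zeros k) IH. Qed.
Lemma comp_idA t : treen 6 t -> precomp t (idA 6).1 (idA 6).2 = t.
Proof.
move=> ht; have hA : wfA 6 (idA 6) by [].
apply: (ev_ext (treen_tcomp hA t) ht) => x hx; rewrite ev_comp //; congr (ev _ _).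
have : all (fun x => blin (idA 6).2 (idA 6).1 x == x) (allbits 6) by [].
by move=> /allP /(_ x); rewrite mem_allbits hx => /(_ isT) /eqP.
Qed.

Section Soundness.
Variables (fs : seq tree) (Phi : seq tree -> nat).
Let F g := Phi (g :: fs).
Let supp g := treen 6 g && (F g != 0).
Hypothesis fs6 : all (deg 4 6) fs.
Hypothesis Phi_EA : forall f1 f2, size f1 = (size fs).+1 -> all (treen 6) f1 -> all (treen 6) f2 -> EAt f1 f2 -> Phi f1 = Phi f2.
Hypothesis supp_deg : forall g, supp g -> deg 4 6 g.
Hypothesis supp_bal : forall g k u, supp g -> k \in span 6 fs -> size u = 6 -> has id u ->
  ones (deriv u (tadd g k)) = 32.

Let tfs : all (treen 6) fs. Proof. exact: sub_deg fs6. Qed.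

(** The total weight of the completions of the prefix h: for g and h of degree at most 3, [W j] of
    their sum says that they share all quadratic and cubic coefficients with least variable before
    x_j. *)
Definition Nsum j h := \sum_(g <- tables | W j (tadd g h)) F g.

Lemma treen_block6 j k : j + k = 5 -> all (treen 6) (block j k).
Proof. by move=> jk; have := treen_block j k; rewrite addnS jk. Qed.

(** By [splitW], each g of nonzero weight that completes h is counted for exactly one [c]. The
    degree bound on the support enters here. *)
Lemma Nsum_split j k h : j + k = 5 -> deg 4 6 h ->
  Nsum j h = \sum_(c <- allbits (size (nc 3 k))) Nsum j.+1 (lin h (block j k) c).
Proof.
move=> jk dh; have th := deg_treen dh; rewrite /Nsum; under [RHS]eq_bigr => c _ do rewrite big_mkcond.
rewrite exchange_big /= big_mkcond /= !big_seq; apply: eq_bigr => g; rewrite mem_tables => tg.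
case: (eqVneq (F g) 0) => [->|hg]; first by rewrite if_same big1 // => c _; rewrite if_same.
have dg : deg 4 6 g by apply: supp_deg; apply/andP.
have dgh : deg 4 (j + k.+1) (tadd g h) by rewrite addnS jk deg_add.
have tb := treen_block6 jk.
rewrite -big_mkcond /= big_seq_cond.
rewrite (eq_bigl (fun c => (c \in allbits (size (nc 3 k))) && (W j (tadd g h) && (c == bcode j k (tadd g h))))); last first.
  move=> c; rewrite mem_allbits; case: eqP => //= hc; rewrite -splitW //.
  have -> : tzero (j + k.+1) = tzero 6 by rewrite addnS jk.
  by rewrite (linE (n := 6)) // (taddA (n := 6)); auto.
case: (W j (tadd g h)); last by rewrite big_pred0 // => c; rewrite andbF.
have sb : size (bcode j k (tadd g h)) = size (nc 3 k).
  move: (tadd g h) (deg_treen dgh) => d {dgh jk}.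
  elim: (j) d => [|i IH] [a|l r] //=; first by case/andP => ? ?; rewrite size_ncf; auto.
  by case/andP => ? ?; apply: IH.
rewrite -big_seq_cond -big_filter.
have -> : [seq c <- allbits (size (nc 3 k)) | true && (c == bcode j k (tadd g h))] = [:: bcode j k (tadd g h)].
  by rewrite /= filter_pred1_uniq ?uniq_allbits // mem_allbits sb.
by rewrite big_seq1.
Qed.

(** The map [s], composition with A followed by adding [kp], permutes the truth tables, keeps the
    weight by EA-invariance, and carries the completions of the prefix with block [c] to those of
    the prefix with block [a]. *)
Lemma Nsum_act j k h A kap T c : j + k = 5 -> treen 6 h ->
  gen j fs h A kap = Some T -> size c = size (nc 3 k) ->
  Nsum j.+1 (lin h (block j k) (look T c)) = Nsum j.+1 (lin h (block j k) c).
Proof.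
move=> jk th; have ek : 5 - j = k by rewrite -jk addKn.
have j6 : j.+1 <= 6 by rewrite ltnS -jk leq_addr.
rewrite /gen ek; set bl := block j k; case: ifP => // /and3P [hE hfl /eqP hk].
set t := lin _ fs kap; set base := bcode j k t; set bA := map _ bl; set cols := map _ bA.
case: ifP => // /and3P [h1 /eqP h2 h3] [<-] hc.
have scols : size cols = size bl by rewrite !size_map.
rewrite look_ctab; last by rewrite scols size_block.
set a := blin base cols c.
have hA : wfA 6 A by case/and4P: hE.
have tbl : all (treen 6) bl by exact: treen_block6.
pose C g := precomp g A.1 A.2.
have tC g : treen 6 (C g) := treen_tcomp hA g.
pose kp := lin (tzero 6) fs kap.
have tkp : treen 6 kp by apply: treen_lin.
pose s g := tadd (C g) kp.
have ts g : treen 6 (s g) by apply: treen_add.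
have sE g : s g = lin (C g) fs kap by rewrite /s (linE (n := 6) (acc := C g)).
pose Bc x := lin (tzero 6) bl x.
have tB x : treen 6 (Bc x) by apply: treen_lin.
pose Z := tadd (lin t bA c) (Bc a).
have tbA : all (treen 6) bA by rewrite all_map; apply/allP => b _ /=; exact: tC.
have tt : treen 6 t by apply: treen_lin => //; apply: treen_add => //; exact: tC.
have tZ : treen 6 Z by apply: treen_add => //; apply: treen_lin.
have hZ : W j.+1 Z.
  have hstart : W j.+1 (tadd t (Bc base)) by rewrite /Bc -(linE (n := 6)).
  rewrite /Z /a; clear Z tZ.
  have sb : size base = size bl by [].
  move: h3 hstart tt sb; rewrite -/cols; clear -tbl tbA tB; clearbody base t.
  elim: bA cols c t base tbA => [|b bs IH] [|col cols] [|x c] t base //= /andP [tb tbs] /andP [/andP [hb /eqP sc] hbs] hw tt sb.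
  apply: IH => //; case: x => //; rewrite ?size_bxor ?sb ?sc //; last by apply: treen_add.
  have -> : Bc (bxor base col) = tadd (Bc base) (Bc col).
    by rewrite /Bc lin_bxor.
  rewrite (taddACA (n := 6)) // (W_add (n := 6)) //; try by apply: treen_add.
  by move: hb; rewrite (linE (n := 6)).
have hW g : treen 6 g -> W j.+1 (tadd (s g) (lin h bl a)) = W j.+1 (tadd g (lin h bl c)).
  move=> tg; set y := lin h bl c.
  have ty : treen 6 y by apply: treen_lin.
  have tY : treen 6 (lin (tzero 6) bA c) by apply: treen_lin.
  have eY : tcomp A y = tadd (C h) (lin (tzero 6) bA c).
    transitivity (lin (C h) bA c); last exact: linE.
    by apply/esym; apply: (lin_map (n := 6) (f := C)) => // u v hu hv; exact: (tcompD hA).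
  have eZ : Z = tadd (tadd (tadd (tadd h (C h)) kp) (lin (tzero 6) bA c)) (Bc a).
    rewrite /Z (linE (n := 6) c tt tbA); congr (tadd (tadd _ _) _).
    exact: (linE (n := 6) kap (treen_add th (tC h)) tfs).
  have ea : lin h bl a = tadd h (Bc a) by exact: linE.
  have -> : tadd (s g) (lin h bl a) = tadd Z (tcomp A (tadd g y)).
    rewrite eZ ea (tcompD hA tg ty) eY; exact: (act_identity (n := 6)).
  by rewrite (W_add (n := 6) tZ _ hZ) ?(W_tcomp hA j6 hfl) // ?treen_tcomp ?treen_add.
have hF g : treen 6 g -> F (s g) = F g.
  move=> tg; apply/esym/Phi_EA; [by [] | by apply/andP | by apply/andP; split; [exact: ts|] |].
  apply: (ext_EAt (kap := kap) hE hk).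
  rewrite -/(C g) (linE (n := 6)) //; last by apply: treen_add.
  rewrite -/kp /s (taddA (n := 6)) // (taddK (tC g)) tadd0l // (taddK tkp).
  by case/andP: (deg_zero 2 6).
have hp : perm_eq (map s tables) tables.
  apply: perm_tables => [g1 _|g1 g2 t1 t2]; first exact: ts.
  move/(f_equal (tadd^~ kp)); rewrite !(taddKK (n := 6)); try exact: tC; try exact: tkp.
  exact: (tcomp_inj hA).
rewrite /Nsum -(perm_big _ hp) big_map big_mkcond [RHS]big_mkcond big_seq [RHS]big_seq.
by apply: eq_bigr => g; rewrite mem_tables => tg; rewrite hW // hF.
Qed.

Lemma premonos_deg j : j <= 6 -> all (deg 4 6) (premonos j).
Proof.
elim: j => // j IH hj; rewrite [premonos _]/= all_cat IH; last exact: ltnW.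
by have := all_block j (5 - j); rewrite addnS subnKC.
Qed.

Definition vtab j (tab : seq (seq bits * seq (trie * bits))) :=
  pall (fun e => exists w, [/\ size w = j, e.1 = map (code5 j (w ++ true :: zeros (5 - j))) (premonos j)
    & pall (valid supp j (w ++ true :: zeros (5 - j))) e.2]) tab.

Fixpoint vtabs r j (tbs : tabs) :=
  if r is r'.+1 then vtab j (head [::] tbs) /\ vtabs r' j.+1 (behead tbs) else True.

Lemma constraintsP j k hc c tab g : j + k = 5 -> vtab j tab -> size c = size (nc 3 k) ->
  supp g -> W j.+1 (tadd g (lin (lin (tzero 6) (premonos j) hc) (block j k) c)) ->
  pall (fun p => size p.2 = size c /\ tmem (bxor p.2 c) p.1)
    (constraints (15 - size (nc 3 k)) hc tab).
Proof.
move=> jk hv hc' hg hW; have ek : 5 - j = k by rewrite -jk addKn.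
have j6 : j <= 6 by rewrite (leq_trans (leq_addr k j)) ?jk.
apply/pall_flatten/pall_map; apply: pall_impl hv => -[cols l] [w [/= hw -> hl]].
apply/pall_map; apply: pall_impl hl => te; rewrite ek => hte.
exact: (valid_walk supp_deg jk hw hte (sub_deg (premonos_deg j6)) erefl hc' hg hW).
Qed.

Lemma pall_pmap (T S : Type) (f : T -> option S) (P : S -> Prop) s :
  (forall x a, f x = Some a -> P a) -> pall P (pmap f s).
Proof.
move=> hf; elim: s => //= x s IH; case E: (f x) => [a|] //=; split=> //; exact: hf E.
Qed.

Lemma node_actsP j k fs' h gs : fs' = fs -> j + k = 5 -> treen 6 h ->
  pall (fun a => forall c, size c = size (nc 3 k) ->
    Nsum j.+1 (lin h (block j k) (look a c)) = Nsum j.+1 (lin h (block j k) c)) (node_acts j fs' h gs).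
Proof.
move=> -> jk th; rewrite /node_acts pall_cat; split.
  by apply: pall_pmap => x a E c hc; apply: (Nsum_act jk th E hc).
case: j jk => // jk; apply: pall_pmap => x a E c hc; exact: (Nsum_act jk th E hc).
Qed.

Lemma collectP (T : Type) (l : seq T) (w : T -> N) (f : T -> option (seq (N * nat))) (v : T -> nat) (u : nat -> nat) res :
  pall (fun x => forall res, f x = Some res -> v x = 128 * \sum_(p <- res) N.to_nat p.1 * u p.2) l ->
  collect (map (fun x => (w x, f x)) l) = Some res ->
  \sum_(x <- l) N.to_nat (w x) * v x = 128 * \sum_(p <- res) N.to_nat p.1 * u p.2.
Proof.
elim: l res => [|x l IH] res /=; first by move=> _ [<-]; rewrite !big_nil.
case=> hx hl; case E: (f x) => [y|] //; case E2: (collect _) => [z|] // [<-].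
rewrite big_cons (IH _ hl E2) (hx _ E) big_cat /= mulnDr; congr (_ + _).
rewrite mulnCA; congr (_ * _); rewrite big_map big_distrr /=; apply: eq_bigr => p _.
by rewrite N2Nat.inj_mul mulnA.
Qed.

Lemma sum_zipD (T : Type) (os : seq T) cs (G : T -> nat) :
  \sum_(o <- os) G o = \sum_(x <- zipD os cs) G x.1.
Proof. by elim: os cs => [|o os IH] cs; rewrite ?big_nil //= !big_cons -IH. Qed.
Lemma pall_zipD (T : Type) (P : T -> Prop) os cs : pall P os -> pall (fun x => P x.1) (zipD os cs).
Proof. by elim: os cs => //= o os IH cs [h1 h2]; split=> //; exact: IH. Qed.

(** At the bottom the completions of h are h + d with d affine, all EA-equivalent over [fs]. The
    hypothesis on [idA] supplies the output matrix for the identity map. *)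
Lemma Nsum_leaf h : deg 4 6 h -> equivk 6 (idA 6) fs fs -> Nsum 6 h = 128 * Phi (h :: fs).
Proof.
move=> dh hid; have th := deg_treen dh.
have hp : perm_eq (map (tadd^~ h) tables) tables.
  apply: perm_tables => [t ht|s t hs ht]; first exact: treen_add.
  by move/(f_equal (tadd^~ h)); rewrite !(taddKK (n := 6)).
rewrite /Nsum -(perm_big _ hp) big_map -sum_W_tables big_distrl /=.
rewrite big_mkcond [RHS]big_mkcond big_seq [RHS]big_seq; apply: eq_bigr => d.
rewrite mem_tables => td; rewrite (taddKK (n := 6)) // mul1n; case: ifP => // hW.
apply/Phi_EA; [by [] | by apply/andP; split; [exact: treen_add|] | by apply/andP|].
apply: (ext_EAt hid (size_zeros (size fs))); rewrite lin_zeros comp_idA ?treen_add // (taddKK (n := 6)) //.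
by case/andP: (W_deg td hW).
Qed.

Lemma runP fuel reps tbs r j h hc c res : r + j = 6 -> equivk 6 (idA 6) fs fs ->
  all (all (treen 6)) reps ->
  vtabs r j tbs -> h = lin (tzero 6) (premonos j) hc -> size hc = size (premonos j) ->
  run fuel fs reps tbs r j h hc c = Some res ->
  Nsum j h = 128 * \sum_(p <- res) N.to_nat p.1 * Phi (nth [::] reps p.2).
Proof.
move=> hrj hid hreps; elim: r j tbs h hc c res hrj => [|r IH] j tbs h hc c res hrj hv hh hs.
  move: hrj hv hh hs; rewrite add0n => -> _ hh hs.
  have dh : deg 4 6 h by rewrite hh deg_lin ?deg_zero ?premonos_deg.
  rewrite run0E; case: c => [|i x|? ?]; try discriminate; case E: (equivk _ _ _ _); last discriminate.
  move=> [<-]; rewrite big_seq1 (Nsum_leaf dh hid) [(_, _).1]/= [(_, _).2]/= -[N.to_nat 1]/1 mul1n; have hE := E.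
  congr (_ * _); apply: Phi_EA; [by [] | | |exact: (equivkP hE)].
    by apply/andP; split=> //; exact: deg_treen dh.
  (* An index out of range denotes the empty tuple, which trivially consists of truth tables. *)
  case: (ltnP (N.to_nat i) (size reps)) => hi; last by rewrite nth_default.
  exact: (allP hreps _ (mem_nth _ hi)).
have jk : j + r = 5 by apply/eqP; rewrite -(eqn_add2r 1) addn1 -addnS addnC hrj.
have j6 : j <= 6 by rewrite (leq_trans (leq_addr r j)) ?jk.
have dh : deg 4 6 h by rewrite hh deg_lin ?deg_zero ?premonos_deg.
have th := deg_treen dh.
case: hv => hv1 hv2; rewrite runSE; cbv zeta.
set nb := size (nc 3 r); set T := cuts _ _; set acts := node_acts _ _ _ _.
case E: (orbits _ _ _) => [os|]; last discriminate.
have hT x : tmem x T -> size x = nb by move/cuts_sub; rewrite mem_full => /eqP.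
have hacts : pall (fun a => forall c, size c = nb ->
    Nsum j.+1 (lin h (block j r) (look a c)) = Nsum j.+1 (lin h (block j r) c)) acts.
  exact: node_actsP.
have [hsum hos] := orbitsP (G := fun c => Nsum j.+1 (lin h (block j r) c)) hacts hT E.
move: hsum; have -> : \sum_(x <- elems T) Nsum j.+1 (lin h (block j r) x) = Nsum j h.
  rewrite (Nsum_split jk dh) -/nb.
  have hp : perm_eq [seq x <- allbits nb | x \in elems T] (elems T).
    apply: uniq_perm; rewrite ?filter_uniq ?uniq_allbits ?uniq_elems // => x.
    rewrite mem_filter mem_allbits -mem_elems andbC; case hx: (tmem x T); rewrite ?andbF //.
    by rewrite (hT _ hx) eqxx.
  rewrite -(perm_big _ hp) big_filter big_mkcond !big_seq; apply: eq_bigr => x.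
  rewrite mem_allbits => /eqP hx; case: ifP => // hxT.
  (* A vector outside [T] has no completion of nonzero weight: such a g would meet every constraint
     and so place the vector in [T]. *)
  apply/esym; rewrite /Nsum big_seq_cond big1 // => g /andP []; rewrite mem_tables => tg hW.
  apply/eqP; apply/negPn/negP => hF; case/negP: (negbT hxT); rewrite -mem_elems.
  apply: cuts_mem; first by rewrite mem_full hx.
  by rewrite hh in hW; apply: (constraintsP jk hv1 hx _ hW); apply/andP.
move=> -> hcol; rewrite (sum_zipD _ (if c is B _ l then l else [::])).
apply: (collectP (v := fun x => Nsum j.+1 (lin h (block j r) x.1.1)) (u := fun i => Phi (nth [::] reps i)) _ hcol).
apply: (pall_impl _ (pall_zipD _ hos)) => -[[x n] ct] hx res'; apply: IH => //.
- by rewrite addnS.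
- by rewrite [premonos _]/= lin_cat // hh -jk addKn.
have -> : size (premonos j.+1) = size (premonos j) + size (block j r).
  by rewrite [premonos _]/= size_cat -jk addKn.
rewrite size_cat hs size_block; congr (_ + _); exact: hx.
Qed.

Lemma span_deg : all (deg 4 6) (span 6 fs).
Proof.
elim: fs fs6 => [|f l IH]; first by move=> _; apply/andP; split; [exact: deg_zero|].
case/andP => hf hl; rewrite [span _ _]/= all_cat IH // all_map.
by apply: sub_all (IH hl) => t ht; apply: deg_add.
Qed.

Lemma vtabs_drop M r j : (forall i, j <= i < j + r -> vtab i (nth [::] M i)) -> vtabs r j (drop j M).
Proof.
elim: r j => //= r IH j h; split.
  by rewrite -nth0 nth_drop addn0; apply: h; rewrite leqnn -addSnnS leq_addr.
have -> : behead (drop j M) = drop j.+1 M by rewrite -drop1 drop_drop add1n.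
by apply: IH => i /andP [h1 h2]; apply: h; rewrite ltnW // -addSnnS.
Qed.

Lemma mktabs_valid : vtabs 6 0 (mktabs (balt (nc 3 5) (tzero 5)) dtabs fs).
Proof.
rewrite -[mktabs _ _ _]drop0; apply: vtabs_drop => j /andP [_ hj].
rewrite nth_mkseq // /dtabs nth_mkseq // -map_comp /dirs -map_comp; apply/pall_map/pall_in => w.
rewrite mem_allbits => /eqP hw; exists w; rewrite subSS.
have j5 : j <= 5 by [].
have hks : pall (valid supp j (w ++ true :: zeros (5 - j)))
    (map (fun k => (balt (nc 3 5) (tzero 5), code5 j (w ++ true :: zeros (5 - j)) k)) (span 6 fs)).
  apply/pall_map/pall_in => k hk.
  exact: (valid_bal span_deg supp_deg supp_bal (subnKC j5) erefl hw hk).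
split; [exact: hw | exact: erefl |].
lazy beta zeta iota delta [ssrfun.comp snd fst]; case: (j < 2); last exact: hks.
by split; [exact: (valid_cuts supp_deg j5 hks) | exact: I].
Qed.

Theorem search_sound fuel reps c res :
  equivk 6 (idA 6) fs fs -> all (all (treen 6)) reps ->
  run fuel fs reps (mktabs (balt (nc 3 5) (tzero 5)) dtabs fs) 6 0 (tzero 6) [::] c = Some res ->
  \sum_(g <- tables) Phi (g :: fs) = 128 * \sum_(p <- res) N.to_nat p.1 * Phi (nth [::] reps p.2).
Proof.
move=> hid hreps hrun.
have h0 : tzero 6 = lin (tzero 6) (premonos 0) [::] by [].
rewrite -(@runP fuel reps _ 6 0 (tzero 6) [::] c res (erefl _) hid hreps mktabs_valid h0 (erefl _) hrun).
by rewrite /Nsum; apply: eq_bigl => g; case: (tadd _ _).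
Qed.
End Soundness.

Local Open Scope ring_scope.

(** * Walsh transform of truth tables *)

Definition sg (b : bool) : int := if b then -1 else 1.
Fixpoint dotb (a x : bits) : bool := match a, x with
  | c :: a', y :: x' => (c && y) (+) dotb a' x' | _, _ => false end.
Fixpoint wht t (a : bits) : int := match t, a with
  | Leaf b, _ => sg b
  | Node l r, c :: a' => wht l a' + sg c * wht r a'
  | _, _ => 0 end.

Lemma sgD a b : sg (a (+) b) = sg a * sg b.
Proof. by case: a; case: b. Qed.

Lemma sum_allbitsS (R : nmodType) n (f : bits -> R) :
  \sum_(x <- allbits n.+1) f x = \sum_(x <- allbits n) f (false :: x) + \sum_(x <- allbits n) f (true :: x).
Proof. by rewrite /= big_cat !big_map. Qed.

Lemma whtE n t a : treen n t -> size a = n ->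
  wht t a = \sum_(x <- allbits n) sg (ev t x (+) dotb a x).
Proof.
elim: n t a => [|n IH] [b|l r] [|c a] // ht ha; first by rewrite big_seq1 /= addbF.
have [hl hr] : treen n l /\ treen n r by apply/andP.
case: ha => ha; rewrite sum_allbitsS [LHS]/= (IH _ _ hl ha) (IH _ _ hr ha) big_distrr /=.
congr (_ + _); apply: eq_bigr => x _ /=; rewrite ?andbF ?andbT ?addFb //.
by rewrite -sgD; congr sg; case: c; case: (ev r x); case: (dotb a x).
Qed.

Fixpoint corr s t : int := match s, t with
  | Leaf a, Leaf b => sg a * sg b
  | Node a b, Node c d => corr a c + corr b d
  | _, _ => 0 end.

(** Parseval twisted by the character of u, which turns the plain correlation into the correlation
    with a shift. For s = t bent of 6 variables all products are 64, the character sum vanishes for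
    u nonzero, and the derivative in direction u is balanced. *)
Lemma parseval n s t u : treen n s -> treen n t -> size u = n ->
  \sum_(a <- allbits n) sg (dotb a u) * wht s a * wht t a = 2 ^+ n * corr s (tshift u t).
Proof.
elim: n s t u => [|n IH] [x|l r] [y|l' r'] [|c u] // hs ht hu.
  by rewrite big_seq1 /= expr0 !mul1r.
have [hl hr] : treen n l /\ treen n r by apply/andP.
have [hl' hr'] : treen n l' /\ treen n r' by apply/andP.
case: hu => hu; rewrite sum_allbitsS -big_split /=.
have h1 := IH _ _ _ hl hl' hu; have h2 := IH _ _ _ hl hr' hu.
have h3 := IH _ _ _ hr hl' hu; have h4 := IH _ _ _ hr hr' hu.
case: c => /=.
  transitivity (2 * (\sum_(a <- allbits n) sg (dotb a u) * wht l a * wht r' a + \sum_(a <- allbits n) sg (dotb a u) * wht r a * wht l' a)).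
    rewrite -big_split big_distrr /=; apply: eq_bigr => a _; rewrite /= ?addFb ?addTb.
    have -> : sg (~~ dotb a u) = - sg (dotb a u) by case: dotb.
    move: (sg (dotb a u)) => z; ring.
  by rewrite h2 h3 exprS; ring.
transitivity (2 * (\sum_(a <- allbits n) sg (dotb a u) * wht l a * wht l' a + \sum_(a <- allbits n) sg (dotb a u) * wht r a * wht r' a)).
  rewrite -big_split big_distrr /=; apply: eq_bigr => a _; rewrite /= ?addFb /=; move: (sg (dotb a u)) => z; ring.
by rewrite h1 h4 exprS; ring.
Qed.

Lemma corr_ones n s t : treen n s -> treen n t -> corr s t = (2 ^ n)%N%:Z - 2 * (ones (tadd s t))%:Z.
Proof.
elim: n s t => [|n IH] [x|l r] [y|l' r'] // hs ht; first by case: (x); case: (y).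
have [hl hr] : treen n l /\ treen n r by apply/andP.
have [hl' hr'] : treen n l' /\ treen n r' by apply/andP.
by rewrite /= !IH // expnS mul2n -addnn !PoszD; ring.
Qed.

Lemma sum_sg_dotb n u : size u = n -> has id u -> \sum_(a <- allbits n) sg (dotb a u) = 0.
Proof.
elim: n u => [|n IH] [|c u] // [hu] h; rewrite sum_allbitsS /=.
case: c h => [_|/= h] /=; last by rewrite (IH u hu h).
by rewrite -big_split big1 //= => a _; case: (dotb a u).
Qed.

Definition bentT t := forall a, size a = 6 -> wht t a = 8 \/ wht t a = - 8.

Lemma bentT_balanced t u : treen 6 t -> bentT t -> size u = 6 -> has id u -> ones (deriv u t) = 32.
Proof.
move=> ht hb hu h; have := parseval ht ht hu.
rewrite big_seq (eq_bigr (fun a => 64 * sg (dotb a u))); last first.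
  move=> a; rewrite mem_allbits => /eqP /hb [] ->; ring.
rewrite -big_seq -big_distrr /= (sum_sg_dotb hu h) (corr_ones ht (treen_shift _ ht)) -/(deriv u t).
by rewrite mulr0; lia.
Qed.

(** * Subcube sums and the degree of a bent function *)

Fixpoint cube_ones (e : bits) t : nat := match e, t with
  | c :: e', Node l r => (if c then cube_ones e' l + cube_ones e' r else cube_ones e' l)%N
  | _, Leaf b => b
  | _, _ => 0%N end.
(** The orthogonal complement of the coordinate subspace spanned by the support of e; [cube_ones] is
    the number of ones on that coordinate subspace. *)
Fixpoint cube_perp (e : bits) : seq bits := match e with
  | c :: e' => if c then map (cons false) (cube_perp e')
               else map (cons false) (cube_perp e') ++ map (cons true) (cube_perp e')
  | [::] => [:: [::]] end.

Lemma cube_onesD n e s t : treen n s -> treen n t -> size e = n ->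
  odd (cube_ones e (tadd s t)) = odd (cube_ones e s) (+) odd (cube_ones e t).
Proof.
elim: n e s t => [|n IH] [|c e] [x|l r] [y|l' r'] // hs ht he; first by case: (x); case: (y).
have [hl hr] : treen n l /\ treen n r by apply/andP.
have [hl' hr'] : treen n l' /\ treen n r' by apply/andP.
case: he => he; case: c => /=; rewrite ?oddD !IH //.
by rewrite -!addbA; congr (_ (+) _); rewrite !addbA; congr (_ (+) _); rewrite addbC.
Qed.

(** Moebius inversion: the parity of the number of ones on the subcube below e is the coefficient of
    the monomial with exponent e. *)
Lemma degle_cube d n t : treen n t ->
  (forall e, size e = n -> (d <= count id e)%N -> ~~ odd (cube_ones e t)) -> degle d n t.
Proof.
elim: n d t => [|n IH] d [x|l r] // ht h.
  by case: d h => //= h; have := h [::] erefl isT => /=; case: (x).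
have [hl hr] : treen n l /\ treen n r by apply/andP.
rewrite /= IH //=; last by move=> e he hc; have := h (false :: e); rewrite /= he => /(_ erefl); apply.
apply: IH; first exact: treen_add.
move=> e he hc; rewrite (cube_onesD hl hr he); have := h (true :: e).
rewrite /= he => /(_ erefl); rewrite oddD; apply.
by case: d hc {h}.
Qed.

(** Poisson summation for a coordinate subspace: summing Walsh values over its complement recovers
    the sum of the signs on the subspace itself. *)
Lemma wht_cube n e t : treen n t -> size e = n ->
  \sum_(a <- cube_perp e) wht t a * 2 ^+ count id e = 2 ^+ n * ((2 ^ count id e)%N%:Z - 2 * (cube_ones e t)%:Z).
Proof.
elim: n e t => [|n IH] [|c e] [x|l r] // ht he; first by rewrite big_seq1 /= expr0; case: (x).
have [hl hr] : treen n l /\ treen n r by apply/andP.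
case: he => he; have h1 := IH e l hl he; have h2 := IH e r hr he.
case: c => /=; rewrite ?big_cat !big_map /=.
  transitivity (2 * (\sum_(a <- cube_perp e) wht l a * 2 ^+ count id e + \sum_(a <- cube_perp e) wht r a * 2 ^+ count id e)).
    by rewrite -big_split big_distrr /=; apply: eq_bigr => a _; rewrite add1n exprS; ring.
  by rewrite h1 h2 exprS add1n expnS PoszM PoszD; ring.
rewrite add0n -big_split /= exprS -mulrA -h1 big_distrr /=; apply: eq_bigr => a _; ring.
Qed.

Lemma size_cube_perp e : (size (cube_perp e) * 2 ^ count id e = 2 ^ size e)%N.
Proof.
elim: e => // c e IH; case: c => /=; rewrite ?size_cat !size_map expnS -IH ?add1n ?add0n ?expnS; lia.
Qed.
Lemma mem_cube_perp e a : a \in cube_perp e -> size a = size e.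
Proof.
elim: e a => [|c e IH] a /=; first by rewrite inE => /eqP ->.
by case: c; rewrite ?mem_cat => h; [|case/orP: h => h]; (case/mapP: h => x /IH <- ->).
Qed.

Lemma sum_pm8 (s : seq bits) (f : bits -> int) : (forall a, a \in s -> f a = 8 \/ f a = -8) ->
  exists m : nat, \sum_(a <- s) f a = 8 * ((size s)%:Z - 2 * m%:Z).
Proof.
elim: s => [|a s IH] h; first by exists 0%N; rewrite big_nil.
have [|m hm] := IH; first by move=> x hx; apply: h; rewrite inE hx orbT.
rewrite big_cons hm /=; case: (h a (mem_head _ _)) => ->; [exists m | exists m.+1]; lia.
Qed.

Lemma bentT_deg t : treen 6 t -> bentT t -> deg 4 6 t.
Proof.
move=> ht hb; rewrite /deg ht; apply: degle_cube => // e he hc.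
have := wht_cube ht he; rewrite -big_distrl /=.
have [m ->] : exists m : nat, \sum_(a <- cube_perp e) wht t a = 8 * ((size (cube_perp e))%:Z - 2 * m%:Z).
  by apply: sum_pm8 => a /mem_cube_perp ha; apply: hb; rewrite ha.
have := size_cube_perp e; rewrite he.
have : (count id e <= 6)%N by rewrite -he count_size.
(* Subcubes of dimension 4, 5 and 6 remain. Here [p] counts the Walsh values in the sum and [q] the
   ones on the subcube; since each value is 8 or -8, [q] comes out as 4, 12 or 28 plus an even
   number. *)
move: (size (cube_perp e)) (cube_ones e t) (count id e) hc => p q [|[|[|[|[|[|[|k]]]]]]] // _ _ h1 h2.
- have hp : p = 4%N by lia.
  subst p; have : (q = 4 + 2 * m)%N by lia.
  by move=> ->; rewrite oddD oddM.
- have hp : p = 2%N by lia.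
  subst p; have : (q = 12 + 4 * m)%N by lia.
  by move=> ->; rewrite oddD oddM.
- have hp : p = 1%N by lia.
  subst p; have : (q = 28 + 8 * m)%N by lia.
  by move=> ->; rewrite oddD oddM.
Qed.

(** * Extended-affine equivalence *)

Lemma F2_cases (P : 'F_2 -> Prop) : P 0 -> P 1 -> forall a, P a.
Proof.
move=> h0 h1 a; case: a => [[|[|k]] hk] //.
  by have -> : Ordinal hk = 0 by apply: val_inj.
by have -> : Ordinal hk = 1 by apply: val_inj.
Qed.
Lemma sgnF2D a b : sgnF2 (a + b) = sgnF2 a * sgnF2 b.
Proof. by elim/F2_cases: a; elim/F2_cases: b. Qed.
Lemma sgnF2_pm a : sgnF2 a = 1 \/ sgnF2 a = -1.
Proof. by elim/F2_cases: a; [left | right]. Qed.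

Ltac zring := apply/rowP => ?; rewrite !mxE; ring.

Lemma addF2 k (x : 'rV['F_2]_k) : x + x = 0.
Proof. by apply/rowP => i; rewrite !mxE; elim/F2_cases: (x 0 i); apply: val_inj. Qed.
Lemma second_diff_affine k (p q r t e f g c : 'rV['F_2]_k) :
  p + (e + c) + (q + (e + f + c)) + (r + (e + g + c)) + (t + (e + f + g + c)) = p + q + r + t.
Proof.
transitivity (p + q + r + t + (e + e + (e + e) + (f + f + (g + g)) + (c + c + (c + c)))); first by zring.
by rewrite !addF2 !addr0.
Qed.

Section Dot.
Variable n : nat.
Implicit Types u v w : 'rV['F_2]_n.
Lemma dotDl u v w : dot (u + v) w = dot u w + dot v w.
Proof. by rewrite /dot mulmxDl mxE. Qed.
Lemma dotDr u v w : dot u (v + w) = dot u v + dot u w.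
Proof. by rewrite /dot linearD mulmxDr mxE. Qed.
Lemma dot_mul m u (v : 'rV_m) (M : 'M['F_2]_(m, n)) : dot u (v *m M) = dot (u *m M^T) v.
Proof. by rewrite /dot trmx_mul mulmxA. Qed.
Lemma dot0l u : dot 0 u = 0. Proof. by rewrite /dot mul0mx mxE. Qed.
End Dot.

Lemma dot_row m1 m2 (b1 x : 'rV_m1) (b2 y : 'rV_m2) :
  dot (row_mx b1 b2) (row_mx x y) = dot b1 x + dot b2 y.
Proof. by rewrite /dot tr_row_mx mul_row_col mxE. Qed.

Section EA.
Variables n m : nat.
Notation V := 'rV['F_2]_n.
Notation fn := {ffun V -> 'rV['F_2]_m}.
Implicit Types F G H : fn.

Lemma EAP F G : reflect (exists M1 M2 v M3 c, [/\ M1 \in unitmx, M2 \in unitmx &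
   forall x, F x = G (x *m M2 + v) *m M1 + (x *m M3 + c)]) (EAeq F G).
Proof.
apply: (iffP idP).
  case/existsP => M1 /existsP [M2 /existsP [v /existsP [M3 /existsP [c /and3P [h1 h2 /forallP h3]]]]].
  by exists M1, M2, v, M3, c; split=> // x; apply/eqP.
case=> M1 [M2 [v [M3 [c [h1 h2 h3]]]]].
apply/existsP; exists M1; apply/existsP; exists M2; apply/existsP; exists v.
apply/existsP; exists M3; apply/existsP; exists c; rewrite h1 h2 /=.
by apply/forallP => x; rewrite h3.
Qed.

Lemma EA_refl F : EAeq F F.
Proof.
apply/EAP; exists 1%:M, 1%:M, 0, 0, 0; split=> [||x]; rewrite ?unitmx1 //.
by rewrite !mulmx1 mulmx0 !addr0.
Qed.
Lemma EA_sym F G : EAeq F G -> EAeq G F.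
Proof.
case/EAP=> M1 [M2 [v [M3 [c [h1 h2 h3]]]]]; apply/EAP.
exists (invmx M1), (invmx M2), (- v *m invmx M2).
exists (- (invmx M2 *m M3 *m invmx M1)), (- ((c - v *m invmx M2 *m M3) *m invmx M1)).
split=> [||y]; rewrite ?unitmx_inv //; set x := y *m invmx M2 + _.
have hx : x *m M2 + v = y by rewrite mulmxDl mulNmx mulNmx !mulmxKV // subrK.
rewrite h3 hx mulmxDl mulmxK // /x.
rewrite !mulmxDl ?mulmxDr ?mulmxN ?mulNmx !mulmxA ?mulmxDl ?mulmxN ?mulNmx.
move: (G y) (y *m _ *m _ *m _) (v *m _ *m _ *m _) (c *m _) => p q r t; zring.
Qed.
Lemma EA_trans F G H : EAeq F G -> EAeq G H -> EAeq F H.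
Proof.
case/EAP=> M1 [M2 [v [M3 [c [h1 h2 h3]]]]] /EAP [N1 [N2 [w [N3 [d [k1 k2 k3]]]]]]; apply/EAP.
exists (N1 *m M1), (M2 *m N2), (v *m N2 + w), (M2 *m N3 *m M1 + M3), ((v *m N3 + d) *m M1 + c).
split=> [||x]; rewrite ?unitmx_mul ?h1 ?h2 ?k1 ?k2 //.
have -> : x *m (M2 *m N2) + (v *m N2 + w) = (x *m M2 + v) *m N2 + w.
  by rewrite mulmxDl mulmxA addrA.
rewrite h3 k3 -mulmxA; set p := H _.
rewrite !(mulmxDl _ _ M1) mulmxDr (mulmxDl _ _ N3) (mulmxDl _ _ M1) !mulmxA.
move: (x *m M3) (d *m M1) (v *m N3 *m M1) (x *m M2 *m N3 *m M1) (p *m N1 *m M1) => o q r t e; zring.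
Qed.

(** Substituting the affine permutation moves a, and the constants contribute a sign. Only the
    change of b must be by one fixed invertible matrix, so that nonzero b stays nonzero. *)
Lemma walsh_EA F G : EAeq F G -> exists (N : 'M['F_2]_m), N \in unitmx /\
  forall a b, exists a' s, (s = 1 \/ s = -1) /\ walsh F a b = s * walsh G a' (b *m N).
Proof.
case/EAP=> M1 [M2 [v [M3 [c [h1 h2 h3]]]]]; exists M1^T; split; first by rewrite unitmx_tr.
move=> a b; set a' := (b *m M3^T + a) *m (invmx M2)^T.
exists a', (sgnF2 (dot b c + dot a' v)); split; first exact: sgnF2_pm.
rewrite /walsh big_distrr [RHS](reindex (fun x => x *m M2 + v)) /=; last first.
  exists (fun y => (y - v) *m invmx M2) => x _; first by rewrite addrK mulmxK.
  by rewrite mulmxKV // subrK.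
apply: eq_bigr => x _; rewrite -sgnF2D h3; congr sgnF2.
have e2 : dot a' (x *m M2) = dot (b *m M3^T + a) x by rewrite /a' -dot_mul mulmxK.
rewrite !dotDr e2 dotDl -!dot_mul.
set p := dot b (_ *m M1); set s := dot b (x *m M3); move: p (dot b c) (dot (_ + _) _) s (dot a x) => p q r s t.
by elim/F2_cases: p; elim/F2_cases: q; elim/F2_cases: r; elim/F2_cases: s; elim/F2_cases: t; apply: val_inj.
Qed.

Lemma bentP F : reflect (forall a b, b != 0 -> walsh F a b = (2 ^ n./2)%:Z \/ walsh F a b = - (2 ^ n./2)%:Z) (bent F).
Proof.
apply: (iffP idP) => h.
  move=> a b hb; move/forallP: h => /(_ a) /forallP /(_ b); rewrite hb /=.
  by case/orP => /eqP; [left | right].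
apply/forallP => a; apply/forallP => b; apply/implyP => hb; apply/orP.
by case: (h a b hb) => ->; [left | right].
Qed.

Lemma bent_EA F G : EAeq F G -> bent G -> bent F.
Proof.
move/walsh_EA=> [N [uN h]] /bentP hG; apply/bentP => a b hb.
have hb' : b *m N != 0.
  by apply: contra hb => /eqP e; rewrite -[b](mulmxK uN) e mul0mx.
have [a' [s [hs ->]]] := h a b.
by case: (hG a' _ hb') => ->; case: hs => ->; rewrite ?mul1r ?mulN1r ?opprK; auto.
Qed.
Lemma bent_EAE F G : EAeq F G -> bent F = bent G.
Proof. by move=> h; apply/idP/idP; apply: bent_EA; [apply: EA_sym|]. Qed.

End EA.

Section Ext.
Variables n m : nat.
Notation V := 'rV['F_2]_n.
Notation fn := {ffun V -> 'rV['F_2]_m}.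
Implicit Types F G : fn.

Definition rowf (g : {ffun V -> 'rV['F_2]_1}) F : {ffun V -> 'rV['F_2]_(1 + m)} :=
  [ffun x => row_mx (g x) (F x)].
Definition extsum (Psi : {ffun V -> 'rV['F_2]_(1 + m)} -> nat) F := (\sum_g Psi (rowf g F))%N.

(** Reindex the sum by composing g with the same affine permutation of the inputs, and let the
    output matrix act as the identity on the new coordinate. *)
Lemma extsum_EA Psi F G : (forall K1 K2, EAeq K1 K2 -> Psi K1 = Psi K2) ->
  EAeq F G -> extsum Psi F = extsum Psi G.
Proof.
move=> hPsi /EAP [M1 [M2 [v [M3 [c [h1 h2 h3]]]]]].
pose phi (g : {ffun V -> 'rV['F_2]_1}) := [ffun x => g (x *m M2 + v)].
rewrite /extsum (reindex phi) /=; last first.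
  exists (fun g => [ffun y => g ((y - v) *m invmx M2)]) => g _; apply/ffunP => x; rewrite !ffunE.
    by rewrite mulmxKV // subrK.
  by rewrite addrK mulmxK.
apply: eq_bigr => g _; apply: hPsi; apply/EAP.
exists (block_mx 1%:M 0 0 M1), M2, v, (row_mx 0 M3), (row_mx 0 c); split=> // [|x].
  by rewrite unitmxE det_ublock det1 mul1r -unitmxE.
by rewrite !ffunE h3 mul_row_block mul_mx_row !add_row_mx !mulmx1 !mulmx0 !addr0 ?add0r.
Qed.

Lemma walsh_rowf g F a b : walsh (rowf g F) a (row_mx 0 b) = walsh F a b.
Proof. by apply: eq_bigr => x _; rewrite ffunE dot_row dot0l add0r. Qed.
Lemma bent_rowfr g F : bent (rowf g F) -> bent F.
Proof.
move/bentP => h; apply/bentP => a b hb; rewrite -(walsh_rowf g); apply: h.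
by rewrite row_mx_eq0 negb_and hb orbT.
Qed.
Lemma bent_rowfl g F : bent (rowf g F) -> bent g.
Proof.
move/bentP => h; apply/bentP => a b hb.
have -> : walsh g a b = walsh (rowf g F) a (row_mx b 0).
  by apply: eq_bigr => x _; rewrite ffunE dot_row dot0l addr0.
by apply: h; rewrite row_mx_eq0 negb_and hb.
Qed.
Lemma bent_swap g F : bent (rowf g F) -> bent ([ffun x => row_mx (F x) (g x)] : {ffun V -> 'rV['F_2]_(m + 1)}).
Proof.
move/bentP => h; apply/bentP => a b hb.
have -> : walsh [ffun x => row_mx (F x) (g x)] a b = walsh (rowf g F) a (row_mx (rsubmx b) (lsubmx b)).
  by apply: eq_bigr => x _; rewrite !ffunE -{1}[b]hsubmxK !dot_row; congr sgnF2; congr (_ + _); exact: addrC.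
apply: h; move: hb; rewrite -{1}[b]hsubmxK !row_mx_eq0; by rewrite andbC.
Qed.

Lemma sum_rowf (Psi : {ffun V -> 'rV['F_2]_(1 + m)} -> nat) :
  (\sum_K Psi K = \sum_F extsum Psi F)%N.
Proof.
rewrite pair_big /= (reindex (fun p : fn * {ffun V -> 'rV['F_2]_1} => rowf p.2 p.1)) //=.
exists (fun H => ([ffun x => rsubmx (H x)] : fn, [ffun x => lsubmx (H x)])) => [[F g] _|H _] /=.
  by congr pair; apply/ffunP => x; rewrite !ffunE ?row_mxKr ?row_mxKl.
by apply/ffunP => x; rewrite !ffunE hsubmxK.
Qed.

(** * Second-derivative invariants and the count of classes *)

Definition DD F u v x := F x + F (x + u) + F (x + v) + F (x + u + v).
(** Ordered triangles, degenerate ones included, of the graph [adj] on the directions. In [T3] a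
    triple is counted once for each common zero. *)
Definition tri (adj : V -> V -> bool) := (\sum_u \sum_v \sum_w (adj u v && (adj v w && adj u w)))%N.
Definition tau F := tri (fun u v => [forall x, DD F u v x != 0]).
Definition T3 F := (\sum_x tri (fun u v => DD F u v x == 0%R))%N.

Lemma tri_lin M (a b : V -> V -> bool) : M \in unitmx -> (forall u v, a u v = b (u *m M) (v *m M)) -> tri a = tri b.
Proof.
move=> hM h.
have hb : bijective (fun u : V => u *m M) by exists (mulmx^~ (invmx M)) => x; rewrite ?mulmxK ?mulmxKV.
rewrite /tri [RHS](reindex _ (onW_bij _ hb)); apply: eq_bigr => u _.
rewrite [RHS](reindex _ (onW_bij _ hb)); apply: eq_bigr => v _.
by rewrite [RHS](reindex _ (onW_bij _ hb)); apply: eq_bigr => w _; rewrite !h.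
Qed.

(** Second derivatives kill the affine summand. What remains is a linear permutation of the
    directions, an affine permutation of the base points, and an invertible matrix on the values,
    which respects vanishing. *)
Lemma tau_T3_EA F G : EAeq F G -> tau F = tau G /\ T3 F = T3 G.
Proof.
case/EAP=> M1 [M2 [v0 [M3 [c [h1 h2 h3]]]]].
have hD u v x : DD F u v x = DD G (u *m M2) (v *m M2) (x *m M2 + v0) *m M1.
  rewrite /DD !h3 !mulmxDl ![_ + _ *m M2 + v0]addrAC.
  exact: second_diff_affine.
have hbij : bijective (fun x : V => x *m M2 + v0).
  exists (fun y => (y - v0) *m invmx M2) => x; first by rewrite addrK mulmxK.
  by rewrite mulmxKV // subrK.
have hz u v x : (DD F u v x == 0) = (DD G (u *m M2) (v *m M2) (x *m M2 + v0) == 0).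
  rewrite hD; apply/eqP/eqP => [e|->]; last by rewrite mul0mx.
  by rewrite -[DD G _ _ _](mulmxK h1) e mul0mx.
split.
  apply: (tri_lin h2) => u v; apply/forallP/forallP => h x; last by rewrite hz.
  by have [k k1 k2] := hbij; rewrite -[x]k2 -hz.
rewrite /T3 [RHS](reindex _ (onW_bij _ hbij)); apply: eq_bigr => x _.
by apply: (tri_lin h2) => u v; rewrite hz.
Qed.

(** Sealed in the same way as [tables], so that the set of functions is reached only through
    [EAclsE]. *)
Fact EAcls_key : {cls : fn -> {set fn} | forall F, cls F = [set G in bent_set n m | EAeq F G]}.
Proof. by exists (fun F => [set G in bent_set n m | EAeq F G]). Qed.
Definition EAcls := sval EAcls_key.
Lemma EAclsE F : EAcls F = [set G in bent_set n m | EAeq F G].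
Proof. exact: (svalP EAcls_key). Qed.
Lemma in_EAcls F G : (G \in EAcls F) = bent G && EAeq F G.
Proof. by rewrite EAclsE /bent_set 2!in_set. Qed.
Lemma EA_classes_count (rs : seq fn) : all (@bent n m) rs ->
  (forall F, bent F -> has (EAeq F) rs) ->
  pairwise (fun F G => (tau F != tau G) || (T3 F != T3 G)) rs ->
  #|EA_classes n m| = size rs.
Proof.
move=> hb hc hp; pose f (i : 'I_(size rs)) := EAcls (tnth (in_tuple rs) i).
have hE F G : EAeq F G -> EAcls F = EAcls G.
  move=> h.
  apply/setP => H.
  rewrite !in_EAcls.
  suff -> : EAeq F H = EAeq G H by [].
  by apply/idP/idP => h'; [apply: (EA_trans (EA_sym h) h') | apply: (EA_trans h h')].
have -> : EA_classes n m = [set f i | i in 'I_(size rs)].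
  apply/setP => C; apply/imsetP/imsetP => -[].
    move=> F; rewrite in_set => /hc /hasP [G hG hFG] ->; rewrite -EAclsE.
    have [i hi] := seq_tnthP hG; exists i => //.
    by rewrite /f -hi; exact: hE.
  by move=> i _ ->; exists (tnth (in_tuple rs) i); rewrite /f ?EAclsE // in_set; apply: (allP hb); exact: mem_tnth.
rewrite card_imset ?card_ord // => i j hij; apply/val_inj/eqP; apply: contraT => hne.
have F0 := tnth (in_tuple rs) i.
have {hij} : EAeq (nth F0 rs i) (nth F0 rs j).
  have : tnth (in_tuple rs) j \in f i.
    by rewrite hij in_EAcls EA_refl andbT; apply: (allP hb); exact: mem_tnth.
  by rewrite in_EAcls !(tnth_nth F0) => /andP [].
move/pairwiseP: hp => /(_ F0) hp.
wlog hlt : i j hne / (i < j)%N.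
  move=> hw; move: (hne); rewrite neq_ltn => /orP [h|h]; first exact: hw.
  by move/EA_sym; apply: hw; rewrite // neq_ltn h.
case/tau_T3_EA => h1 h2; have := hp i j; rewrite !inE !ltn_ord hlt => /(_ isT isT isT).
by rewrite h1 h2 !eqxx.
Qed.
End Ext.

(** * Vectorial functions as tuples of truth tables *)

Lemma F2E (a : 'F_2) : a = (a != 0)%:R.
Proof. by elim/F2_cases: a; apply: val_inj. Qed.
Lemma F2_addb (a b : bool) : (a (+) b)%:R = a%:R + b%:R :> 'F_2.
Proof. by case: a; case: b; apply: val_inj. Qed.
Lemma F2_andb (a b : bool) : (a && b)%:R = a%:R * b%:R :> 'F_2.
Proof. by case: a; case: b; apply: val_inj. Qed.
Lemma F2_neq0 (a : bool) : (a%:R != 0 :> 'F_2) = a.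
Proof. by case: a. Qed.
Lemma sgnF2_nat (b : bool) : sgnF2 b%:R = sg b.
Proof. by case: b. Qed.

Lemma nth_bxor a b i : size a = size b -> nth false (bxor a b) i = nth false a i (+) nth false b i.
Proof. by elim: a b i => [|x a IH] [|y b] [|i] //= [h]; [case: (x); case: (y) | apply: IH]. Qed.

Definition bitsv n (x : 'rV['F_2]_n) : bits := [seq x 0 i != 0 | i <- enum 'I_n].
Definition tov n (b : bits) : 'rV['F_2]_n := \row_i (nth false b i)%:R.

Section Vectors.
Variable n : nat.
Implicit Types x y : 'rV['F_2]_n.
Lemma size_bitsv x : size (bitsv x) = n. Proof. by rewrite size_map size_enum_ord. Qed.
Lemma nth_bitsv x (i : 'I_n) : nth false (bitsv x) i = (x 0 i != 0).
Proof. by rewrite (nth_map i) ?size_enum_ord // nth_ord_enum. Qed.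
Lemma bitsvK : cancel (@bitsv n) (@tov n).
Proof. by move=> x; apply/rowP => i; rewrite mxE nth_bitsv -F2E. Qed.
Lemma tovK b : size b = n -> bitsv (tov n b) = b.
Proof.
move=> hb; apply: (@eq_from_nth _ false); rewrite size_bitsv // => i hi.
by rewrite (nth_bitsv _ (Ordinal hi)) mxE F2_neq0.
Qed.
Lemma sum_bits (R : nmodType) (f : bits -> R) : \sum_(x : 'rV['F_2]_n) f (bitsv x) = \sum_(b <- allbits n) f b.
Proof.
rewrite -(big_map (@bitsv n) xpredT f); apply: perm_big; apply: uniq_perm.
- by rewrite map_inj_uniq ?index_enum_uniq //; exact: can_inj bitsvK.
- exact: uniq_allbits.
move=> b; rewrite mem_allbits; apply/mapP/eqP => [[x _ ->]|hb]; first exact: size_bitsv.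
by exists (tov n b); rewrite ?mem_index_enum ?tovK.
Qed.
Lemma tovD a b : size a = size b -> tov n (bxor a b) = tov n a + tov n b.
Proof. by move=> h; apply/rowP => i; rewrite !mxE nth_bxor // F2_addb. Qed.
Lemma bitsvD x y : bitsv (x + y) = bxor (bitsv x) (bitsv y).
Proof.
rewrite -(tovK (b := bxor _ _)) ?tovD ?bitsvK // ?size_bxor ?size_bitsv //.
Qed.
Lemma tov_zeros k : tov n (zeros k) = 0.
Proof. by apply/rowP => i; rewrite !mxE nth_nseq if_same. Qed.
Lemma has_bitsv x : has id (bitsv x) = (x != 0).
Proof.
apply/idP/idP => [h|]; last first.
  apply: contraR => /not_has e; rewrite -[x]bitsvK e size_bitsv tov_zeros eqxx //.
apply/eqP => e; move: h; rewrite e -[0](tov_zeros n) tovK ?size_zeros //.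
by rewrite has_zeros.
Qed.
Lemma sum_dotb (a b : bits) : size a = n -> size b = n ->
  \sum_(i < n) (nth false a i)%:R * (nth false b i)%:R = (dotb a b)%:R :> 'F_2.
Proof.
elim: n a b => [|k IH] [|c a] [|d b] // ha hb; first by rewrite big_ord0.
case: ha => ha; case: hb => hb; rewrite big_ord_recl /= F2_addb F2_andb; congr (_ + _).
exact: IH.
Qed.
Lemma dot_tov a b : size a = n -> size b = n -> dot (tov n a) (tov n b) = (dotb a b)%:R.
Proof.
by move=> ha hb; rewrite -sum_dotb // /dot mxE; apply: eq_bigr => i _; rewrite !mxE.
Qed.
Lemma dot_bits x y : dot x y = (dotb (bitsv x) (bitsv y))%:R.
Proof. by rewrite -dot_tov ?size_bitsv // !bitsvK. Qed.
Lemma tov_blin k acc ms c : size ms = k -> size c = k -> size acc = n -> all (fun m => size m == n) ms ->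
  tov n (blin acc ms c) = tov n acc + tov k c *m \matrix_(i < k) tov n (nth [::] ms i).
Proof.
move=> hm hc ha hs; rewrite mulmx_sum_row.
under eq_bigr => i _ do rewrite mxE rowK.
elim: k ms c acc hm hc ha hs => [|k IH] [|m ms] [|d c] acc // hm hc ha hs; first by rewrite big_ord0 addr0.
case: hm => hm; case: hc => hc; case/andP: hs => /eqP hs1 hs; rewrite big_ord_recl /=.
rewrite (IH ms c) //; last by case: d; rewrite ?size_bxor ?hs1.
rewrite addrA; congr (_ + _); case: d; rewrite ?scale1r ?scale0r ?addr0 //.
by rewrite tovD // ha hs1.
Qed.
End Vectors.

Lemma ev_lin n t fs c x : treen n t -> all (treen n) fs -> size x = n ->
  ev (lin t fs c) x = ev t x (+) dotb c (map (ev^~ x) fs).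
Proof.
move=> ht hf hx; elim: fs c t hf ht => [|f fs IH] [|b c] t hf ht /=; rewrite ?addbF //.
case/andP: hf => hf hfs; rewrite IH //; last by case: b; rewrite ?treen_add.
by case: b; rewrite // (evD ht hf hx) addbA.
Qed.

Lemma span_lin n fs k : all (treen n) fs -> k \in span n fs ->
  exists2 c, size c = size fs & k = lin (tzero n) fs c.
Proof.
elim: fs k => [|f fs IH] k; first by move=> _; rewrite inE => /eqP ->; exists [::].
case/andP => hf hfs; rewrite [span _ _]/= mem_cat => /orP [h|/mapP [k' h ->]].
  have [c hc ->] := IH k hfs h; by exists (false :: c); rewrite /= ?hc.
have [c hc ->] := IH k' hfs h; exists (true :: c); rewrite /= ?hc //.
by rewrite (tadd0l hf) [RHS](linE (n := n)) //.
Qed.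

Lemma degle1_ev n t : treen n t -> degle 1 n t -> exists b, forall x, size x = n -> ev t x = b.
Proof.
elim: n t => [|n IH] [b|l r] //; first by exists b.
case/andP => hl hr; rewrite [degle _ _ _]/= => /andP [h1 h2].
have [b hb] := IH l hl h1; exists b => -[|c x] // [hx] /=.
have e : r = l.
  have h0 : tadd l r = tzero n by apply: deg0; rewrite /deg h2 treen_add.
  by rewrite -[r](taddKK (n := n) hr hl) [tadd r l]taddC h0 tadd0l.
by rewrite e if_same hb.
Qed.
Lemma degle2_ev n t : treen n t -> degle 2 n t ->
  exists p : bits * bool, size p.1 = n /\ forall x, size x = n -> ev t x = p.2 (+) dotb p.1 x.
Proof.
elim: n t => [|n IH] [b|l r] //.
  by exists ([::], b); split=> // x _; rewrite addbF.
case/andP => hl hr; rewrite [degle _ _ _]/= => /andP [h1 h2].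
have [[a k] /= [ha hk]] := IH l hl h1; have [b hb] := degle1_ev (treen_add hl hr) h2.
exists (b :: a, k); split; rewrite /= ?ha // => -[|c x] // [hx] /=.
have hrx : ev r x = ev l x (+) b by rewrite -(hb x hx) (evD hl hr hx) addKb.
by case: c; rewrite ?andbT ?andbF ?hrx hk //= addbC addbCA.
Qed.

Section Fof.
Variables (n m : nat).
Notation V := 'rV['F_2]_n.
Definition Fof (fs : seq tree) : {ffun V -> 'rV['F_2]_m} :=
  [ffun x => tov m [seq ev f (bitsv x) | f <- fs]].

Lemma walsh_Fof fs a b : all (treen n) fs -> size fs = m ->
  walsh (Fof fs) a b = wht (lin (tzero n) fs (bitsv b)) (bitsv a).
Proof.
move=> hf hs; rewrite (whtE (n := n)) ?size_bitsv ?treen_lin ?treen_const //.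
rewrite -sum_bits; apply: eq_bigr => x _.
rewrite ffunE !dot_bits tovK ?size_map //.
by rewrite -F2_addb sgnF2_nat (ev_lin _ (treen_const n false)) ?size_bitsv // ev_const ?size_bitsv // addFb.
Qed.

End Fof.

Lemma bent_Fof m fs : all (treen 6) fs -> size fs = m ->
  bent (Fof 6 m fs) <-> (forall c, size c = m -> has id c -> bentT (lin (tzero 6) fs c)).
Proof.
move=> hf hs; split.
  move/bentP => h c hc hn a ha; have := h (tov 6 a) (tov m c).
  by rewrite walsh_Fof // !tovK // -has_bitsv tovK // => /(_ hn).
move=> h; apply/bentP => a b hb; rewrite walsh_Fof //.
by apply: h; rewrite ?size_bitsv ?has_bitsv.
Qed.

Fixpoint cnt t (a : bits) (s : bool) : nat := match t, a with
  | Leaf b, _ => s (+) b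
  | Node l r, c :: a' => (cnt l a' s + cnt r a' (s (+) c))%N
  | _, _ => 0%N end.
Lemma wht_cnt n t a s : treen n t -> size a = n -> sg s * wht t a = (2 ^ n)%N%:Z - 2 * (cnt t a s)%:Z.
Proof.
elim: n t a s => [|n IH] [b|l r] [|c a] s // ht ha; first by case: s; case: (b).
have [hl hr] : treen n l /\ treen n r by apply/andP.
case: ha => ha; rewrite [wht _ _]/= mulrDr mulrA -sgD (IH l a s hl ha) (IH r a _ hr ha).
by rewrite [cnt _ _ _]/= expnS mul2n -addnn !PoszD; ring.
Qed.
(** A Walsh value is 64 minus twice the number of ones of t plus a linear function, and 64 - 56 = 8,
    64 - 72 = -8. *)
Definition bentc t := all (fun a => let k := cnt t a false in (k == 28)%N || (k == 36)%N) (allbits 6).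
Lemma bentcP t : treen 6 t -> bentc t -> bentT t.
Proof.
move=> ht /allP h a ha; have := h a; rewrite mem_allbits ha eqxx => /(_ isT).
have := wht_cnt false ht ha; rewrite mul1r => ->.
by case/orP => /eqP ->; [left | right].
Qed.
Definition bent_check fs := all (treen 6) fs && all (fun c => ~~ has id c || bentc (lin (tzero 6) fs c)) (allbits (size fs)).
Lemma bent_checkP fs : bent_check fs -> bent (Fof 6 (size fs) fs).
Proof.
case/andP => hf /allP h; apply/bent_Fof => // c hc hn; apply: bentcP.
  exact: treen_lin (treen_const 6 false) hf.
by have := h c; rewrite mem_allbits hc eqxx hn /= => /(_ isT).
Qed.

Lemma rowf_Fof n m t fs : rowf (Fof n 1 [:: t]) (Fof n m fs) = Fof n (1 + m) (t :: fs).
Proof.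
apply/ffunP => x; rewrite !ffunE; apply/rowP => i; rewrite !mxE.
by case: splitP => j hj; rewrite mxE hj //= ord1.
Qed.

Fixpoint tof n (f : bits -> bool) :=
  if n is k.+1 then Node (tof k (fun x => f (false :: x))) (tof k (fun x => f (true :: x))) else Leaf (f [::]).
Lemma treen_tof n f : treen n (tof n f).
Proof. by elim: n f => //= n IH f; rewrite !IH. Qed.
Lemma ev_tof n f x : size x = n -> ev (tof n f) x = f x.
Proof. by elim: n f x => [|n IH] f [|c x] //= [hx]; case: c; rewrite IH. Qed.

Lemma sum_tables (f : {ffun 'rV['F_2]_6 -> 'rV['F_2]_1} -> nat) :
  (\sum_g f g = \sum_(t <- tables) f (Fof 6 1 [:: t]))%N.
Proof.
rewrite -(big_map (fun t => Fof 6 1 [:: t]) xpredT f); apply/esym/perm_big; apply: uniq_perm.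
- rewrite map_inj_in_uniq ?uniq_tables // => s t; rewrite !mem_tables => hs ht h.
  apply: (ev_ext hs ht) => x hx.
  have := congr1 (fun F : {ffun _ -> 'rV__} => F (tov 6 x) 0 0) h.
  rewrite /= !ffunE !mxE /= tovK // => /(congr1 (fun z : 'F_2 => z != 0)).
  by rewrite !F2_neq0.
- exact: index_enum_uniq.
move=> g; rewrite mem_index_enum; apply/mapP.
exists (tof 6 (fun b => g (tov 6 b) 0 0 != 0)); first by rewrite mem_tables treen_tof.
set T := tof 6 _; have hT : forall x, size x = 6%N -> ev T x = (g (tov 6 x) 0 0 != 0) by move=> x; apply: ev_tof.
move: T hT => T hT; apply/ffunP => x; rewrite ffunE; apply/rowP => i; rewrite ord1 mxE [map _ _]/= [nth _ _ _]/=.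
by rewrite hT ?size_bitsv // bitsvK -F2E.
Qed.

Lemma unit_rows k (ms : seq bits) : size ms = k -> all (fun m => size m == k) ms -> inj_rows k k ms ->
  \matrix_(i < k) tov k (nth [::] ms i) \in unitmx.
Proof.
move=> hm hs hi; rewrite -row_free_unit; apply: inj_row_free => v hv.
have := allP hi (bitsv v); rewrite mem_allbits size_bitsv eqxx => /(_ isT).
have hb : size (blin (zeros k) ms (bitsv v)) = k by apply: size_blin; rewrite ?size_zeros.
have := tov_blin hm (size_bitsv v) (size_zeros k) hs.
rewrite tov_zeros add0r bitsvK hv => e.
have -> : blin (zeros k) ms (bitsv v) = zeros k by rewrite -[LHS](tovK hb) e -(tov_zeros k k) tovK ?size_zeros.
rewrite has_zeros has_bitsv /= negbK => /eqP //.
Qed.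

(** Row i of M says that the i-th member of [f1], composed with A, plus a combination of [f2] is
    affine. Over F_2 the combination moves to the other side, which is [key]; the transpose appears
    because values are row vectors. Solving for [f2] gives the equivalence in the reverse direction,
    hence the symmetry at the start. *)
Lemma EAt_EAeq m f1 f2 : size f1 = m -> all (treen 6) f1 -> all (treen 6) f2 -> EAt f1 f2 ->
  EAeq (Fof 6 m f1) (Fof 6 m f2).
Proof.
move=> s1 t1 t2 [A [M [hA s12 sM hM iM]]]; apply: EA_sym.
have s2 : size f2 = m by rewrite -s12.
case/and4P: (hA) => /eqP sA aA /eqP sv iA.
pose M2 := \matrix_(i < 6) tov 6 (nth [::] A.1 i).
have uM2 : M2 \in unitmx by apply: unit_rows.
have aM : all (fun c => size c == m) M.
  move: hM; rewrite /rows_ok all2E => /andP [_ /allP h]; apply/allP => c hc.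
  have hi : (index c M < m)%N by rewrite -s2 -sM index_mem.
  have := h (nth (Leaf false, [::]) (zip (map (fun f => precomp f A.1 A.2) f1) M) (index c M)).
  rewrite mem_nth ?size_zip ?size_map ?sM ?s12 ?minnn ?s2 // => /(_ isT) /andP [_].
  by rewrite nth_zip ?size_map ?sM ?s12 //= nth_index // s2.
have iM' : inj_rows m m M by rewrite -s2.
have sM' : size M = m by rewrite sM.
pose N := \matrix_(i < m) tov m (nth [::] M i).
have uN : N \in unitmx by apply: unit_rows.
have hp (i : 'I_m) : exists p : bits * bool, size p.1 = 6%N /\ forall x, size x = 6%N ->
    ev (nth (Leaf false) f1 i) (blin A.2 A.1 x) (+) dotb (nth [::] M i) (map (ev^~ x) f2) = p.2 (+) dotb p.1 x.
  have hi : (i < size f1)%N by rewrite s1.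
  set g := precomp (nth (Leaf false) f1 i) A.1 A.2.
  have tg : treen 6 g by rewrite -sA treen_comp.
  have hd : degle 2 6 (lin g f2 (nth [::] M i)).
    move: hM; rewrite /rows_ok all2E => /andP [_ /allP h].
    have := h (nth (Leaf false, [::]) (zip (map (fun f => precomp f A.1 A.2) f1) M) i).
    rewrite mem_nth ?size_zip ?size_map ?sM ?s12 ?minnn ?s2 // => /(_ isT) /andP [+ _].
    by rewrite nth_zip ?size_map ?sM ?s12 //= (nth_map (Leaf false)).
  have [p [p1 p2]] := degle2_ev (treen_lin _ tg t2) hd.
  exists p; split=> // x hx; rewrite -p2 // (ev_lin _ tg t2 hx) ev_comp ?sA //.
have [p hpp] := fin_all_exists hp.
pose M3 := \matrix_(j < 6, i < m) ((nth false (p i).1 j)%:R : 'F_2).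
pose c := \row_(i < m) ((p i).2%:R : 'F_2).
have key x : Fof 6 m f1 (x *m M2 + tov 6 A.2) = Fof 6 m f2 x *m N^T + (x *m M3 + c).
  rewrite !ffunE; apply/rowP => i; rewrite 4!mxE.
  have [p1 p2] := hpp i.
  have hi : (i < size f1)%N by rewrite s1.
  have -> : bitsv (x *m M2 + tov 6 A.2) = blin A.2 A.1 (bitsv x).
    rewrite -[RHS](@tovK 6) ?(size_blin _ sv aA) //.
    by rewrite (tov_blin sA (size_bitsv x) sv aA) bitsvK addrC.
  rewrite (nth_map (Leaf false)) //.
  have := p2 (bitsv x) (size_bitsv x).
  set e := ev _ _; set d := dotb (nth _ _ _) _ => h.
  have -> : e = d (+) ((p i).2 (+) dotb (p i).1 (bitsv x)) by rewrite -h addbC addbK.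
  have sMi : size (nth [::] M i) = m by apply/eqP/(allP aM)/mem_nth; rewrite sM'.
  rewrite !F2_addb; congr (_ + _).
    rewrite /d -(sum_dotb sMi) ?size_map //; apply: eq_bigr => j _; rewrite !mxE mulrC //.
  rewrite [c _ _]mxE addrC; congr (_ + _).
  rewrite mxE -(sum_dotb p1 (size_bitsv x)); apply: eq_bigr => j _; by rewrite !mxE nth_bitsv -F2E mulrC.
apply/EAP; exists (invmx N^T), M2, (tov 6 A.2), (- (M3 *m invmx N^T)), (- (c *m invmx N^T)).
have uNt : N^T \in unitmx by rewrite unitmx_tr.
split=> // [|x]; first by rewrite unitmx_inv.
rewrite key mulmxDl mulmxK // mulmxDl mulmxN mulmxA; set y := _ *m invmx _; set z := _ *m invmx _.
by rewrite -addrA [_ + (- y - z)](_ : _ = 0) ?addr0 // addrACA !subrr addr0.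
Qed.

Section Step.
Variables (m : nat) (fs : seq tree).
Hypotheses (sfs : size fs = m) (fs6 : all (deg 4 6) fs).
Variable Psi : {ffun 'rV['F_2]_6 -> 'rV['F_2]_(1 + m)} -> nat.
Hypothesis Psi_EA : forall K1 K2, EAeq K1 K2 -> Psi K1 = Psi K2.
Hypothesis Psi_bent : forall K, Psi K != 0%N -> bent K.

Lemma run_extsum fuel reps c res :
  equivk 6 (idA 6) fs fs -> all (all (treen 6)) reps ->
  run fuel fs reps (mktabs (balt (nc 3 5) (tzero 5)) dtabs fs) 6 0 (tzero 6) [::] c = Some res ->
  (extsum Psi (Fof 6 m fs) = 128 * \sum_(p <- res) N.to_nat p.1 * Psi (Fof 6 (1 + m) (nth [::] reps p.2)))%N.
Proof.
move=> hid hreps hrun; rewrite /extsum sum_tables.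
under eq_bigr => t _ do rewrite rowf_Fof.
have tfs : all (treen 6) fs by exact: sub_deg fs6.
(* For k in the span of [fs], g + k is the component of (g, fs) with coefficient vector (1, c'),
   which is nonzero, so it is bent. Taking k = 0 gives the degree bound, and general k the balanced
   derivatives. *)
have hsupp g : treen 6 g && (Psi (Fof 6 (1 + m) (g :: fs)) != 0%N) ->
    forall k, k \in span 6 fs -> treen 6 (tadd g k) /\ bentT (tadd g k).
  case/andP => tg /Psi_bent hb k /(span_lin tfs) [c' sc ->].
  have tk : treen 6 (lin (tzero 6) fs c') by apply: treen_lin; rewrite ?treen_const.
  split; first exact: treen_add.
  have -> : tadd g (lin (tzero 6) fs c') = lin (tzero 6) (g :: fs) (true :: c').
    by rewrite -[RHS]/(lin (tadd (tzero 6) g) fs c') (tadd0l tg) [RHS](linE (n := 6)).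
  have ts : all (treen 6) (g :: fs) by apply/andP.
  have hs : size (g :: fs) = (1 + m)%N by rewrite /= sfs.
  by have /bent_Fof := hb; move/(_ ts hs); apply; rewrite //= sc sfs.
apply: (@search_sound fs (fun gs => Psi (Fof 6 (1 + m) gs)) fs6 _ _ _ fuel reps c res hid hreps hrun).
- move=> f1 f2 s1 t1 t2 h; apply/Psi_EA/EAt_EAeq => //; by rewrite s1 sfs.
- move=> g hg; have h0 : tzero 6 \in span 6 fs.
    by clear; elim: fs => [|f l IH]; rewrite /= ?mem_seq1 // mem_cat IH.
  have [tg bg] := hsupp g hg _ h0; move: tg bg; rewrite tadd0; first exact: bentT_deg.
  by case/andP: hg.
move=> g k u hg hk hu hn; have [tg bg] := hsupp g hg _ hk.
exact: bentT_balanced.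
Qed.
End Step.

Local Open Scope nat_scope.

(** * Computing the invariants *)

Fixpoint tor s t := match s, t with
  | Leaf a, Leaf b => Leaf (a || b)
  | Node a b, Node c d => Node (tor a c) (tor b d)
  | _, _ => Leaf false end.
Fixpoint leaves t := match t with Leaf b => [:: b] | Node l r => leaves l ++ leaves r end.
Fixpoint rdot (a b : bits) : nat := match a, b with
  | x :: a', y :: b' => if x && y then (rdot a' b').+1 else rdot a' b' | _, _ => 0 end.
(** Triangles from an adjacency matrix: each edge contributes the inner product of the rows of its
    two ends. *)
Definition tric (rows : seq bits) : N :=
  foldr (fun r a => N.add (foldr (fun p a => N.add (if p.1 then N.of_nat (rdot r p.2) else 0%num) a) 0%num (zip r rows)) a)
    0%num rows.
Definition anyt n (ts : seq tree) := foldr tor (tzero n) ts.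
Definition tauc n fs :=
  let cs := allbits n in
  tric (map (fun u => let ds := map (deriv u) fs in map (fun v => isc true (anyt n (map (deriv v) ds))) cs) cs).
(** For a fixed base point x, shifting the table of D_u F by x and adding the constant D_u F (x)
    lists D_v D_u F (x) for all v at once, so one row of the adjacency matrix costs one pass over a
    truth table per component. *)
Definition T3c n fs :=
  let cs := allbits n in
  let dss := map (fun u => map (deriv u) fs) cs in
  foldr (fun x a => N.add (tric (map (fun ds =>
    map negb (leaves (anyt n (map (fun d => tadd (tconst n (ev d x)) (tshift x d)) ds)))) dss)) a) 0%num cs.

Lemma to_nat_foldr (T : Type) (f : T -> N) s :
  N.to_nat (foldr (fun x a => N.add (f x) a) 0%num s) = \sum_(x <- s) N.to_nat (f x).
Proof. by elim: s => [|x s IH] /=; rewrite ?big_nil // big_cons N2Nat.inj_add IH. Qed.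
Lemma rdot_map (T : Type) (f g : T -> bool) s :
  rdot (map f s) (map g s) = \sum_(x <- s) (g x && f x).
Proof. by elim: s => [|x s IH] /=; rewrite ?big_nil // big_cons -IH; case: (f x); case: (g x). Qed.
Lemma tricE (T : Type) (f : T -> T -> bool) s :
  N.to_nat (tric (map (fun u => map (f u) s) s)) =
  \sum_(u <- s) \sum_(v <- s) \sum_(w <- s) (f u v && (f v w && f u w)).
Proof.
rewrite to_nat_foldr big_map; apply: eq_bigr => u _.
rewrite to_nat_foldr zip_map big_map; apply: eq_bigr => v _ /=.
case: (f u v) => /=; last by rewrite big1.
by rewrite Nat2N.id rdot_map.
Qed.
Lemma leavesE n t : treen n t -> leaves t = map (ev t) (allbits n).
Proof.
elim: n t => [|n IH] [b|l r] // /andP [hl hr].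
by rewrite /= (IH l hl) (IH r hr) map_cat -!map_comp.
Qed.
Lemma treen_tor n s t : treen n s -> treen n t -> treen n (tor s t).
Proof. by elim: n s t => [|n IH] [a|l r] [b|l' r'] //= /andP [? ?] /andP [? ?]; rewrite !IH. Qed.
Lemma ev_tor n s t x : treen n s -> treen n t -> size x = n -> ev (tor s t) x = ev s x || ev t x.
Proof.
elim: n s t x => [|n IH] [a|l r] [b|l' r'] [|y x] //= /andP [? ?] /andP [? ?] [hx].
by case: y; rewrite IH.
Qed.
Lemma treen_anyt n ts : all (treen n) ts -> treen n (anyt n ts).
Proof. by elim: ts => [_|t ts IH /andP [h1 h2]]; [apply: treen_const | apply: treen_tor; auto]. Qed.
Lemma ev_anyt n ts x : all (treen n) ts -> size x = n -> ev (anyt n ts) x = has (ev^~ x) ts.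
Proof.
move=> ht hx; elim: ts ht => [|t ts IH /andP [h1 h2]]; first by rewrite /= ev_const.
by rewrite [anyt _ _]/= (ev_tor h1 (treen_anyt h2) hx) IH.
Qed.
Lemma isc_ev n t : treen n t -> isc true t = all (ev t) (allbits n).
Proof.
elim: n t => [|n IH] [b|l r] //; first by rewrite /= andbT eqb_id.
by case/andP => hl hr; rewrite /= all_cat !all_map (IH l hl) (IH r hr).
Qed.

Section Invariants.
Variables (n m : nat) (fs : seq tree).
Hypotheses (tfs : all (treen n) fs) (sfs : size fs = m).
Local Open Scope ring_scope.
Notation V := 'rV['F_2]_n.

Lemma bxor_map (T : Type) (f g : T -> bool) s : bxor (map f s) (map g s) = [seq f x (+) g x | x <- s].
Proof. by elim: s => //= x s ->; case: (f x); case: (g x). Qed.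

Let ds u := map (deriv u) fs.
Lemma treen_ds u : all (treen n) (ds u).
Proof. by rewrite all_map; apply: sub_all tfs => t ht; apply: treen_deriv. Qed.

Lemma DD_Fof (u v x : V) : (DD (Fof n m fs) u v x != 0) =
  has (fun d => ev d (bitsv x) (+) ev d (bxor (bitsv x) (bitsv v))) (ds (bitsv u)).
Proof.
rewrite -bitsvD -has_bitsv /DD !(bitsvD (_ + _)) bitsvD; rewrite !ffunE !tovK ?size_map // !bxor_map.
rewrite /ds !has_map; apply: eq_in_has => f hf /=.
have tf := allP tfs f hf.
by rewrite !(ev_deriv tf) ?size_bitsv // -!bitsvD [x + v + u]addrAC !addbA.
Qed.

Lemma sum3_bits (f : bits -> bits -> bits -> nat) :
  (\sum_(u : V) \sum_(v : V) \sum_(w : V) f (bitsv u) (bitsv v) (bitsv w) =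
   \sum_(u <- allbits n) \sum_(v <- allbits n) \sum_(w <- allbits n) f u v w)%N.
Proof.
rewrite -(sum_bits n (fun u => \sum_(v <- allbits n) \sum_(w <- allbits n) f u v w)%N).
apply: eq_bigr => u _; rewrite -(sum_bits n (fun v => \sum_(w <- allbits n) f _ v w)%N).
by apply: eq_bigr => v _; rewrite -(sum_bits n (fun w => f _ _ w)%N).
Qed.

Lemma tri_tric (adj : V -> V -> bool) (f : bits -> bits -> bool) :
  (forall u v, adj u v = f (bitsv u) (bitsv v)) ->
  tri adj = N.to_nat (tric (map (fun u => map (f u) (allbits n)) (allbits n))).
Proof.
move=> h; rewrite tricE -(sum3_bits (fun u v w => nat_of_bool (f u v && (f v w && f u w)))).
by apply: eq_bigr => u _; apply: eq_bigr => v _; apply: eq_bigr => w _; rewrite !h.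
Qed.

Lemma tau_Fof : tau (Fof n m fs) = N.to_nat (tauc n fs).
Proof.
apply: (tri_tric (f := fun u v => isc true (anyt n (map (deriv v) (ds u))))) => u v.
have ht : all (treen n) (map (deriv (bitsv v)) (ds (bitsv u))).
  by rewrite all_map; apply: sub_all (treen_ds (bitsv u)) => t ht; apply: treen_deriv.
have hE (x : V) : (DD (Fof n m fs) u v x != 0) = ev (anyt n (map (deriv (bitsv v)) (ds (bitsv u)))) (bitsv x).
  rewrite DD_Fof ev_anyt ?size_bitsv // has_map; apply: eq_in_has => d hd /=.
  by rewrite (ev_deriv (allP (treen_ds _) d hd)) ?size_bitsv.
rewrite (isc_ev (treen_anyt ht)); apply/forallP/allP => [h x|h x]; last by rewrite hE h // mem_allbits size_bitsv.
by rewrite mem_allbits => /eqP hx; rewrite -(tovK hx) -hE.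
Qed.

Lemma T3_Fof : T3 (Fof n m fs) = N.to_nat (T3c n fs).
Proof.
rewrite to_nat_foldr -sum_bits; apply: eq_bigr => x _; rewrite -map_comp.
pose e u := anyt n (map (fun d => tadd (tconst n (ev d (bitsv x))) (tshift (bitsv x) d)) (ds u)).
rewrite (tri_tric (f := fun u v => ~~ ev (e u) v)).
  congr (N.to_nat (tric _)); apply: eq_map => u /=; have te : treen n (e u); last by rewrite -/(ds u) -/(e u) (leavesE te) -map_comp.
  apply: treen_anyt; rewrite all_map; apply: sub_all (treen_ds u) => t ht.
  by apply: treen_add; [apply: treen_const | apply: treen_shift].
move=> u v; rewrite -[LHS]negbK DD_Fof ev_anyt ?size_bitsv //; last first.
  rewrite all_map; apply: sub_all (treen_ds (bitsv u)) => t ht.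
  by apply: treen_add; [apply: treen_const | apply: treen_shift].
rewrite has_map; congr (~~ _); apply: eq_in_has => d hd /=.
have td := allP (treen_ds (bitsv u)) d hd.
by rewrite (evD (n := n)) ?treen_const ?treen_shift ?size_bitsv // ev_const ?size_bitsv // (ev_shift td) ?size_bitsv // bxorC.
Qed.
End Invariants.

(** * From (6,m)-functions to (6,m+1)-functions *)

Definition tally_weights k (res : seq (N * nat)) : seq N :=
  mkseq (fun i => foldr (fun p a => if p.2 == i then N.add p.1 a else a) 0%num res) k.
(** Two tests are added to [run]: indices in range, so that multiplicities can be collected for each
    representative, and some positive multiplicity, from which extendability of [fs] follows. *)
Definition run_checked fuel bal dt (reps' : seq (seq tree)) fs c :=
  if run fuel fs reps' (mktabs bal dt fs) 6 0 (tzero 6) [::] c is Some res then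
    if all (fun p => p.2 < size reps') res && has (fun p => N.ltb 0 p.1) res then Some res else None
  else None.
Definition search_level fuel bal dt reps' (ws : seq N) (reps : seq (seq tree)) (cs : seq cert) :=
  collect (map (fun x => (x.1.1, run_checked fuel bal dt reps' x.1.2 x.2)) (zip (zip ws reps) cs)).
Definition tally_is (w : seq N) (r : option (seq (N * nat))) :=
  if r is Some res then tally_weights (size w) res == w else false.
Definition reps_ok m (reps : seq (seq tree)) :=
  all (fun fs => [&& size fs == m, all (deg 4 6) fs & equivk 6 (idA 6) fs fs]) reps.

Lemma run_checkedP fuel bal dt reps' fs c r : run_checked fuel bal dt reps' fs c = Some r ->
  [/\ run fuel fs reps' (mktabs bal dt fs) 6 0 (tzero 6) [::] c = Some r,
      all (fun p => p.2 < size reps') r & has (fun p => N.ltb 0 p.1) r].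
Proof. by rewrite /run_checked; case: (run _ _ _ _ _ _ _ _ _) => // r'; case: ifP => // /andP [h1 h2] [<-]. Qed.

Lemma tally_weightsP k res (u : nat -> nat) : all (fun p => p.2 < k) res ->
  \sum_(p <- res) N.to_nat p.1 * u p.2 = \sum_(i < k) N.to_nat (nth 0%num (tally_weights k res) i) * u i.
Proof.
move=> h; transitivity (\sum_(i < k) (\sum_(p <- res | p.2 == i) N.to_nat p.1) * u i).
  under [RHS]eq_bigr => i _ do rewrite big_distrl /= big_mkcond.
  rewrite exchange_big /= !big_seq; apply: eq_bigr => p hp.
  have hk := allP h p hp; rewrite (bigD1 (Ordinal hk)) //= eqxx big1 ?addn0 // => i hi.
  suff -> : (p.2 == i) = false by [].
  by apply: contraNF hi => /eqP e; apply/eqP/val_inj.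
apply: eq_bigr => i _; congr (_ * _); rewrite nth_mkseq //.
elim: res {h} => [|p res IH] /=; first by rewrite big_nil.
by rewrite big_cons; case: eqP => _; rewrite ?N2Nat.inj_add IH.
Qed.

Lemma collect_all (T : Type) (P : nat -> bool) (w : T -> N) (f : T -> option (seq (N * nat))) l res :
  (forall x r, f x = Some r -> all (fun p => P p.2) r) ->
  collect (map (fun x => (w x, f x)) l) = Some res -> all (fun p => P p.2) res.
Proof.
move=> h; elim: l res => [|x l IH] res /=; first by move=> [<-].
case E: (f x) => [y|] //; case E2: (collect _) => [z|] // [<-].
rewrite all_cat all_map (IH z E2) andbT; exact: h E.
Qed.

Lemma all_zip1 (T S : Type) (P : T -> bool) (s : seq T) (t : seq S) : all P s -> all (fun x => P x.1) (zip s t).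
Proof. by elim: s t => [|x s IH] [|y t] //= /andP [-> h]; rewrite IH. Qed.
Lemma all_zip2 (T S : Type) (P : S -> bool) (s : seq T) (t : seq S) : all P t -> all (fun x => P x.2) (zip s t).
Proof. by elim: s t => [|x s IH] [|y t] //= /andP [-> h]; rewrite IH. Qed.

Section Levels.
Variable m : nat.
Notation fn k := {ffun 'rV['F_2]_6 -> 'rV['F_2]_k}.
Definition admissible k (Psi : fn k -> nat) :=
  (forall K1 K2, EAeq K1 K2 -> Psi K1 = Psi K2) /\ (forall K, Psi K != 0 -> bent K).
(** The quantification over all admissible [Psi] is what makes the iteration possible: the step from
    m to m + 1 instantiates it with [extsum Psi], again EA-invariant and supported on bent functions
    because a truncation of a bent function is bent. *)
Definition weights k K (ws : seq N) (reps : seq (seq tree)) :=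
  forall Psi : fn k -> nat, admissible Psi ->
  \sum_F Psi F = K * \sum_(x <- zip ws reps) N.to_nat x.1 * Psi (Fof 6 k x.2).

Lemma extsum_admissible (Psi : fn (1 + m) -> nat) : admissible Psi -> admissible (@extsum 6 m Psi).
Proof.
case=> h1 h2; split=> [K1 K2|K]; first exact: extsum_EA.
rewrite /extsum sum_nat_eq0 negb_forall => /existsP [g]; rewrite /= => h.
exact: (bent_rowfr (h2 _ h)).
Qed.

Variables (K : nat) (fuel : nat) (ws ws' : seq N) (reps reps' : seq (seq tree)) (cs : seq cert).
Hypothesis hws : weights m K ws reps.
Hypothesis hreps : reps_ok m reps.
Hypothesis hreps' : all (all (treen 6)) reps'.
Hypothesis hagg : tally_is ws' (search_level fuel (balt (nc 3 5) (tzero 5)) dtabs reps' ws reps cs).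
Hypothesis hsize : size ws' = size reps'.

Lemma weights_step : size cs = size reps -> size ws = size reps -> weights (1 + m) (K * 128) ws' reps'.
Proof.
move=> scs sws Psi hPsi; rewrite sum_rowf (hws (extsum_admissible hPsi)) -mulnA; congr (_ * _).
have -> : zip ws reps = map fst (zip (zip ws reps) cs).
  by rewrite -/(unzip1 _) unzip1_zip // size_zip sws minnn scs.
rewrite big_map; move: hagg; rewrite /tally_is; case E: (search_level _ _ _ _ _ _ _) => [res|] // /eqP ha.
rewrite /search_level in E.
pose f2 (x : N * seq tree * cert) := run_checked fuel (balt (nc 3 5) (tzero 5)) dtabs reps' x.1.2 x.2.
have hf x r : f2 x = Some r -> all (fun p => p.2 < size reps') r by case/run_checkedP.
have hall : all (fun p => p.2 < size reps') res.
  exact: (@collect_all _ (fun i => i < size reps') (fun x => x.1.1) f2 _ _ hf E).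
transitivity (128 * \sum_(p <- res) N.to_nat p.1 * Psi (Fof 6 (1 + m) (nth [::] reps' p.2))).
  apply: (@collectP _ _ (fun x => x.1.1) f2 (fun x => extsum Psi (Fof 6 m x.1.2))
    (fun i => Psi (Fof 6 (1 + m) (nth [::] reps' i))) _ _ E).
  have : all (fun x => x.1.2 \in reps) (zip (zip ws reps) cs).
    apply: (@all_zip1 _ _ (fun y => y.2 \in reps)); apply: (@all_zip2 _ _ (fun y => y \in reps)); exact/allP.
  elim: (zip _ _) => //= x l IH /andP [hx hl]; split; last exact: IH.
  have /and3P [/eqP s6 d6 e6] := allP hreps _ hx.
  move=> r /run_checkedP [E2 _ _]; case: hPsi => h1 h2.
  exact: (run_extsum s6 d6 h1 h2 e6 hreps' E2).
congr (_ * _); rewrite (tally_weightsP (fun i => Psi (Fof 6 (1 + m) (nth [::] reps' i))) hall) -hsize ha.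
rewrite (big_nth (0%num, [::])) size_zip hsize minnn big_mkord.
by apply: eq_bigr => i _; rewrite nth_zip.
Qed.
End Levels.

Lemma collect_some (T : Type) (w : T -> N) (f : T -> option (seq (N * nat))) l res :
  collect (map (fun x => (w x, f x)) l) = Some res -> all (fun x => isSome (f x)) l.
Proof.
elim: l res => //= x l IH res; case: (f x) => // y.
by case E: (collect _) => [z|] // _; rewrite (IH z E).
Qed.

Lemma mem_zip2 (S T : eqType) (s : seq S) (t : seq T) x : x \in zip s t -> x.2 \in t.
Proof.
elim: s t => [|y s IH] [|z t] //=; rewrite !inE => /orP [/eqP -> | /IH ->]; first by rewrite eqxx.
by rewrite orbT.
Qed.

Definition bents_ok m (reps : seq (seq tree)) := all (fun fs => (size fs == m) && bent_check fs) reps.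
(** The [if] keeps call-by-value evaluation from computing the more expensive [T3c], except for
    pairs that [tauc] fails to separate. *)
Definition invs_ok (reps : seq (seq tree)) :=
  pairwise (fun p q => if N.eqb p.1 q.1 then ~~ N.eqb (T3c 6 p.2) (T3c 6 q.2) else true)
    (map (fun fs => (tauc 6 fs, fs)) reps).

Lemma eqb_to_nat (a b c d : N) : (if N.eqb a b then ~~ N.eqb c d else true) ->
  (N.to_nat a != N.to_nat b) || (N.to_nat c != N.to_nat d).
Proof.
case: N.eqb_spec => [_ |h _]; last by apply/orP; left; apply/eqP => /N2Nat.inj.
by case: N.eqb_spec => // h _; apply/orP; right; apply/eqP => /N2Nat.inj.
Qed.

Section Bent.
Variables (m : nat) (reps : seq (seq tree)).
Notation fn k := {ffun 'rV['F_2]_6 -> 'rV['F_2]_k}.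
Hypothesis hb : bents_ok m reps.

Lemma bents_size fs : fs \in reps -> size fs = m.
Proof. by move=> /(allP hb) /andP [/eqP]. Qed.
Lemma bents_treen fs : fs \in reps -> all (treen 6) fs.
Proof. by move=> /(allP hb) /andP [_ /andP []]. Qed.
Lemma bents_bent fs : fs \in reps -> bent (Fof 6 m fs).
Proof. by move=> h; have /andP [/eqP <- /bent_checkP] := allP hb fs h. Qed.

Lemma admissible_bent k : @admissible k (fun F => bent F).
Proof. by split=> [K1 K2 /bent_EAE ->|F] //; case: (bent F). Qed.

Section Weights.
Variables (K : nat) (ws : seq N).
Hypothesis hws : weights m K ws reps.

Lemma card_bents : size ws = size reps -> #|bent_set 6 m| = K * \sum_(w <- ws) N.to_nat w.
Proof.
move=> hs; rewrite -sum1dep_card big_mkcond.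
transitivity (\sum_(F : fn m) bent F); first by apply: eq_bigr => F _; case: (bent F).
rewrite (hws (@admissible_bent m)); congr (_ * _).
have -> : ws = map fst (zip ws reps) by rewrite -/(unzip1 _) unzip1_zip ?hs.
rewrite big_map; have -> : zip [seq i.1 | i <- zip ws reps] reps = zip ws reps.
  by rewrite -/(unzip1 _) unzip1_zip ?hs.
rewrite !big_seq; apply: eq_bigr => x hx.
have /bents_bent -> : x.2 \in reps by exact: mem_zip2 hx.
by rewrite muln1.
Qed.

Lemma bents_complete F : bent F -> has (EAeq F) (map (Fof 6 m) reps).
Proof.
pose Psi (G : fn m) : nat := bent G && ~~ has (EAeq G) (map (Fof 6 m) reps).
have hPsi : admissible Psi.
  split=> [K1 K2 h|G]; rewrite /Psi; last by case: (bent G).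
  have e : has (EAeq K1) (map (Fof 6 m) reps) = has (EAeq K2) (map (Fof 6 m) reps).
    by apply: eq_has => G; apply/idP/idP => h'; [apply: (EA_trans (EA_sym h) h') | apply: (EA_trans h h')].
  exact: (congr2 (fun a b : bool => nat_of_bool (a && ~~ b)) (bent_EAE h) e).
have h0 : \sum_G Psi G = 0.
  rewrite (hws hPsi) big_seq big1 ?muln0 // => x hx; rewrite /Psi.
  have hx2 : x.2 \in reps by exact: mem_zip2 hx.
  suff -> : has (EAeq (Fof 6 m x.2)) (map (Fof 6 m) reps) by rewrite andbF muln0.
  by apply/hasP; exists (Fof 6 m x.2); [apply: map_f | apply: EA_refl].
move=> hF; apply: contraT => hn; move: h0; rewrite (bigD1 F) //= {1}/Psi hF hn.
by rewrite add1n.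
Qed.

Lemma card_EA_classes : invs_ok reps -> #|EA_classes 6 m| = size reps.
Proof.
move=> hi; rewrite -(size_map (Fof 6 m) reps); apply: EA_classes_count.
- by rewrite all_map; apply/allP => fs; apply: bents_bent.
- exact: bents_complete.
move: hi; rewrite /invs_ok !pairwise_map.
apply: (@sub_in_pairwise _ [in reps] _ _ _ _ _); last exact/allP.
move=> f g hf hg /=.
rewrite !tau_Fof ?T3_Fof ?bents_size ?bents_treen //.
exact: eqb_to_nat.
Qed.

Lemma bents_extend : (forall fs, fs \in reps -> extsum (fun H => bent H) (Fof 6 m fs) != 0) ->
  forall F : fn m, bent F -> exists g : fn 1, bent (rowf g F).
Proof.
move=> he F /bents_complete /hasP [G /mapP [fs /he h ->]] hE; move: h.
rewrite -(extsum_EA (fun K1 K2 h => congr1 nat_of_bool (bent_EAE h)) hE).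
rewrite /extsum sum_nat_eq0 negb_forall => /existsP [g]; rewrite /= => hg.
by exists g; case: (bent _) hg.
Qed.
End Weights.
End Bent.

Section Extend.
Variables (m fuel : nat) (ws ws' : seq N) (reps reps' : seq (seq tree)) (cs : seq cert).
Hypothesis hreps : reps_ok m reps.
Hypothesis hb' : bents_ok (1 + m) reps'.
Hypothesis hagg : tally_is ws' (search_level fuel (balt (nc 3 5) (tzero 5)) dtabs reps' ws reps cs).

Lemma reps_extend fs : size cs = size reps -> size ws = size reps -> fs \in reps ->
  extsum (fun H => bent H) (Fof 6 m fs) != 0.
Proof.
move=> scs sws; move: hagg; rewrite /tally_is; case E: (search_level _ _ _ _ _ _ _) => [res|] // _.
rewrite /search_level in E.
pose f2 (x : N * seq tree * cert) := run_checked fuel (balt (nc 3 5) (tzero 5)) dtabs reps' x.1.2 x.2.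
have hs := @collect_some _ (fun x => x.1.1) f2 _ _ E.
have -> : reps = map (fun x => x.1.2) (zip (zip ws reps) cs).
  rewrite (map_comp snd fst) -/(unzip1 _) unzip1_zip ?size_zip ?sws ?minnn ?scs //.
  by rewrite -/(unzip2 _) unzip2_zip // sws.
have hin : all (fun x => x.1.2 \in reps) (zip (zip ws reps) cs).
  apply: (@all_zip1 _ _ (fun y => y.2 \in reps)); apply: (@all_zip2 _ _ (fun y => y \in reps)); exact/allP.
suff : all (fun gs => extsum (fun H => bent H) (Fof 6 m gs) != 0) (map (fun x => x.1.2) (zip (zip ws reps) cs)).
  by move/allP; apply.
elim: (zip (zip ws reps) cs) hin hs => // x l IH /andP [hx hl] /andP [sx sl].
rewrite [all _ _]/= IH // andbT {IH}.
have /and3P [/eqP s6 d6 e6] := allP hreps _ hx.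
move: sx; case E2: (f2 x) => [r|] // _; case/run_checkedP: E2 => [E2 hr hp].
have ht : all (all (treen 6)) reps' by apply/allP => gs hgs; apply: (bents_treen hb' hgs).
have [h1 h2] := admissible_bent (1 + m).
rewrite (run_extsum s6 d6 h1 h2 e6 ht E2) muln_eq0 negb_or /=.
case/hasP: hp => p hpr; rewrite (big_rem p hpr) /= => /N.ltb_lt hlt.
rewrite (bents_bent hb' (mem_nth _ (allP hr p hpr))) muln1.
have : N.to_nat p.1 <> 0 by move=> e; move: hlt; rewrite -[p.1]N2Nat.id e.
by rewrite addn_eq0 negb_and => /eqP ->.
Qed.
End Extend.

(** The start of the iteration: there is a single function into the zero space, and it is
    represented by the empty tuple. *)
Lemma weights0 : @weights 0 1 [:: 1%num] [:: [::]].
Proof.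
move=> Psi _; rewrite big_seq1 mul1n mul1n (bigD1 (Fof 6 0 [::])) //= big1 ?addn0 // => F hF.
by case/eqP: hF; apply/ffunP => x; apply/rowP => -[].
Qed.

(** * Representatives and certificates *)

(* The bits of the number are the coefficients of the 35 monomials of degree 2 and 3, in the order of [premonos]. *)
Definition tcode x := lin (tzero 6) (premonos 6) (nbits 35 x).
Definition reps1 := map (map tcode) [:: [:: 142622720]; [:: 142622721]; [:: 142885377]; [:: 629672209]]%num.
Definition reps2 := map (map tcode) [:: [:: 1612718080; 142622720]; [:: 5905584144; 8598323456]; [:: 1075863809;
17314152464]; [:: 22012510530; 151003137]; [:: 17321033744; 151527681]; [:: 18193475606; 151529479]; [:: 17117615120;
606364177]; [:: 25707966096; 629689857]; [:: 9162063920; 629672209]]%num.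
Definition reps3 := map (map tcode) [:: [:: 696256512; 1612718080; 142622720]; [:: 17876125696; 1612718080;
142622720]; [:: 2843740160; 1612718080; 142622720]; [:: 18253875200; 1612718080; 142622720]; [:: 30081712384;
1075863809; 17314152464]; [:: 30106813184; 1075863809; 17314152464]; [:: 30748590272; 1075863809; 17314152464]; [::
33121363912; 17321033744; 151527681]; [:: 5392335108; 17321033744; 151527681]; [:: 11581406018; 17117615120;
606364177]; [:: 13904619534; 17117615120; 606364177]; [:: 14571208994; 9162063920; 629672209]; [:: 14705426722;
9162063920; 629672209]]%num.
(** Each of the three lists has one search tree for every tuple to be extended: the empty tuple
    here, the members of [reps1] for [certs1], and those of [reps2] for [certs2]. *)
Definition certs0 := [:: B [:: 3411478429760; 1222699581504] [:: B [:: 3177392382047; 2230500995181] [:: B [::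
4072905126008; 3878608187459] [:: B [::] [:: B [::] [:: B [::] [:: L 0 3639353861056]; B [::] [:: L 0 3957512051136]];
B [::] [:: B [::] [:: L 0 3658800975296]; B [::] [:: L 0 1190872457152]]; B [::] [:: B [::] [:: L 0 2112182516352]; B
[::] [:: L 0 2601168618240]]; B [::] [:: B [::] [:: L 0 3429942882048]; B [::] [:: L 0 1148508073600]]; B [::] [:: B
[::] [:: L 1 486466330206]; B [::] [:: L 1 351175179488]]; B [::] [:: B [::] [:: L 1 350072682087]; B [::] [:: L 1
72010521995]]; B [::] [:: B [::] [:: L 1 143941230443]; B [::] [:: L 1 211660778381]]; B [::] [:: B [::] [:: L 1
141759387082]; B [::] [:: L 1 485378927089]]]; B [::] [:: B [::] [:: B [::] [:: L 1 689402012548]; B [::] [:: L 1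
149428254471]]; B [::] [:: B [::] [:: L 1 620650902521]; B [::] [:: L 1 217095587734]]; B [::] [:: B [::] [:: L 1
79614271197]; B [::] [:: L 1 620649079785]]; B [::] [:: B [::] [:: L 1 550885851574]; B [::] [:: L 1 148372595967]]; B
[::] [:: B [::] [:: L 1 71070722079]; B [::] [:: L 1 82719299958]]; B [::] [:: B [::] [:: L 1 1034044400101]; B [::]
[:: L 1 908434999596]]; B [::] [:: B [::] [:: L 1 895528288770]; B [::] [:: L 1 222497856193]]; B [::] [:: B [::] [::
L 1 964482165736]; B [::] [:: L 1 964448975031]]]]; B [:: 3385677328454] [:: B [::] [:: B [::] [:: B [::] [:: L 1
82820288345]; B [::] [:: L 1 828954976390]]; B [::] [:: B [::] [:: L 1 356514035649]; B [::] [:: L 1 825847899414]]; B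
[::] [:: B [::] [:: L 1 838733307785]; B [::] [:: L 1 280383627258]]; B [::] [:: B [::] [:: L 1 283696303483]; B [::]
[:: L 1 623991422290]]; B [::] [:: B [::] [:: L 1 80787630296]; B [::] [:: L 1 354536093322]]; B [::] [:: B [::] [:: L
1 766910549618]; B [::] [:: L 1 291077672176]]; B [::] [:: B [::] [:: L 1 691518690069]; B [::] [:: L 1 79699229340]];
B [::] [:: B [::] [:: L 1 355591239077]; B [::] [:: L 1 1036411014574]]]; B [::] [:: B [::] [:: B [::] [:: L 2
87160123270]; B [::] [:: L 2 79901326664]]; B [::] [:: B [::] [:: L 2 94594424076]; B [::] [:: L 2 71354608877]]; B
[::] [:: B [::] [:: L 2 79748267197]; B [::] [:: L 2 98890702361]]; B [::] [:: B [::] [:: L 2 79883750603]; B [::] [::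
L 2 96977079503]]; B [::] [:: B [::] [:: L 2 84982714303]; B [::] [:: L 2 88507988411]]; B [::] [:: B [::] [:: L 2
94929463679]; B [::] [:: L 2 94646427024]]; B [::] [:: B [::] [:: L 2 72394799358]; B [::] [:: L 2 87115001852]]; B
[::] [:: B [::] [:: L 2 91322083842]; B [::] [:: L 2 102112188695]]]]; D]; B [:: 1618382434379; 4356323156090;
3802272641114] [:: B [:: 3809872191585; 2505275875437; 4355315998838] [:: B [::] [:: B [::] [:: B [::] [:: L 1
562819051353]; B [::] [:: L 1 416848800323]]; B [::] [:: B [::] [:: L 1 560564730014]; B [::] [:: L 1 966410744408]];
B [::] [:: B [::] [:: L 1 835417360089]; B [::] [:: L 1 427567310216]]; B [::] [:: B [::] [:: L 1 146137717935]; B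
[::] [:: L 1 693685817953]]; B [::] [:: B [::] [:: L 1 905431861808]; B [::] [:: L 1 149476470695]]; B [::] [:: B [::]
[:: L 1 762521398493]; B [::] [:: L 1 1044941000415]]; B [::] [:: B [::] [:: L 1 424395925613]; B [::] [:: L 1
630358698072]]; B [::] [:: B [::] [:: L 1 765684293468]; B [::] [:: L 1 144136314162]]]; B [::] [:: B [::] [:: B [::]
[:: L 2 151505606924]; B [::] [:: L 2 147563831180]]; B [::] [:: B [::] [:: L 2 162574961176]; B [::] [:: L 2
161080965854]]; B [::] [:: B [::] [:: L 2 161316208273]; B [::] [:: L 2 153667255264]]; B [::] [:: B [::] [:: L 2
155963161282]; B [::] [:: L 2 150498033224]]; B [::] [:: B [::] [:: L 2 161304099883]; B [::] [:: L 2 144083114974]];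
B [::] [:: B [::] [:: L 2 161449826647]; B [::] [:: L 2 147610709545]]; B [::] [:: B [::] [:: L 2 162461493993]; B
[::] [:: L 2 170008291982]]; B [::] [:: B [::] [:: L 2 146152365347]; B [::] [:: L 2 149726243661]]]]; B [::
2573962063974] [:: B [::] [:: B [::] [:: B [::] [:: L 2 295387281715]; B [::] [:: L 2 280549448644]]; B [::] [:: B
[::] [:: L 2 301975805792]; B [::] [:: L 2 280550497730]]; B [::] [:: B [::] [:: L 2 299945471232]; B [::] [:: L 2
282546502009]]; B [::] [:: B [::] [:: L 2 289029077123]; B [::] [:: L 2 289313222173]]; B [::] [:: B [::] [:: L 2
298977902252]; B [::] [:: L 2 297752448044]]; B [::] [:: B [::] [:: L 2 276289084252]; B [::] [:: L 2 301843098510]];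
B [::] [:: B [::] [:: L 2 299682789611]; B [::] [:: L 2 294677994770]]; B [::] [:: B [::] [:: L 2 287197145721]; B
[::] [:: L 2 291327225158]]]; B [::] [:: B [::] [:: B [::] [:: L 3 139322053018]; B [::] [:: L 3 208240976375]]; B
[::] [:: B [::] [:: L 3 276776272289]; B [::] [:: L 3 482633568421]]; B [::] [:: B [::] [:: L 3 346137170156]; B [::]
[:: L 3 485135479224]]; B [::] [:: B [::] [:: L 3 139237110032]; B [::] [:: L 3 345093316790]]; B [::] [:: B [::] [::
L 3 484815901015]; B [::] [:: L 3 348289900745]]; B [::] [:: B [::] [:: L 3 73428422833]; B [::] [:: L 3
210616787055]]; B [::] [:: B [::] [:: L 3 71478595938]; B [::] [:: L 3 208089989551]]; B [::] [:: B [::] [:: L 3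
488113414475]; B [::] [:: L 3 71864726002]]]]; D; D; D]; B [:: 439438291056; 4044303380596] [:: B [:: 3314038087761;
2637379936374] [:: B [::] [:: B [::] [:: B [::] [:: L 2 150997790675]; B [::] [:: L 2 174053166590]]]; D]; B [::
3731489300584; 3741152452690] [:: B [::] [:: B [::] [:: B [::] [:: L 3 415356011442]; B [::] [:: L 3 836437779347]]];
D; D; D]; D; D]]]%num.
Definition certs1 := [:: B [:: 4150115184704; 2436492513344] [:: B [:: 4358572093525; 2637212950644; 2837046108276]
[:: D; B [::] [:: B [::] [:: B [::] [:: B [::] [:: L 0 3971072631680]; B [::] [:: L 0 2814725399104]]; B [::] [:: B
[::] [:: L 0 2007713997056]; B [::] [:: L 0 4039704422784]]; B [::] [:: B [::] [:: L 0 820054593984]; B [::] [:: L 0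
417818856064]]; B [::] [:: B [::] [:: L 0 4299062522112]; B [::] [:: L 0 817860341632]]; B [::] [:: B [::] [:: L 1
3444598130943]; B [::] [:: L 1 1339073780628]]; B [::] [:: B [::] [:: L 1 592789902363]; B [::] [:: L 1
1334778813178]]; B [::] [:: B [::] [:: L 1 4162965749076]; B [::] [:: L 1 1842593164991]]; B [::] [:: B [::] [:: L 1
2698331038583]; B [::] [:: L 1 3790342998147]]]; B [::] [:: B [::] [:: B [::] [:: L 0 567480654976]; B [::] [:: L 0
3813832494656]]; B [::] [:: B [::] [:: L 0 1971937193088]; B [::] [:: L 0 1903302686272]]; B [::] [:: B [::] [:: L 0
2802607816384]; B [::] [:: L 0 2898011551936]]; B [::] [:: B [::] [:: L 0 2141743897792]; B [::] [:: L 0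
3088971747776]]; B [::] [:: B [::] [:: L 1 2971094507341]; B [::] [:: L 1 4079163290527]]; B [::] [:: B [::] [:: L 1
1699768723869]; B [::] [:: L 1 4348672488251]]; B [::] [:: B [::] [:: L 1 1692252530700]; B [::] [:: L 1
3749608191694]]; B [::] [:: B [::] [:: L 1 3403863324642]; B [::] [:: L 1 1195192372459]]]]; D; D; D; D]; B [::
3666997162060; 2698465255513; 3253623595075; 4084733587569] [::]; B [:: 3593965940809; 4280087228507; 3659464192093;
2425718054992; 4072838279245; 3454429835386] [::]; B [:: 2227076341865; 2222814404713; 2367803629695; 2705008369756]
[:: D; B [:: 2503145431158; 2503044767819; 2220734029916; 2708129456206] [:: B [::] [:: D; B [::] [:: B [::] [:: L 1
3888087958960]]; D; B [::] [:: B [::] [:: L 1 3205757545541]]; D; D; D; D]; D; D; D; D; D]; D; D; D; D; D; D; D; D; D;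
D; D; D; D]; B [:: 3319006244949; 2423572668537; 2354786082919] [::]; B [:: 3315783970897; 2218419822690;
2423637680241] [::]; B [:: 3872149221469; 2562100043853; 2559952560199; 3605844996210] [::]; B [:: 3319139414123;
3319006244981; 2285059973193; 3384636616774] [::]; B [:: 3455504625763; 2218554040418; 2423572668498; 3455371456624]
[::]]; B [:: 3324440784987; 2225077993575; 3316118614137] [:: B [:: 2224937246792; 2216340496504; 2766102863987;
2216340496464; 2774695419993] [:: D; B [::] [:: B [::] [:: B [::] [:: B [::] [:: L 1 2656718390131]]]; B [::] [:: B
[::] [:: B [::] [:: L 1 2518472000672]]]]; D; D; D; D; D; D; B [::] [:: B [::] [:: B [::] [:: B [::] [:: L 2
2775767013984]]]; B [::] [:: B [::] [:: B [::] [:: L 2 2226010629161]]]]; D; D; D; D]; B [:: 2774684934259;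
3874196303987; 2216338399304] [::]; B [:: 2224939343936; 3324440752226; 3874208886904] [:: D; D; D; D; D; B [::
2216338399304; 2216338399328] [:: B [::] [:: B [::] [:: B [::] [:: L 2 2259302508141]]]; B [::] [:: B [::] [:: B [::]
[:: L 2 2792948704263]]]; B [::] [:: B [::] [:: B [::] [:: L 2 2801538540549]]]; B [::] [:: B [::] [:: B [::] [:: L 2
2784358847614]]]; D]; D; D; B [:: 2216338399328] [:: B [::] [:: B [::] [:: B [::] [:: L 2 3351420581494]]]; B [::] [::
B [::] [:: B [::] [:: L 2 3351418484318]]]; B [::] [:: B [::] [:: B [::] [:: L 2 2251908859431]]]; B [::] [:: B [::]
[:: B [::] [:: L 2 3334251234877]]]; D; D]]; B [:: 2224937246824] [:: D; D; D; D; D; D; D; D; D; D; D; D; D; D; D; D;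
D; B [:: 2216338399328] [:: B [::] [:: B [::] [:: B [::] [:: L 3 2250700242066]]]; B [::] [:: B [::] [:: B [::] [:: L
3 2259835966643]]]; D; D; D; D]; D; D; D; B [:: 2216338399328] [:: B [::] [:: B [::] [:: B [::] [:: L 3
2207890707222]]]; B [::] [:: B [::] [:: B [::] [:: L 3 2208427458351]]]; D; D; D; D]; D; D; D]; B [:: 2216340496456;
2766109155410; 2766098669688; 2774697517120; 2774689128562] [::]; B [:: 3315862614138; 3315850031177; 3315862614130]
[:: B [::] [:: B [::] [:: B [::] [:: B [::] [:: L 2 1700946345633]]]; B [::] [:: B [::] [:: B [::] [:: L 2
1159782716551]]]]; D; D; B [:: 2216338399304; 2216338399320] [:: B [::] [:: B [::] [:: B [::] [:: L 2
1118984804366]]]; B [::] [:: B [::] [:: B [::] [:: L 2 1159786846857]]]; B [::] [:: B [::] [:: B [::] [:: L 2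
1127573407923]]]; B [::] [:: B [::] [:: B [::] [:: L 2 1159776424077]]]; D]; B [:: 2216338399312] [:: B [::] [:: B
[::] [:: B [::] [:: L 3 1151188614225]]]; B [::] [:: B [::] [:: B [::] [:: L 3 1142865393767]]]; D; D; D; D]; D; D; D;
D; D; D; D; D; D]; B [:: 2774693322841; 2766102863995; 2216338399328; 2224943538289] [::]; B [:: 2216353079363;
2216342593617; 2216346787946; 2216350982235; 2216338399336] [:: D; D; D; D; D; D; D; D; D; D; D; B [::] [:: B [::] [::
B [::] [:: B [::] [:: L 2 2774687807716]]]; B [::] [:: B [::] [:: B [::] [:: L 2 2803677485786]]]]; B [::
2216338399336; 2216338399304] [:: B [::] [:: B [::] [:: B [::] [:: L 2 2219560059600]]]; B [::] [:: B [::] [:: B [::]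
[:: L 2 2766103928549]]]; B [::] [:: B [::] [:: B [::] [:: L 2 2228157983749]]]; B [::] [:: B [::] [:: B [::] [:: L 2
2766108152037]]]; D]; D; D; D; D; D; D; D; D; D; D; D; D; D; D]; B [:: 2216353079411; 2216353079395; 2216346787954;
2216344690801; 2216342593625] [:: D; B [::] [:: B [::] [:: B [::] [:: B [::] [:: L 2 1136556098093]]]; B [::] [:: B
[::] [:: B [::] [:: L 2 3301232115348]]]]; D; D; D; D; D; D; D; D; D; D; D; D; D; D; D; D; D; B [:: 2216338399328] [::
B [::] [:: B [::] [:: B [::] [:: L 2 1163678898417]]]; B [::] [:: B [::] [:: B [::] [:: L 2 1143281210586]]]; D]; D;
D; D; D; D; D; D; D; D; D; D; D]; B [:: 2216348885066; 2216346787962; 3315852128369; 3315856322624] [:: D; B [::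
2216338399344] [:: B [::] [:: B [::] [:: B [::] [:: L 2 1110796780042]]]; B [::] [:: B [::] [:: B [::] [:: L 2
1110786757784]]]; D]; D; D; B [:: 2216338399312] [:: B [::] [:: B [::] [:: B [::] [:: L 2 3324857972912]]]; B [::] [::
B [::] [:: B [::] [:: L 2 3324847519922]]]; B [::] [:: B [::] [:: B [::] [:: L 2 1125830564506]]]; B [::] [:: B [::]
[:: B [::] [:: L 2 1153745472056]]]; D; D]; B [:: 2216338399312] [:: B [::] [:: B [::] [:: B [::] [:: L 3
1125831206657]]]; B [::] [:: B [::] [:: B [::] [:: L 3 1142999624488]]]; D; D; D; D]; D; D; D; D; D; D; D; D; D]; B
[:: 3874206789729; 2216353079371; 3865610301529; 3874202595450] [::]; B [:: 2216346787906; 2224928858218] [::]; B [::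
3315852128321; 2216342593617; 2766098669656] [::]; B [:: 3874204692561; 2224937246792; 3324455432273] [::]; B [::
2216344690753; 2216346787922; 2216338399304; 2216340496464] [:: B [::] [:: B [::] [:: B [::] [:: B [::] [:: L 3
610301468797]]]]; D; D; D; B [::] [:: B [::] [:: B [::] [:: B [::] [:: L 3 593110922863]]]]; D; D; D; D; D]; B [::
2216342593609; 2216348885058; 2216353079387; 2216350982227] [:: D; D; B [::] [:: B [::] [:: B [::] [:: B [::] [:: L 3
1143005883171]]]]; D; B [::] [:: B [::] [:: B [::] [:: B [::] [:: L 3 1143270176513]]]; D]; D; D; D; D; D; D; D; D]];
B [:: 2220969091189; 2238529519739; 2202180067392] [:: B [:: 2225474117744; 2219025375312; 2253385113688;
2218496893024] [:: B [::] [:: B [::] [:: B [::] [:: B [::] [:: L 3 2236653065454]]]; B [::] [:: B [::] [:: B [::] [::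
L 3 2234493127750]]]]; D; D; B [::] [:: B [::] [:: B [::] [:: B [::] [:: L 3 2235072477001]]]; B [::] [:: B [::] [:: B
[::] [:: L 3 2241544766564]]]]; D; D; D; D; B [::] [:: B [::] [:: B [::] [:: B [::] [:: L 3 2245367896025]]]; B [::]
[:: B [::] [:: B [::] [:: L 3 2245904104916]]]]; D; D]; B [:: 2259288596578; 2250698137672] [::]; B [:: 2259825467514;
2259288596578] [:: B [::] [:: B [::] [:: B [::] [:: B [::] [:: L 3 2238787962206]]]; B [::] [:: B [::] [:: B [::] [::
L 3 2238800672084]]]]; D; D; D; B [::] [:: B [::] [:: B [::] [:: B [::] [:: L 3 2237223998403]]]; B [::] [:: B [::]
[:: B [::] [:: L 3 2238858171222]]]]; D; D; D; D; D; D; D; D; D; D; D; D; D; D; D; D; D; D; D; D]; B [::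
2218488504386; 2224928858186; 2259288596578] [::]; B [:: 2216376148033; 2216875270256] [::]; B [:: 2216921407603;
2218525728835; 2250698137704] [:: D; D; D; D; D; D; D; B [::] [:: B [::] [:: B [::] [:: B [::] [:: L 3
2209405441993]]]; B [::] [:: B [::] [:: B [::] [:: L 3 2237317973443]]]]; B [:: 2216338399328] [:: B [::] [:: B [::]
[:: B [::] [:: L 3 2210978675702]]]; B [::] [:: B [::] [:: B [::] [:: L 3 2245876977990]]]; D; B [::] [:: B [::] [:: B
[::] [:: L 3 2202421399409]]]; B [::] [:: B [::] [:: B [::] [:: L 3 2202949758327]]]; D]; D]; B [:: 2219070988371;
2216346787938; 2252848242794] [:: B [::] [:: B [::] [:: B [::] [:: B [::] [:: L 3 2251672864880]]]; B [::] [:: B [::]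
[:: B [::] [:: L 3 2253824151787]]]]; D; D; D; D; D; D; D; D; B [::] [:: B [::] [:: B [::] [:: B [::] [:: L 3
2202550828017]]]; B [::] [:: B [::] [:: B [::] [:: L 3 2203096151882]]]; D; D]; D]; B [:: 2227086303306;
2218496893024] [:: B [::] [:: B [::] [:: B [::] [:: B [::] [:: L 4 142276268554]]]; B [::] [:: B [::] [:: B [::] [:: L
4 582008068124]]]]; D; D; D; D; D; B [::] [:: D; B [::] [:: B [::] [:: B [::] [:: L 5 2229528074173]]]]; D; D; D; D;
D; D; D; D; D; D; D; D; D; D; D; D; D; D; D; D; D; D; D; D; D; D; D; D; D; D; D; D; D; D; D; D; D; D; D; D; D; D; D;
D; D; D; D; D; D; D; D; D; D; D; D; D; D; D; D; D; D; D; D; D; D; D; D; D; D; D; D; D; D; D; D; D; D; D; D; D; D]; B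
[:: 2216913018993] [:: D; D; D; D; D; D; D; D; D; D; D; D; D; D; D; D; D; D; D; D; D; D; D; D; D; D; D; D; D; D; D; D;
D; D; D; D; D; D; D; D; D; D; D; D; D; D; D; D; D; D; D; D; D; D; D; D; D; D; D; D; D; D; D; D; D; D; D; D; D; D; D;
D; D; D; D; D; D; D; D; D; D; D; D; D; D; D; D; D; D; D; D; D; D; D; D; D; D; D; D; D; D; D; D; D; D; D; D; D; D; D;
D; D; D; D; D; D; D; D; D; D; D; D; D; D; D; D; D; D; D; D; D; D; D; D; D; D; B [::] [:: D; B [::] [:: B [::] [:: B
[::] [:: L 5 2201785276343]]]]; D; D; D; D; D; D; D; D; D; D; D]]; B [:: 2216338661472; 2217708167274; 1221796544634;
2217418567802; 3316680847433] [:: B [:: 2216359632977; 2216338661472; 2217687130202; 2217435476075; 2216359374945]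
[::]; B [:: 2216875274336] [:: B [::] [:: B [::] [:: B [::] [:: B [::] [:: L 5 145341343750]]]; B [::] [:: B [::] [::
B [::] [:: L 5 139336611896]]]]; B [::] [:: B [::] [:: B [::] [:: B [::] [:: L 5 413944888368]]]; B [::] [:: B [::]
[:: B [::] [:: L 5 533944065075]]]]; D; D; D; D; D; D; D; D; D; D; D; D; D; D; D; D; D; D; D]; B [:: 2216606834784;
2216875536448; 2216606838896] [::]; B [:: 2217980473435; 2252055785554; 2252319760498] [::]; B [:: 2217414238282;
2250698924136] [::]; B [:: 2217414238282; 2217414242395; 2216359374945] [::]; D; B [:: 2217414500458; 2217435471994;
2216347054161; 2216368025696] [::]; B [:: 2251256508504; 2251795476578; 2251782893650] [:: D; D; D; B [::
2250698661960; 2216338661472] [:: D; B [::] [:: B [::] [:: B [::] [:: L 5 190859999281]]]; B [::] [:: B [::] [:: B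
[::] [:: L 5 155963185193]]]]; B [::] [:: D; D; D; D; B [::] [:: B [::] [:: B [::] [:: L 5 2751526420552]]]; B [::]
[:: B [::] [:: B [::] [:: L 5 2800587718780]]]; D; D]; B [::] [:: D; D; D; D; D; D; B [::] [:: B [::] [:: B [::] [:: L
5 2752583684179]]]; B [::] [:: B [::] [:: B [::] [:: L 5 2801678532687]]]]; D; D; B [::] [:: D; D; B [::] [:: B [::]
[:: B [::] [:: L 5 2422657439747]]]; B [::] [:: B [::] [:: B [::] [:: L 5 2415521122364]]]]]; B [:: 2216359632977;
2217414500458; 2216628072545; 2216359370865] [::]; B [:: 2251264893001; 2217422889035; 2217959497818; 2216875536448]
[:: D; D; B [:: 2216875270256; 2216338661472] [:: D; B [::] [:: B [::] [:: B [::] [:: L 5 183262210050]]]; B [::] [::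
B [::] [:: B [::] [:: L 5 148365244440]]]; D]; B [:: 2216338661472] [:: D; D; D; B [::] [:: B [::] [:: B [::] [:: L 5
690462152782]]]; D; B [::] [:: B [::] [:: B [::] [:: L 5 724302092381]]]]; D; B [::] [:: D; D; B [::] [:: B [::] [:: B
[::] [:: L 5 2451004712985]]]; B [::] [:: B [::] [:: B [::] [:: L 5 2417173256209]]]]]; B [:: 2216896245841;
2216607101008; 2216615227473] [::]; B [:: 2251774763106; 2250707312713] [:: D; D; D; D; D; B [::] [:: D; B [::] [:: B
[::] [:: B [::] [:: L 6 1135975403822]]]]; D; B [::] [:: D; B [::] [:: B [::] [:: B [::] [:: L 6 2320511015669]]]]; D;
D; D; D; D; D; D; D; D; D; D; D; D; D; D; D; D; D; D; D; D; D; D; D; D; D; D; D; D; D; D; D; D; D; D; D; D; D; D; D;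
D; D; D; D; D; D; D; D; D; D; D; D; D; D; D; D; D; D; D; D; D; D; D; D; D; D; D; D; D; D; D; D]; B [:: 2251774763106;
2250707312713] [::]; B [:: 2217164943441; 2216636457040; 2216367763520] [:: D; D; D; D; D; B [::] [:: D; B [::] [:: B
[::] [:: B [::] [:: L 7 87492428056]]]]; D; D; D; D; D; D; D; D; D; D; B [::] [:: B [::] [:: B [::] [:: B [::] [:: L 6
4315419097163]]]; D]; D; D; D; D; D; D; D; D; D; D; D; D; D; D; D; D; D; D; D; D; D; D; D; D; D; D; D]; B [::
2216636461120; 2217164677217; 2216607096896] [::]; B [:: 2216338403408; 2251244183641; 2250719899752; 2216606838896;
2217414242395] [:: D; D; D; D; D; D; D; D; B [::] [:: B [::] [:: B [::] [:: B [::] [:: L 8 2218012232753]]]; B [::]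
[:: B [::] [:: B [::] [:: L 8 3369226306679]]]]; B [::] [:: B [::] [:: B [::] [:: B [::] [:: L 8 2320762449988]]]; B
[::] [:: B [::] [:: B [::] [:: L 8 2319588029461]]]]; D]; B [:: 2216896241729; 2252340994115; 2250975486041;
2251264897145; 2218244714603] [::]; B [:: 2216636194928; 2216338403408] [::]; B [:: 2216636199008; 2216636194928]
[::]]]%num.
Definition certs2 := [:: B [:: 2216338399329; 2357065687153; 1851383111787] [:: B [:: 2634141409369; 2562100043866;
2357065687145; 2562100043855] [:: B [::] [:: B [::] [:: B [::] [:: B [::] [:: L 0 3789870053120]; B [::] [:: L 1
3292529442944]]; B [::] [:: B [::] [:: L 1 3446243352768]; B [::] [:: L 1 2053180494016]]; B [::] [:: B [::] [:: L 1
2046434759104]; B [::] [:: L 1 2503229325376]]; B [::] [:: B [::] [:: L 1 3956505325824]; B [::] [:: L 1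
3544103542848]]; B [::] [:: B [::] [:: L 2 1498306597252]; B [::] [:: L 2 1226683470216]]; B [::] [:: B [::] [:: L 2
4041950376309]; B [::] [:: L 2 846059802820]]; B [::] [:: B [::] [:: L 2 1701748433101]; B [::] [:: L 2
4365651292479]]; B [::] [:: B [::] [:: L 2 1780499374178]; B [::] [:: L 2 2054253207663]]]]; D; B [:: 2216338399341;
2216338399334] [:: B [::] [:: D; D; D; B [::] [:: B [::] [:: L 1 653284437568]]; D; D; D; D]; B [::] [:: B [::] [:: B
[::] [:: L 3 493633409280]]; D; D; D; D; D; D; D]; D; D; D; D; B [::] [:: D; B [::] [:: B [::] [:: L 3
4319970579200]]; D; D; D; D; D; D]; B [::] [:: D; D; B [::] [:: B [::] [:: L 3 736234303680]]; D; D; D; D; D]; D; D;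
D; D; D; D; D; D; D; D; D; D; D; D; D; D; D; D; D; D]; D; D; D; D; D; D; D; D; D; D]; B [:: 2698532364394;
2289386397792; 2430113685614; 2357065687158; 2289386397822] [::]; B [:: 2497709088837; 2289386397821; 2216338399350]
[:: B [:: 2216338399340; 2216338399332] [:: B [::] [:: B [::] [:: B [::] [:: L 3 1836800918336]]]; B [::] [:: B [::]
[:: B [::] [:: L 3 2896649682496]]]; D; D; D; D; B [::] [:: B [::] [:: B [::] [:: L 3 2250168011008]]]; B [::] [:: B
[::] [:: B [::] [:: L 1 3029146697088]]]; D; D; D; D; D; D; D; D; D; D; D; D; D; D; D; D; D; D; D; D]; D; B [::
2216338399359; 2216338399338] [:: B [::] [:: B [::] [:: B [::] [:: L 3 3865266502592]]]; B [::] [:: B [::] [:: B [::]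
[:: L 1 344735186560]]]; D; D; D; B [::] [:: B [::] [:: B [::] [:: L 3 469667698048]]]; B [::] [:: B [::] [:: B [::]
[:: L 3 3029389393408]]]; D; D; D; D; D; D; D; D; D; D; D; D; D; D; D; D; D; D; D; D; D]; D; D]; B [:: 2497709088835;
2289386397799; 2497709088876; 2497709088843] [::]; B [:: 2562100043865; 2497709088837; 2634141409401] [::]; B [::
2634141409402; 2357065687166; 2497709088855] [::]; B [:: 2430113685589; 2289386397768; 2357065687161; 2289386397798;
2497709088833] [::]; B [:: 2430113685594; 2357065687157] [::]; B [:: 2634141409367; 2357065687130; 2497709088892;
2698532364379; 2289386397809] [::]; B [:: 2357065687148; 2634141409362; 2497709088847; 2698532364375] [::]; B [::
2216338399311; 2562100043852; 2216338399313; 2216338399321] [::]; B [:: 2216338399342; 2289386397766] [::]; B [::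
2497709088883; 2497709088884; 2497709088892; 2216338399351] [::]; B [:: 2216338399313; 2216338399309; 2562100043850;
2216338399317] [::]; B [:: 2562100043852; 2216338399326; 2562100043864; 2562100043869] [::]; B [:: 2562100043854;
2216338399303; 2562100043845] [::]; B [:: 2216338399310; 2216338399336; 2216338399329] [::]; B [:: 2216338399304;
2289386397801; 2216338399311] [::]; B [:: 2216338399308; 2216338399345; 2216338399348] [::]; B [:: 2216338399307;
2497709088884; 2497709088881] [::]; B [:: 2357065687111; 2357065687159; 2216338399329] [::]; B [:: 2357065687124;
2216338399314; 2216338399331] [::]; B [:: 2216338399314; 2698532364397; 2698532364358] [::]; B [:: 2698532364414;
2216338399353; 2698532364375] [::]; B [:: 2216338399354; 2430113685595; 2216338399330] [::]; B [:: 2430113685593;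
2430113685625; 2430113685569] [::]; B [:: 2216338399347; 2216338399323; 2634141409346] [::]; B [:: 2634141409385;
2216338399322; 2216338399346] [::]; D; D; D; D; D; D; B [:: 2216338399336; 2216338399313; 2216338399329;
2216338399304] [:: B [::] [:: B [::] [:: B [::] [:: B [::] [:: L 2 846068909093]]]]; D; D; D; D; D; D; D; D; D; D; D;
D; D; D; D]; D; B [:: 2216338399354; 2216338399330; 2216338399321] [::]; D; B [:: 2216338399305; 2216338399314;
2216338399354; 2216338399297] [::]; D; B [:: 2216338399321; 2216338399314; 2216338399337] [::]; D]; B [::
2768241696865; 2364514771064; 2362367287382; 2766094213185; 2766094213191] [:: B [:: 2216338399302; 2912123101269;
2766094213199; 2768241696873] [::]; B [:: 2914270584955; 2218485882986; 2216338399302; 2364514771062] [::]; B [::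
2766094213185; 2914270584955; 2768241696869; 2768241696873] [::]; B [:: 2216338399306; 2218485882978] [:: B [::] [:: B
[::] [:: B [::] [:: B [::] [:: L 2 4169393545385]; B [::] [:: L 2 1863850189495]]]; D; D]; D; D; D; D; D; D; D; D; D;
D; D; D; D; D; D; D; D; D; D; D; D; D; D; D; D; D; D; D; D; D; D; D; D; D; D; D; D; D; D; D; D; D; D; D; D; D; D; D;
D; D; D; D; D; D; D; D; D; D; D; D; D; D; D; D; D; D; D; D; D; D; D; D; D; D; D]; B [::] [:: B [::] [:: B [::] [:: B
[::] [:: B [::] [:: L 2 4229336974236]; B [::] [:: L 2 2098027578247]]]; D; D]; D; D; D; D; D; D; D; D; D; D; D; D; D;
D; D; D; D; D; D; D; D; D; D; D; D; D; D; D; D; D; D; D; D; D; D; D; D; D; D; D; D; D; D; D; D; D; D; D; D; D; D; D;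
D; D; D; D; D; D; D; D; D; D; D; D; D; D; D; D; D; D; D; D; D; D; D; D; D; D; D; D; D; D; D; D; D; D; D; D; D; D; D];
B [:: 2216338399300; 2766094213193] [::]; B [:: 2218485882982; 2216338399302] [::]; B [:: 2914270584959;
2914270584953] [::]; B [:: 2362367287378; 2912123101273; 2768241696867] [::]; B [:: 2768241696871; 2218485882986]
[::]; B [:: 2914270584955; 2216338399304; 2364514771062] [::]; B [:: 2766094213193] [::]; B [:: 2362367287386;
2364514771056; 2766094213187] [::]; B [:: 2362367287390; 2218485882986] [::]; B [:: 2218485882988; 2912123101269]
[::]; B [:: 2216338399308] [::]; B [:: 2914270584945; 2766094213185; 2218485882978] [::]; B [:: 2216338399306;
2218485882984; 2914270584951] [::]; B [:: 2362367287390; 2768241696871] [::]; B [:: 2914270584949; 2914270584955]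
[::]; B [:: 2218485882986; 2218485882978] [::]; B [:: 2218485882978; 2216338399304] [::]; B [:: 2218485882976;
2218485882986] [::]; B [:: 2218485882982] [::]; B [:: 2218485882976] [::]; B [:: 2218485882980] [::]; B [::
2218485882984; 2766094213185; 2216338399308; 2364514771066] [::]; B [:: 2364514771060; 2766094213199] [::]; B [::
2768241696875; 2766094213187; 2768241696879] [::]; B [:: 2216338399306; 2216338399300; 2766094213187] [::]; B [::
2218485882976; 2216338399302; 2768241696865; 2912123101265] [::]; B [:: 2364514771062; 2914270584947] [::]; B [::
2216338399310; 2768241696877; 2218485882990] [::]; B [:: 2766094213189; 2766094213199] [::]; B [:: 2364514771064;
2912123101269] [::]; B [:: 2364514771070; 2768241696867] [::]; B [:: 2364514771056; 2914270584955; 2912123101279]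
[::]; B [:: 2766094213195; 2362367287390; 2768241696867] [::]; B [:: 2218485882984; 2216338399304] [::]; B [::
2218485882990; 2218485882980] [::]; B [:: 2216338399300; 2912123101273; 2914270584955; 2766094213197] [::]; B [::
2218485882986; 2914270584959; 2914270584955] [::]; B [:: 2362367287390; 2362367287378; 2218485882984] [::]; B [::
2218485882984; 2218485882988; 2216338399306] [::]; B [:: 2768241696871; 2914270584955; 2364514771062] [::]; B [::
2768241696877; 2912123101271; 2914270584957] [::]; B [:: 2362367287376; 2362367287390; 2766094213185; 2914270584949]
[::]; B [:: 2218485882978; 2218485882988; 2912123101269] [::]; B [:: 2362367287380; 2364514771062; 2362367287378]
[::]; B [:: 2216338399306; 2218485882984] [::]; B [:: 2768241696869; 2364514771068; 2766094213191] [::]; B [::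
2364514771056; 2768241696879; 2766094213191] [::]; B [:: 2218485882976; 2218485882984] [::]; B [:: 2218485882986;
2218485882976] [::]; B [:: 2914270584951; 2768241696873; 2364514771066; 2912123101277] [::]; B [:: 2218485882976;
2914270584945] [::]; B [:: 2362367287390; 2216338399300; 2914270584955] [::]; B [:: 2914270584945; 2914270584955;
2914270584959] [::]; B [:: 2218485882976; 2766094213197; 2912123101275] [::]; B [:: 2218485882982; 2914270584955;
2362367287386] [::]; B [:: 2218485882984; 2768241696879; 2364514771062] [::]; B [:: 2766094213191; 2912123101277;
2914270584955] [::]; B [:: 2766094213199; 2364514771068; 2364514771058; 2218485882982] [::]; B [:: 2218485882990;
2914270584945; 2914270584959] [::]; B [:: 2914270584957; 2768241696877; 2914270584955] [::]; B [:: 2914270584955;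
2914270584945; 2914270584957] [::]; B [:: 2218485882984; 2216338399304] [::]; B [:: 2218485882990; 2216338399306]
[::]; B [:: 2216338399306; 2216338399304] [::]; B [:: 2216338399304; 2216338399306] [::]; D; B [:: 2766094213189;
2766094213191] [::]; D; B [:: 2216338399298; 2914270584947; 2914270584953] [::]; B [:: 2216338399304; 2914270584953;
2216338399306] [::]; B [:: 2216338399306; 2216338399304; 2914270584955] [::]; D; B [:: 2216338399298; 2914270584959]
[::]; D; B [:: 2216338399304; 2766094213195] [::]; B [:: 2216338399304; 2766094213187] [::]; B [:: 2216338399306;
2766094213193] [::]; B [:: 2914270584947; 2914270584955] [::]; B [:: 2914270584959; 2914270584949] [::]; B [::
2216338399304] [::]; B [:: 2216338399306; 2766094213189] [::]; B [:: 2914270584947; 2216338399304] [::]; B [::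
2914270584959; 2914270584949] [::]; B [:: 2216338399304] [::]; B [:: 2216338399306; 2766094213189] [::]; B [::
2914270584947; 2914270584955] [::]; B [:: 2914270584945; 2216338399306] [::]]; B [:: 2216348885059; 2216340496481;
2216348885091; 2774690607174] [:: B [:: 2774688346226] [::]; B [:: 2216338399328] [::]; B [:: 2216338399328;
2216338399304] [::]; B [:: 2216348885067; 2216348885099] [::]; D; D; D; B [::] [:: D; D; D; D; D; D; D; D; D; D; D; D;
D; D; D; D; D; D; D; D; D; D; D; D; D; D; D; D; D; D; D; D; B [::] [:: B [::] [:: B [::] [:: B [::] [:: L 4
2216338399296]]]; B [::] [:: B [::] [:: B [::] [:: L 4 1213215001628]]]]; B [::] [:: B [::] [:: B [::] [:: B [::] [::
L 4 1135900060722]]]; B [::] [:: B [::] [:: B [::] [:: L 4 1126237589098]]]]; D; B [::] [:: B [::] [:: B [::] [:: B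
[::] [:: L 4 1194973117516]]]; B [::] [:: B [::] [:: B [::] [:: L 4 1753172192264]]]]; B [::] [:: B [::] [:: B [::]
[:: B [::] [:: L 4 1196038054013]]]; B [::] [:: B [::] [:: B [::] [:: L 4 2294753377868]]]]; D; B [::] [:: B [::] [::
B [::] [:: B [::] [:: L 4 1194839753221]]]; B [::] [:: B [::] [:: B [::] [:: L 4 2293530328147]]]]; B [::] [:: B [::]
[:: B [::] [:: B [::] [:: L 4 1135753798152]]]; B [::] [:: B [::] [:: B [::] [:: L 4 1186235706899]]]]; D; B [::] [::
B [::] [:: B [::] [:: B [::] [:: L 4 1754384616473]]]; B [::] [:: B [::] [:: B [::] [:: L 4 2860615556163]]]]; B [::]
[:: B [::] [:: B [::] [:: B [::] [:: L 4 2293532425322]]]; B [::] [:: B [::] [:: B [::] [:: L 4 2286019301959]]]]; D;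
D; D; D; D; D; D]; D; D; B [:: 2216346787938] [:: D; D; D; D; D; D; D; D; D; D; D; D; B [::] [:: D; B [::] [:: B [::]
[:: B [::] [:: L 5 2216338399296]]]]; D; D]; D; D; D; D; D; D; D; D; D; B [:: 2216346787914] [::]; B [::] [:: D; D; D;
D; D; D; D; D; B [::] [:: B [::] [:: B [::] [:: B [::] [:: L 6 2216338399296]]]]; D; D; B [::] [:: B [::] [:: B [::]
[:: B [::] [:: L 6 2774696898629]]]]; D; D; D; D; D; D; D; D; D; D; D; B [::] [:: B [::] [:: B [::] [:: B [::] [:: L 6
2774690607206]]]]; B [::] [:: B [::] [:: B [::] [:: B [::] [:: L 6 2216348885067]]]]; D; D; D; D; D; D; D; D; D; D; D;
D; D; D; D; D; D]; D; B [:: 2216346787938] [::]; D; B [:: 2216340496489; 2216348885059] [::]; D; D; B [::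
2216338399336] [::]; B [:: 2216340496457; 2216338399336] [::]; D; D; D; B [:: 2216346787914] [::]; B [::
2216338399336; 2216348885091] [::]; B [:: 2216338399328] [::]; B [:: 2216348885067] [::]; D; D; B [:: 2774698831985;
2774696734800] [::]; B [:: 2774698831953] [::]; B [:: 2216338399304] [::]; B [:: 2774698831993; 2216338399336] [::];
D; D; B [:: 2774696734832; 2774698831953] [::]; D; B [:: 2774698831961] [::]; B [:: 2216338399304] [::]; D; D; B [::
2774696734800] [::]; D; B [:: 2216338399328; 2216338399304] [::]; B [:: 2774696734832] [::]; B [:: 2774696734800;
2774698831993] [::]; B [:: 2774698831961] [::]; B [:: 2216338399304; 2216340496481; 2216340496449] [::]; D; D; D; D; B
[:: 2216340496489; 2216338399304] [::]; B [:: 2216338399304; 2216346787938; 2216340496489] [::]; B [:: 2216346787914;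
2216338399336] [::]; B [:: 2216346787914] [::]; D; D; B [:: 2216340496489; 2216338399304; 2216346787946] [::]; B [::
2216346787914; 2216340496481] [::]; B [:: 2216338399328; 2216346787946] [::]; B [:: 2216340496481; 2216348885067;
2216340496449] [::]; B [:: 2216340496481; 2216340496457; 2216348885067] [::]; B [:: 2216340496489] [::]; D; D; D; D;
D; D; D; D; D; D; D; D; D; D; D; D; D; D; D; D]; B [:: 2225478201443; 2259831611479; 2259840000078] [:: B [::] [:: D;
D; D; D; D; D; B [::] [:: B [::] [:: B [::] [:: B [::] [:: L 6 1135486747136]]]]; D; D]; D; D; B [::] [:: D; D; D; D;
D; D; D; D; D; D; D; B [::] [:: B [::] [:: B [::] [:: B [::] [:: L 6 1666989435980]]]; D]]; D; D; D; D; D; D; D; B [::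
2216338399328] [::]; D; B [:: 2216346787921] [:: D; D; D; D; D; B [::] [:: B [::] [:: B [::] [:: B [::] [:: L 5
2254590758402]]]]; D; D; D; D]; B [::] [:: D; D; D; D; D; D; D; B [::] [:: D; B [::] [:: B [::] [:: B [::] [:: L 5
2263315585740]]]]; D]; D; B [:: 2216346787921] [::]; D; D; D; D; D; B [:: 2216338399328] [::]; B [:: 2216338399328]
[::]; D; D; D; D; B [:: 2216338399328] [::]; D; D; D; D; D; D; D; D; B [:: 2216338399328] [::]; D]; B [::
2251774423128; 2251774287984; 2259296792668; 2216338452593] [:: D; D; D; D; D; D; B [:: 2226012561481] [::]; D; D; D;
D; D; D; D; D; D; D; D; D; D; D; D; D; D; D; D; D; D; D; D; D; D; D; D; B [:: 2226012561481] [::]; D; D; D; D; D; D;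
D; D; D; D; D; D; D; D; B [:: 2226012561481] [::]; D; D; D; D; D; D; D; B [::] [:: D; D; D; D; D; D; D; D; D; B [::]
[:: B [::] [:: B [::] [:: B [::] [:: L 7 2216338399296]]]]]; D; D; D; D; D; D; D; B [:: 2251774242881] [:: D; D; D; D;
D; D; D; D; D; D; D; D; D; D; B [::] [:: B [::] [:: B [::] [:: B [::] [:: L 8 2216338399296]]]; B [::] [:: B [::] [::
B [::] [:: L 8 671763294265]]]]; B [::] [:: B [::] [:: B [::] [:: B [::] [:: L 8 73556685361]]]; B [::] [:: B [::] [::
B [::] [:: L 8 2332331274773]]]]; D; D; B [::] [:: B [::] [:: B [::] [:: B [::] [:: L 8 2874547681796]]]; B [::] [:: B
[::] [:: B [::] [:: L 8 610448732760]]]]; B [::] [:: B [::] [:: B [::] [:: B [::] [:: L 8 2844890609788]]]; B [::] [::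
B [::] [:: B [::] [:: L 8 679285844004]]]]]; D; D; D; D; D; D; D; D; D; D; B [:: 2251774242881] [::]; D; D; D; B [::
2251774242881] [::]; D; D; B [:: 2251774242881] [::]; B [:: 2251774242881] [::]; B [:: 2259296727112] [::]; D; D; D;
D; D; D; D; B [:: 2259296727112] [::]; B [:: 2259296727112] [::]; D; D; B [:: 2259296727112] [::]]; B [::
2216338403417; 2204864245839; 2207889322109] [:: D; D; D; D; D; D; D; B [:: 2216338403417] [::]; D; D; D; D; B [::
2216338403417] [::]; D; B [:: 2216338403417] [::]; D; D; B [:: 2216338403417] [::]; D; D; D; D; D; D; D; D; D; D; D;
D; D; D; D; D; D; D; D; B [:: 2216338403417] [::]; D; D; B [:: 2216338403417] [::]; D; D; D; D; D; D; D; D; D; D; D;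
D; B [:: 2216338403417] [::]; D; D; D; D; D; B [:: 2216338403417] [::]; B [::] [:: D; D; D; B [::] [:: B [::] [:: B
[::] [:: B [::] [:: L 7 2209032285232]]]]; D; D; B [::] [:: B [::] [:: B [::] [:: B [::] [:: L 7 2222178090289]]]];
D]; B [:: 2216338403417] [::]; D; D; D; D; D; D; D; D; D; D; D; D; D]; B [:: 3861512319064] [:: D; D; D; D; D; D; D;
D; D; D; D; D; D; D; D; D; D; D; D; D; D; D; D; D; D; D; D; D; D; D; D; D; D; D; D; D; D; D; D; D; D; D; D; D; D; D;
D; D; D; D; D; D; D; D; D; D; D; D; D; D; D; D; D; D; D; D; D; D; D; D; D; D; D; D; D; D; D; D; D; D; D; D; D; D; D;
D; D; D; D; D; D; D; D; D; D; D; D; D; D; D; D; D; D; D; D; D; D; D; D; D; D; D; D; D; D; D; D; D; D; D; D; D; D; D;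
D; D; D; D; D; D; D; D; D; D; D; D; D; D; D; D; D; D; D; D; D; D; D; D; D; D; D; D; D; D; D; D; D; D; D; D; D; D; D;
D; D; D; D; D; D; D; D; D; D; D; D; D; D; D; D; D; D; D; D; D; D; D; D; D; D; D; D; D; D; D; D; D; D; D; D; D; D; D;
D; D; D; D; D; D; D; D; D; D; D; D; D; D; D; D; D; D; D; D; D; D; D; D; D; D; D; D; D; D; D; D; D; D; D; D; D; D; D;
D; D; D; D; D; D; D; D; D; D; D; D; D; D; D; D; D; D; D; D; D; D; D; D; D; D; D; D; D; D; D; D; D; D; D; D; D; D; D;
D; D; D; D; D; D; D; D; D; D; D; B [::] [:: D; B [::] [:: B [::] [:: B [::] [:: B [::] [:: L 9 2216338399296]]]]; D;
D; D]; D; D; D; D; D; D; D; D; D; D; D; D; D; D; D; D; D; D; D; D; D; D; D; B [::] [:: B [::] [:: B [::] [:: B [::]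
[:: B [::] [:: L 9 1151241233312]]]]; B [::] [:: B [::] [:: B [::] [:: B [::] [:: L 9 1361610244261]]]]; D; D; D; D;
D]; D; D; D; D; D; D; D; D; D; D; D; D; D; D; D; D; D; D; D; D; D; D; D; D; D; D; D; D; D; D; D; D; D; D; D; D; D; D;
D; D; D; D; D; D; D; D; D; B [::] [:: D; D; D; D; B [::] [:: B [::] [:: B [::] [:: B [::] [:: L 10 2216338399296]]]];
B [::] [:: B [::] [:: B [::] [:: B [::] [:: L 10 189667878435]]]]]; D; D; D; D; D; D; D; D; D; D; D]; B [::
1812625031241] [:: D; D; D; D; D; D; D; D; D; D; D; D; D; D; D; D; D; D; D; D; D; D; D; D; D; D; D; D; D; D; D; D; D;
D; D; D; D; D; D; D; D; D; D; D; D; D; D; D; D; D; D; D; D; D; D; D; D; D; D; D; D; D; D; D; D; D; D; D; D; D; D; D;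
D; D; D; D; D; D; D; D; D; D; D; D; D; D; D; D; D; D; D; D; D; D; D; D; D; D; D; D; D; D; D; D; D; D; D; D; D; D; D;
D; D; D; D; D; D; D; D; D; D; D; D; D; D; D; D; D; D; D; D; D; D; D; D; D; D; D; D; D; D; D; D; D; D; D; D; D; D; D;
D; D; D; D; D; D; D; D; D; D; D; D; D; D; D; D; D; D; D; D; D; D; D; D; D; D; D; D; D; D; D; D; D; D; D; D; D; D; D;
D; D; D; D; D; D; D; D; D; D; D; D; D; D; D; D; D; D; D; D; D; D; D; D; D; D; D; D; D; D; D; D; D; D; D; D; D; D; D;
D; D; D; D; D; D; D; D; D; D; D; D; B [::] [:: D; D; D; D; B [::] [:: B [::] [:: B [::] [:: B [::] [:: L 10
3755925652533]]]]]; D; B [::] [:: D; D; D; D; D; D; D; B [::] [:: B [::] [:: B [::] [:: B [::] [:: L 10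
755044257895]]]]; D; D; D; B [::] [:: B [::] [:: B [::] [:: B [::] [:: L 10 1408429338251]]]]]; D; D; D; D; D; D; D;
D; D; D; D; D; D; D; D; D; D; D; D; D; D; D; D; D; D; D; D; D; D; D; D; D; D; D; D; D; D; D; D; D; D; D; D; D; D; D;
D; D; D; D; D; D; D; D; D; D; D; D; D; D; D; D; D; D; D; D; D; D; D; D; D; D; D; D; D; D; D; D; D; D; D; D; D; D; D;
D; D; D; D; D; D; D; D; D; D; D; D; D; D; D; D; D; D; D; D; D; D; D; D; D; D; D; D; D; D; D; D; D; D; D; D; D; D; D;
D; D; D; D; D; D; D; B [::] [:: B [::] [:: B [::] [:: B [::] [:: B [::] [:: L 10 937009243951]]]]; D; D; D; D; D; B
[::] [:: B [::] [:: B [::] [:: B [::] [:: L 10 2088308165069]]]]; D; D; D]]; B [:: 1221039456355; 1221827526754] [::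
D; B [:: 2217143709760] [::]; D; D; B [:: 2217143709760] [::]; D; D; D; D; D; D; D; D; D; D; D; D; D; D; D; D; D; D;
D; D; D; D; D; D; D; D; D; D; D; D; B [::] [:: D; D; D; D; D; D; D; B [::] [:: B [::] [:: B [::] [:: B [::] [:: L 9
2286634994657]]]]]; D; D; B [:: 2216636194928] [::]; D; D; D; D; D; D; D; D; D; D; D; D; D; B [::] [:: D; B [::] [:: B
[::] [:: B [::] [:: B [::] [:: L 10 3702421465104]]]]; D; D; D; D; D; B [::] [:: B [::] [:: B [::] [:: B [::] [:: L 10
1759699707980]]]]; D; D; D; D]; D; D; D; D; B [::] [:: D; D; D; D; D; D; D; D; B [::] [:: B [::] [:: B [::] [:: B [::]
[:: L 11 2216338399296]]]; B [::] [:: B [::] [:: B [::] [:: L 12 2216338399296]]]]; B [::] [:: B [::] [:: B [::] [:: B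
[::] [:: L 12 1152055102528]]]; B [::] [:: B [::] [:: B [::] [:: L 12 1135333254269]]]]; D; D; B [::] [:: B [::] [:: B
[::] [:: B [::] [:: L 12 1185577400447]]]; B [::] [:: B [::] [:: B [::] [:: L 12 1100991875115]]]]; B [::] [:: B [::]
[:: B [::] [:: B [::] [:: L 12 3352196187145]]]; B [::] [:: B [::] [:: B [::] [:: L 12 1220243376190]]]]; D; D; D; D;
D; D; D; D; D; D; B [::] [:: B [::] [:: B [::] [:: B [::] [:: L 12 3334819520618]]]; B [::] [:: B [::] [:: B [::] [::
L 12 2218144869387]]]]; B [::] [:: B [::] [:: B [::] [:: B [::] [:: L 12 1101064206375]]]; B [::] [:: B [::] [:: B
[::] [:: L 12 3333850907771]]]]; D; D; B [::] [:: B [::] [:: B [::] [:: B [::] [:: L 12 1151113804874]]]; B [::] [:: B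
[::] [:: B [::] [:: L 11 3333902070855]]]]; B [::] [:: B [::] [:: B [::] [:: B [::] [:: L 12 2234594876523]]]; B [::]
[:: B [::] [:: B [::] [:: L 12 2234651544691]]]]; D; D]]]%num.

(* [weightsM] times 128 ^ M: the number of bent (6, M)-functions EA-equivalent to each representative. *)
Definition weights1 := [:: 13888; 1874880; 10499328; 29998080]%num.
Definition weights2 := [:: 79994880; 2159861760; 20158709760; 120952258560; 40317419520; 483809034240;
  552924610560; 184308203520; 23038525440]%num.
Definition weights3 := [:: 319979520; 20158709760; 161269678080; 53756559360; 1290157424640; 9031101972480;
  4515550986240; 18062203944960; 2580314849280; 10321259397120; 10321259397120; 184308203520; 1290157424640]%num.

(** The trie of balanced codes and the derivative tables are arguments, so that call-by-value
    evaluation builds them once for all 1 + 4 + 9 runs. *)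
Definition searches_ok bal dt :=
  [&& tally_is weights1 (search_level (2 ^ 18) bal dt reps1 [:: 1%num] [:: [::]] certs0),
      tally_is weights2 (search_level (2 ^ 18) bal dt reps2 weights1 reps1 certs1)
    & tally_is weights3 (search_level (2 ^ 18) bal dt reps3 weights2 reps2 certs2)].
Lemma searches : searches_ok (balt (nc 3 5) (tzero 5)) dtabs.
Proof. vm_cast_no_check (erefl true). Qed.
Lemma reps_oks : [&& reps_ok 0 [:: [::]], reps_ok 1 reps1 & reps_ok 2 reps2].
Proof. vm_cast_no_check (erefl true). Qed.
Lemma bents_oks : [&& bents_ok 1 reps1, bents_ok 2 reps2 & bents_ok 3 reps3].
Proof. vm_cast_no_check (erefl true). Qed.
Lemma inequivalent2 : invs_ok reps2. Proof. vm_cast_no_check (erefl true). Qed.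
Lemma inequivalent3 : invs_ok reps3. Proof. vm_cast_no_check (erefl true). Qed.

Lemma bents_ok_treen m reps : bents_ok m reps -> all (all (treen 6)) reps.
Proof. by move=> hb; apply/allP => fs; apply: (bents_treen hb). Qed.

Lemma weights_1 : weights 1 (1 * 128) weights1 reps1.
Proof.
have /and3P [s _ _] := searches; have /and3P [r _ _] := reps_oks; have /and3P [b _ _] := bents_oks.
exact: (weights_step weights0 r (bents_ok_treen b) s erefl erefl erefl).
Qed.
Lemma weights_2 : weights 2 (1 * 128 * 128) weights2 reps2.
Proof.
have /and3P [_ s _] := searches; have /and3P [_ r _] := reps_oks; have /and3P [_ b _] := bents_oks.
exact: (weights_step weights_1 r (bents_ok_treen b) s erefl erefl erefl).
Qed.
Lemma weights_3 : weights 3 (1 * 128 * 128 * 128) weights3 reps3.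
Proof.
have /and3P [_ _ s] := searches; have /and3P [_ _ r] := reps_oks; have /and3P [_ _ b] := bents_oks.
exact: (weights_step weights_2 r (bents_ok_treen b) s erefl erefl erefl).
Qed.

Lemma of_nat_mul a b : N.of_nat (a * b) = N.mul (N.of_nat a) (N.of_nat b).
Proof. exact: Nat2N.inj_mul. Qed.
(** The counts are far beyond unary numbers, so [N.of_nat] is pushed down to the weights before
    anything is evaluated. *)
Lemma of_nat_sum (ws : seq N) : N.of_nat (\sum_(w <- ws) N.to_nat w) = foldr N.add 0%num ws.
Proof. by rewrite -[RHS]N2Nat.id to_nat_foldr. Qed.

(** The search prepends the new coordinate while the theorem appends it; exchanging the two blocks
    of coordinates preserves bentness. *)
Lemma extend_row m (F : {ffun 'rV['F_2]_6 -> 'rV['F_2]_m}) : (exists g, bent (rowf g F)) ->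
  exists f : {ffun 'rV['F_2]_6 -> 'rV['F_2]_1},
    bent f /\ bent ([ffun x => row_mx (F x) (f x)] : {ffun 'rV['F_2]_6 -> 'rV['F_2]_(m + 1)}).
Proof. by case=> g hg; exists g; split; [exact: bent_rowfl hg | exact: bent_swap]. Qed.

(* From here on %N is N_scope instead of nat_scope, so that the literals 9%N and 13%N below are of type N. *)
From Stdlib Require Import NArith.
Local Open Scope ring_scope.

Theorem theorem3 :
  (* (1) *)
  (N.of_nat #|bent_set 6 2| = 23392233361244160%num /\ #|EA_classes 6 2| = 9%N) /\
  (* (2) *)
  (N.of_nat #|bent_set 6 3| = 121282113886947901440%num /\ #|EA_classes 6 3| = 13%N) /\
  (* (3), m = 1 *)
  (forall F : {ffun 'rV['F_2]_6 -> 'rV['F_2]_1}, bent F ->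
     exists f : {ffun 'rV['F_2]_6 -> 'rV['F_2]_1},
       bent f /\ bent ([ffun x => row_mx (F x) (f x)] : {ffun 'rV['F_2]_6 -> 'rV['F_2]_2})) /\
  (* (3), m = 2 *)
  (forall F : {ffun 'rV['F_2]_6 -> 'rV['F_2]_2}, bent F ->
     exists f : {ffun 'rV['F_2]_6 -> 'rV['F_2]_1},
       bent f /\ bent ([ffun x => row_mx (F x) (f x)] : {ffun 'rV['F_2]_6 -> 'rV['F_2]_3})).
Proof.
have /and3P [b1 b2 b3] := bents_oks; have /and3P [_ s2 s3] := searches; have /and3P [_ r1 r2] := reps_oks.
split; [split|split; [split|split]].
- by rewrite (card_bents b2 weights_2 erefl) !of_nat_mul of_nat_sum.
- exact: (card_EA_classes b2 weights_2 inequivalent2).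
- by rewrite (card_bents b3 weights_3 erefl) !of_nat_mul of_nat_sum.
- exact: (card_EA_classes b3 weights_3 inequivalent3).
- move=> F hF; have := @extend_row 1 F; apply; apply: (bents_extend weights_1 _ hF) => fs.
  exact: (reps_extend r1 b2 s2 erefl erefl).
move=> F hF; have := @extend_row 2 F; apply; apply: (bents_extend weights_2 _ hF) => fs.
exact: (reps_extend r2 b3 s3 erefl erefl).
Qed.
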